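(* If $\Omega$ is a connected Stein manifold for which there exists a point $z_0\in\Omega$ such that $$\lim_{\Omega\ni z\to\infty_\Omega}c_{\Omega}(z,z_0)=\infty,$$ then $\Omega$ belongs to the class $\mathcal{S}$.
   Context: A Stein manifold is a complex analytic manifold $\Omega$ of finite dimension $N$ such that: $\Omega$ has an exhaustion by compact sets $K_l$ with $K_l\subset\operatorname{int}K_{l+1}$ and $\bigcup_l K_l=\Omega$; the holomorphic hull $\widehat{K}_\Omega=\{z\in\Omega: |f(z)|\le\sup_K|f| \text{ for every } f\in\mathcal{O}(\Omega)\}$ of every compact set $K\subset\Omega$ is compact; holomorphic functions on $\Omega$ separate points; and for each $z\in\Omega$ some holomorphic map $F:\Omega\to\mathbb{C}^N$ has invertible derivative at $z$. $\mathcal{O}(\Omega)$ is the space of holomorphic functions $\Omega\to\mathbb{C}$ with the topology of uniform convergence on compact sets. For holomorphic $\varphi:\Omega\to\Omega$, $C_\varphi:\mathcal{O}(\Omega)\to\mathcal{O}(\Omega)$ is $C_\varphi(f)=f\circ\varphi$. For a self-map $T$, $T^{[n]}$ denotes its $n$-th iterate. ''Increasing'' means strictly increasing. $\mathbb{D}$ is the open unit disc. For $z,w\in\Omega$ put $c_\Omega^*(z,w)=\sup\{|F(z)|: F:\Omega\to\mathbb{D}\text{ holomorphic}, F(w)=0\}$ and $c_\Omega(z,w)=\frac12\log\frac{1+c_\Omega^*(z,w)}{1-c_\Omega^*(z,w)}$ (the Carathéodory pseudodistance). $\infty_\Omega$ is the point added in the one-point compactification of $\Omega$; thus the limit condition means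 that for each $R>0$ there is a compact $L\subset\Omega$ with $c_\Omega(z,z_0)>R$ for all $z\in\Omega\setminus L$. The operator $C_\varphi$ is hypercyclic with respect to an increasing sequence $(n_l)_l\subset\mathbb{N}$ if there is $f\in\mathcal{O}(\Omega)$ such that $\{C_\varphi^{[n_l]}(f): l\in\mathbb{N}\}$ is dense in $\mathcal{O}(\Omega)$. A domain $U\subset\Omega$ is a Runge domain with respect to $\Omega$ if every function in $\mathcal{O}(U)$ can be approximated locally uniformly on $U$ by functions from $\mathcal{O}(\Omega)$. $\mathcal{S}$ is the class of all connected Stein manifolds $\Omega$ such that for every holomorphic $\varphi:\Omega\to\Omega$ and every increasing sequence $(n_l)_l$ of natural numbers: if (c1) $\varphi$ is injective, (c2) $\varphi(\Omega)$ is a Runge domain with respect to $\Omega$, and (c3) the sequence $(\varphi^{[n_l]})_l$ is run-away, i.e. for every compact $K\subset\Omega$ there is $l$ with $\varphi^{[n_l]}(K)\cap K=\varnothing$, then $C_\varphi$ is hypercyclic with respect to $(n_l)_l$. *)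

(* Defs.v *)
From HB Require Import structures.
From mathcomp Require Import all_boot all_order all_algebra.
From mathcomp Require Import complex.
From mathcomp Require Import all_classical all_reals all_analysis.

Set Implicit Arguments.
Unset Strict Implicit.
Unset Printing Implicit Defensive.

Import Order.TTheory GRing.Theory Num.Theory.
Import numFieldNormedType.Exports.
Local Open Scope classical_set_scope.
Local Open Scope ring_scope.

(* The complex numbers over R, typed as a numFieldType rather than as the bare
   carrier R[i]: this is what makes the normed-module structures (of the field
   over itself and of 'rV[Cplx R]_N) inferable.  In particular `differentiable`
   below is Frechet differentiability over the complex field. *)
Definition Cplx (R : realType) : numFieldType := R[i]%C.

(* The real-valued modulus; the generic `|z| takes its values in Cplx R. *)
Definition cmod (R : realType) (z : Cplx R) : R := ComplexField.Normc.normc z.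

(* The functions are total; only chart_fwd on chart_dom, and chart_inv on the
   image of chart_dom, are meaningful. *)
Record chart (M E : topologicalType) := Chart {
  chart_dom : set M;
  chart_fwd : M -> E;
  chart_inv : E -> M;
  chart_dom_open : open chart_dom;
  chart_img_open : open (chart_fwd @` chart_dom);
  chart_fwdK : forall p, chart_dom p -> chart_inv (chart_fwd p) = p;
  chart_fwd_continuous :
    forall p, chart_dom p -> {for p, continuous chart_fwd};
  chart_inv_continuous :
    forall p, chart_dom p -> {for chart_fwd p, continuous chart_inv}
}.

Record complex_manifold (R : realType) (N : nat) := ComplexManifold {
  manifold_space :> topologicalType;
  atlas : set (chart manifold_space 'rV[Cplx R]_N);
  manifold_hausdorff : hausdorff_space manifold_space;
  atlas_cover : forall p, exists2 e, atlas e & chart_dom e p;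
  atlas_holomorphic : forall e e', atlas e -> atlas e' ->
    forall p, chart_dom e p -> chart_dom e' p ->
    differentiable (chart_fwd e' \o chart_inv e) (chart_fwd e p)
}.

Section Holomorphic.
Context {R : realType}.
Local Notation C := (Cplx R).

(* For open U; the values of f outside U are irrelevant. *)
Definition holomorphic_on {N : nat} {M : complex_manifold R N}
    {W : normedModType C} (U : set M) (f : M -> W) : Prop :=
  forall e, atlas e -> forall p, U p -> chart_dom e p ->
    differentiable (f \o chart_inv e) (chart_fwd e p).

Definition holomorphic {N : nat} {M : complex_manifold R N}
    {W : normedModType C} (f : M -> W) : Prop :=
  holomorphic_on [set: M] f.

Definition holomorphic_map {N N' : nat} {M : complex_manifold R N}
    {M' : complex_manifold R N'} (phi : M -> M') : Prop :=
  continuous phi /\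
  forall e e', atlas e -> atlas e' ->
    forall p, chart_dom e p -> chart_dom e' (phi p) ->
    differentiable (chart_fwd e' \o phi \o chart_inv e) (chart_fwd e p).

Lemma near_eq_differentiable (V W : normedModType C) (f g : V -> W) (x : V) :
  (\forall y \near x, f y = g y) -> differentiable f x -> differentiable g x.
Proof.
move=> fg df; have fgx : f x = g x := nbhs_singleton fg.
have dfc := diff_continuous df.
have E : g \o shift x = cst (g x) + 'd f x +o_ 0 id.
  apply/eqaddoP => _/posnumP[eps].
  move/diff_locally : df => /eqaddoP /(_ _ (gt0 eps)).
  have : \forall h \near (0 : V), f (h + x) = g (h + x).
    rewrite (near_shift x) sub0r; apply: filterS fg => y.
    by rewrite /= subrK.
  apply: filterS2 => h fgh.
  by rewrite -fgx !fctE /= fgh.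
apply/diff_locallyP.
by rewrite (diff_unique dfc E).
Qed.

Lemma holomorphic_comp {N N' : nat} {M : complex_manifold R N}
    {M' : complex_manifold R N'} {W : normedModType C}
    (phi : M -> M') (f : M' -> W) :
  holomorphic_map phi -> holomorphic f -> holomorphic (f \o phi).
Proof.
move=> [cphi hphi] hf e Ae p _ ep.
have [e' Ae' e'p] := atlas_cover (phi p).
have dphi := hphi _ _ Ae Ae' _ ep e'p.
have df : differentiable (f \o chart_inv e')
    ((chart_fwd e' \o phi \o chart_inv e) (chart_fwd e p)).
  by rewrite /= chart_fwdK//; exact: hf.
apply: near_eq_differentiable (differentiable_comp dphi df).
have Np : nbhs (phi p) (chart_dom e').
  by apply: open_nbhs_nbhs; split=> //; exact: chart_dom_open.
have Np' : nbhs (chart_inv e (chart_fwd e p)) (phi @^-1` chart_dom e').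
  by rewrite chart_fwdK//; exact: cphi Np.
have := chart_inv_continuous ep Np'; rewrite nbhs_simpl/=.
by apply: filterS => y e'y; rewrite /= chart_fwdK.
Qed.

End Holomorphic.

Section Stein.
Context {R : realType} {N : nat}.
Local Notation C := (Cplx R).
Implicit Type M : complex_manifold R N.

(* For nonempty compact K this sup is a maximum; for K = set0 it is 0, and the
   hull is empty. *)
Definition holomorphic_hull M (K : set M) : set M :=
  [set z | forall f : M -> C, holomorphic f ->
     cmod (f z) <= sup [set cmod (f w) | w in K]].

Definition stein M : Prop :=
  [/\ exists K : nat -> set M,
        [/\ forall l, compact (K l),
            forall l, K l `<=` interior (K l.+1)
          & \bigcup_l K l = [set: M]],
      forall K : set M, compact K -> compact (holomorphic_hull K),
      forall z w : M, z <> w ->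
        exists2 f : M -> C, holomorphic f & f z <> f w
    & forall z : M, exists2 F : M -> 'rV[C]_N, holomorphic F &
        forall e, atlas e -> chart_dom e z ->
          jacobian (F \o chart_inv e) (chart_fwd e z) \in unitmx].

Definition connected_stein M : Prop := connected [set: M] /\ stein M.

(* O(M), as a subspace of the functions M -> C with the topology of uniform
   convergence on compact sets. *)
Definition holo_space M : set {family compact, M -> C} :=
  [set f | holomorphic (f : M -> C)].
Arguments holo_space : clear implicits.

Definition holo_fun M (f : holo_space M) : M -> C := set_val f.

Lemma holo_funP M (f : holo_space M) : holomorphic (holo_fun f).
Proof. exact: (set_mem (valP f)). Qed.

Definition composition_operator M (phi : M -> M) (hphi : holomorphic_map phi)
    (f : holo_space M) : holo_space M :=
  exist _ (holo_fun f \o phi : {family compact, M -> C})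
    (mem_set (holomorphic_comp hphi (holo_funP f))).

Definition hypercyclic_along M (phi : M -> M) (hphi : holomorphic_map phi)
    (n : nat -> nat) : Prop :=
  exists f : holo_space M,
    dense [set iter (n l) (composition_operator hphi) f | l in [set: nat]].

Definition is_domain M (U : set M) : Prop :=
  [/\ open U, connected U & U !=set0].

Definition runge_domain M (U : set M) : Prop :=
  is_domain U /\
  forall f : M -> C, holomorphic_on U f ->
  forall K : set M, compact K -> K `<=` U ->
  forall eps : R, 0 < eps ->
  exists2 g : M -> C, holomorphic g & forall z, K z -> cmod (f z - g z) < eps.

Definition run_away M (phi : M -> M) (n : nat -> nat) : Prop :=
  forall K : set M, compact K ->
    exists l, (iter (n l) phi @` K) `&` K = set0.

Definition class_S M : Prop :=
  connected_stein M /\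
  forall (phi : M -> M) (hphi : holomorphic_map phi) (n : nat -> nat),
    {homo n : i j / (i < j)%N} ->
    injective phi -> runge_domain (range phi) -> run_away phi n ->
    hypercyclic_along hphi n.

Definition caratheodory_star M (z w : M) : R :=
  sup [set cmod (F z) | F in [set F : M -> C |
    [/\ holomorphic F, forall x, cmod (F x) < 1 & F w = 0]]].

(* On a connected manifold caratheodory_star < 1 (by the maximum principle and
   Montel's theorem), so that the quotient is not degenerate. *)
Definition caratheodory M (z w : M) : R :=
  2^-1 * ln ((1 + caratheodory_star z w) / (1 - caratheodory_star z w)).

(* u z tends to +oo as z tends to the point at infinity of the one-point
   compactification `option M`; the value given to u at that point is
   irrelevant, the limit being taken over its punctured neighbourhoods. *)
Definition tends_to_infty_at_infty M (u : M -> R) : Prop :=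
  oapp u 0 x @[x --> (None : one_point_compactification M)^'] --> +oo.

Lemma tends_to_infty_at_inftyP M (u : M -> R) :
  tends_to_infty_at_infty u <->
  forall r : R, 0 < r ->
    exists2 L : set M, compact L & forall z, ~ L z -> r < u z.
Proof.
split=> [/cvgryPgt ugt r r0|H].
  have [L [cL _] Lu] := ugt r; exists L => // z Lz.
  by apply: (Lu (Some z)) => //; left; exists z.
apply/cvgryPgt => A.
have A0 : 0 < Num.max A 1 by rewrite lt_max ltr01 orbT.
have [L cL Lu] := H _ A0.
exists L; first by split=> //; exact: compact_closed (@manifold_hausdorff _ _ M) cL.
move=> [z|] /= Hz nz; last by case/eqP: nz.
case: Hz => [[y Ly [<-]]|//]; apply: le_lt_trans (Lu _ Ly).
by rewrite le_max lexx.
Qed.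

End Stein.

Arguments holo_space {R N} M.

(* Main.v *)
From HB Require Import structures.
Require Import Defs.
From mathcomp Require Import all_boot all_order all_algebra all_solvable all_field.
From mathcomp Require Import ring lra zify complex.
From mathcomp Require Import all_classical all_reals all_analysis.

(* Let psi be an iterate of phi that moves z0 far away. Some holomorphic F from Omega to
   the disc then has F z0 = 0 and |F (psi z0)| close to 1. By the Schwarz-Pick lemma F
   maps a given compact K into a fixed smaller disc and psi K into a small neighbourhood
   of F (psi z0), so iterating t |-> 3 t^2 - 2 t^3 on a normalized power of F gives
   holomorphic functions close to 0 on K and close to 1 on psi K. Since phi is
   injective, every g is h o psi for some h holomorphic on psi Omega (Osgood), and by the
   Runge property h can be taken holomorphic on Omega up to a small error on psi K.
   Gluing f on K and h on psi K with the functions above gives the transitivity of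
   the sequence of composition operators, from which a hypercyclic function is built
   as a limit, along a countable dense set of targets.

   The function theory rests on a maximum principle for functions that are
   differentiable where they do not vanish. It follows from Goursat's bisection applied to
   trapezoidal sums, and it yields Rado's theorem and the Cauchy estimates by means of a
   Poisson kernel discretized at the roots of unity. *)

Set Implicit Arguments.
Unset Strict Implicit.
Unset Printing Implicit Defensive.

Import Order.TTheory GRing.Theory Num.Theory.
Import numFieldNormedType.Exports.
Local Open Scope classical_set_scope.
Local Open Scope ring_scope.

(** * Complex numbers and real-valued norms *)

Section RealNorm.
Context {R : realType}.
Local Notation C := (Cplx R).

(** It suffices to drive the single point [z0] off to infinity. For [F] with values in the disc,
    [F \o psi] has values in the disc too, so [F] maps psi K into the pseudohyperbolic disc about F
    (psi z0) of a radius rho < 1 that depends only on K and z0. Such discs shrink to a point in the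
    Euclidean sense as their centre approaches the unit circle. This dictates the order of choices:
    rho, then the power of [F], then how close to 1 the modulus of F (psi z0) must be, and only then
    psi and F.

    The analytic obstacle is the inverse of an injective holomorphic map: the inverse function
    theorem gives its differentiability only where the Jacobian determinant does not vanish, and
    nothing excludes zeros beforehand. Transported to the image, the determinant is a continuous
    function known to be differentiable only off its zeros, and the maximum principle is stated for
    exactly such functions. Finite sums stand for contour integrals throughout, at the price that
    integral formulas hold only in the limit of fine subdivisions. *)

Definition re (z : C) : R := complex.Re (z : R[i]%C).
Definition im (z : C) : R := complex.Im (z : R[i]%C).
Definition rc (x : R) : C := (x%:C)%C.
Definition ii : C := ('i)%C.
Definition cj (z : C) : C := (z^*)%C.

Lemma eqC (z w : C) : re z = re w -> im z = im w -> z = w.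
Proof. by case: z => a b; case: w => c d; rewrite /re /im /= => -> ->. Qed.

Lemma reD z w : re (z + w) = re z + re w. Proof. by case: z; case: w. Qed.
Lemma imD z w : im (z + w) = im z + im w. Proof. by case: z; case: w. Qed.
Lemma reN z : re (- z) = - re z. Proof. by case: z. Qed.
Lemma imN z : im (- z) = - im z. Proof. by case: z. Qed.
Lemma reB z w : re (z - w) = re z - re w. Proof. by rewrite reD reN. Qed.
Lemma imB z w : im (z - w) = im z - im w. Proof. by rewrite imD imN. Qed.
Lemma reM z w : re (z * w) = re z * re w - im z * im w.
Proof. by case: z; case: w. Qed.
Lemma imM z w : im (z * w) = re z * im w + im z * re w.
Proof. by case: z; case: w => a b c d; rewrite /im/= addrC addrC. Qed.
Lemma re_rc x : re (rc x) = x. Proof. by []. Qed.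
Lemma im_rc x : im (rc x) = 0. Proof. by []. Qed.
Lemma re_ii : re ii = 0. Proof. by []. Qed.
Lemma im_ii : im ii = 1. Proof. by []. Qed.
Lemma re0 : re 0 = 0. Proof. by []. Qed.
Lemma im0 : im 0 = 0. Proof. by []. Qed.
Lemma re1 : re 1 = 1. Proof. by []. Qed.
Lemma im1 : im 1 = 0. Proof. by []. Qed.
Lemma re_cj z : re (cj z) = re z. Proof. by case: z. Qed.
Lemma im_cj z : im (cj z) = - im z. Proof. by case: z. Qed.

Definition reimE := (reD, imD, reN, imN, reM, imM, re_rc, im_rc, re_ii, im_ii,
  re0, im0, re1, im1, re_cj, im_cj).

Lemma rcD x y : rc (x + y) = rc x + rc y.
Proof. by apply: eqC; rewrite !reimE ?addr0. Qed.
Lemma rcN x : rc (- x) = - rc x.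
Proof. by apply: eqC; rewrite !reimE ?oppr0. Qed.
Lemma rcB x y : rc (x - y) = rc x - rc y. Proof. by rewrite rcD rcN. Qed.
Lemma rcM x y : rc (x * y) = rc x * rc y.
Proof. by apply: eqC; rewrite !reimE; ring. Qed.
Lemma rc0 : rc 0 = 0. Proof. by []. Qed.
Lemma rc1 : rc 1 = 1. Proof. by []. Qed.
Lemma rcn n : rc n%:R = n%:R.
Proof. by elim: n => // n IH; rewrite -addn1 !natrD rcD IH. Qed.
Lemma rc_eq0 x : (rc x == 0) = (x == 0).
Proof. by apply/eqP/eqP => [/(congr1 re)//|->]. Qed.
Lemma rcV x : rc x^-1 = (rc x)^-1.
Proof.
have [->|x0] := eqVneq x 0; first by rewrite invr0 rc0 invr0.
apply: (mulfI (x := rc x)); first by rewrite rc_eq0.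
by rewrite -rcM divff// divff ?rc_eq0.
Qed.
Lemma reimrc z : z = rc (re z) + ii * rc (im z).
Proof. by apply: eqC; rewrite !reimE; ring. Qed.
Lemma reMr z x : re (z * rc x) = re z * x. Proof. by rewrite !reimE; ring. Qed.
Lemma re_sum I r (P : pred I) (F : I -> C) :
  re (\sum_(i <- r | P i) F i) = \sum_(i <- r | P i) re (F i).
Proof. by apply: (big_morph re reD re0). Qed.

Lemma cjM z w : cj (z * w) = cj z * cj w.
Proof. by apply: eqC; rewrite !reimE //; ring. Qed.
Lemma cjK z : cj (cj z) = z.
Proof. by apply: eqC; rewrite !reimE //; ring. Qed.
(** The norm of a module over [Cplx R] takes its values in [Cplx R]; its real part determines it
    ([nrmE]) and lives in an ordered field. *)
Definition nrm {V : normedModType C} (v : V) : R := re `|v|.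

Section Nrm.
Context {V : normedModType C}.
Implicit Types v w : V.

Lemma nrmE v : `|v| = rc (nrm v).
Proof.
apply: eqC => //; rewrite im_rc.
by have := normr_ge0 v; rewrite lecE => /andP[/eqP].
Qed.

Lemma nrm_ge0 v : 0 <= nrm v.
Proof. by have := normr_ge0 v; rewrite lecE => /andP[]. Qed.

Lemma nrm0 : nrm (0 : V) = 0. Proof. by rewrite /nrm normr0. Qed.

Lemma nrm_eq0 v : (nrm v == 0) = (v == 0).
Proof. by rewrite -(normr_eq0 v) nrmE rc_eq0. Qed.

Lemma nrm_gt0 v : (0 < nrm v) = (v != 0).
Proof. by rewrite lt_neqAle nrm_ge0 andbT eq_sym nrm_eq0. Qed.

Lemma nrmD v w : nrm (v + w) <= nrm v + nrm w.
Proof. by have := ler_normD v w; rewrite !nrmE -rcD lecR. Qed.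

Lemma nrmN v : nrm (- v) = nrm v. Proof. by rewrite /nrm normrN. Qed.

Lemma nrmB v w : nrm (v - w) <= nrm v + nrm w.
Proof. by rewrite -(nrmN w) nrmD. Qed.

Lemma nrmC v w : nrm (v - w) = nrm (w - v).
Proof. by rewrite -nrmN opprB. Qed.

Lemma nrm_tri u v w : nrm (u - w) <= nrm (u - v) + nrm (v - w).
Proof. by have := nrmD (u - v) (v - w); rewrite addrA subrK. Qed.

Lemma nrm_sum I r (P : pred I) (F : I -> V) :
  nrm (\sum_(i <- r | P i) F i) <= \sum_(i <- r | P i) nrm (F i).
Proof.
elim/big_rec2 : _ => [|i y x _ le]; first by rewrite nrm0.
by apply: le_trans (nrmD _ _) _; rewrite lerD2l.
Qed.

End Nrm.

Lemma nrmcM (z w : C) : nrm (z * w) = nrm z * nrm w.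
Proof. by apply: complexI; rewrite -/(rc _) -/(rc _) -nrmE normrM !nrmE -rcM. Qed.

Lemma nrmZ {V : normedModType C} (a : C) (v : V) : nrm (a *: v) = nrm a * nrm v.
Proof. by apply: complexI; rewrite -/(rc _) -/(rc _) -nrmE normrZ !nrmE -rcM. Qed.

Lemma nrm_rc x : nrm (rc x) = `|x|.
Proof. by rewrite /nrm normc_def /re /= expr0n addr0 sqrtr_sqr. Qed.

Lemma nrm1 : nrm (1 : C) = 1. Proof. by rewrite -rc1 nrm_rc normr1. Qed.

Lemma nrmX (z : C) n : nrm (z ^+ n) = nrm z ^+ n.
Proof. by elim: n => [|n IH]; rewrite ?expr0 ?nrm1 // !exprS nrmcM IH. Qed.

Lemma nrmV (z : C) : nrm z^-1 = (nrm z)^-1.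
Proof.
by apply: complexI; rewrite -/(rc _) -/(rc _) -nrmE normfV !nrmE -rcV.
Qed.

Lemma nrm_ii : nrm ii = 1.
Proof. by rewrite /nrm normc_def /re /= expr0n expr1n add0r sqrtr1. Qed.

Lemma nrm_n n : nrm (n%:R : C) = n%:R.
Proof. by rewrite -rcn nrm_rc ger0_norm. Qed.

Lemma nrm_sqr (z : C) : nrm z ^+ 2 = re z ^+ 2 + im z ^+ 2.
Proof.
rewrite /nrm normc_def /re /= sqr_sqrtr ?addr_ge0 ?sqr_ge0//.
Qed.

Lemma nrm_cj (z : C) : nrm (cj z) = nrm z.
Proof.
apply/eqP; rewrite -(@eqrXn2 _ 2) ?nrm_ge0// !nrm_sqr re_cj im_cj sqrrN //.
Qed.

Lemma mul_cj (z : C) : z * cj z = rc (nrm z ^+ 2).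
Proof. by rewrite nrm_sqr; apply: eqC; rewrite !reimE; ring. Qed.

Lemma cmodE (z : C) : cmod z = nrm z.
Proof.
by rewrite /nrm normc_def; case: z.
Qed.

Lemma re_le (z : C) : `|re z| <= nrm z.
Proof.
rewrite -(@ler_sqr _ _ _) ?nnegrE ?nrm_ge0// real_normK ?num_real// nrm_sqr.
by rewrite lerDl sqr_ge0.
Qed.

Lemma im_le (z : C) : `|im z| <= nrm z.
Proof.
rewrite -(@ler_sqr _ _ _) ?nnegrE ?nrm_ge0// real_normK ?num_real// nrm_sqr.
by rewrite lerDr sqr_ge0.
Qed.

Lemma nrm_le_reim (z : C) : nrm z <= `|re z| + `|im z|.
Proof.
rewrite {1}(reimrc z); apply: le_trans (nrmD _ _) _.
by rewrite nrmcM nrm_ii mul1r !nrm_rc.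
Qed.

End RealNorm.

(** * Continuity and differentiability in epsilon-delta form *)

Section Topo.
Context {R : realType}.
Local Notation C := (Cplx R).

Lemma nbhs_nrm {V : normedModType C} (p : V) (A : set V) :
  nbhs p A <-> exists2 e : R, 0 < e & forall x, nrm (x - p) < e -> A x.
Proof.
split=> [/nbhs_ballP[e/= e0 eA]|[e e0 eA]].
  have eE : e = rc (re e).
    by apply: eqC => //; rewrite im_rc; move: e0; rewrite ltcE => /andP[/eqP].
  exists (re e); first by move: e0; rewrite ltcE => /andP[].
  move=> x xp; apply: eA; rewrite -ball_normE /ball_ /=.
  by rewrite nrmE eE ltcR nrmC.
apply/nbhs_ballP; exists (rc e) => /=; first by rewrite ltcR.
move=> x; rewrite -ball_normE /ball_ /= nrmE ltcR nrmC; exact: eA.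
Qed.

Lemma cont_nrm {V W : normedModType C} (f : V -> W) (p : V) :
  {for p, continuous f} <->
  forall e : R, 0 < e -> exists2 d : R, 0 < d &
    forall x, nrm (x - p) < d -> nrm (f x - f p) < e.
Proof.
split=> [cf e e0|H A].
  have /cf : nbhs (f p) [set y | nrm (y - f p) < e] by apply/nbhs_nrm; exists e.
  by rewrite nbhs_simpl /= => /nbhs_nrm[d d0 H]; exists d.
move=> /nbhs_nrm[e e0 eA]; have [d d0 dH] := H e e0.
by rewrite nbhs_simpl; apply/nbhs_nrm; exists d => // x /dH /eA.
Qed.

Lemma diff_nrm {V W : normedModType C} (f : V -> W) (p : V) :
  differentiable f p -> forall e : R, 0 < e -> exists2 d : R, 0 < d &
    forall h, nrm h < d -> nrm (f (p + h) - f p - 'd f p h) <= e * nrm h.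
Proof.
move=> df e e0; move/diff_locally : df => /eqaddoP /(_ (rc e)).
rewrite ltcR => /(_ e0) /nbhs_nrm[d d0 H]; exists d => // h hd.
have := H h; rewrite subr0 => /(_ hd) /=.
by rewrite !fctE /= !nrmE -rcM lecR opprD addrA [h + p]addrC.
Qed.

(** The bound on [L] supplies the continuity that Frechet differentiability demands of its linear
    part in a general normed module. *)
Lemma nrm_diff {V W : normedModType C} (f : V -> W) (p : V)
    (L : {linear V -> W}) (K : R) :
  (forall h, nrm (L h) <= K * nrm h) ->
  (forall e : R, 0 < e -> exists2 d : R, 0 < d &
    forall h, nrm h < d -> nrm (f (p + h) - f p - L h) <= e * nrm h) ->
  differentiable f p /\ 'd f p = L :> (V -> W).
Proof.
move=> LK H.
have cL : continuous L.
  move=> x; apply/cont_nrm => e e0; exists (e / (`|K| + 1)).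
    by rewrite divr_gt0// ltr_wpDl.
  move=> y yx; rewrite -linearB; apply: le_lt_trans (LK _) _.
  apply: le_lt_trans (_ : (`|K| + 1) * nrm (y - x) < _).
    by rewrite ler_wpM2r ?nrm_ge0// (le_trans (ler_norm _))// lerDl.
  by rewrite mulrC -ltr_pdivlMr// ltr_wpDl.
have E : f \o shift p = cst (f p) + L +o_ 0 id.
  apply/eqaddoP => e e0.
  have eE : e = rc (re e).
    by apply: eqC => //; rewrite im_rc; move: e0; rewrite ltcE => /andP[/eqP].
  have e0' : 0 < re e by move: e0; rewrite ltcE => /andP[].
  have [d d0 dH] := H _ e0'; apply/nbhs_nrm; exists d => // h; rewrite subr0.
  move=> /dH; rewrite !fctE /= !nrmE eE -rcM lecR opprD addrA [h + p]addrC //.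
have dL := diff_unique cL E.
split=> //; apply/diff_locallyP; rewrite dL; split => //.
Qed.

End Topo.

(** * Goursat's lemma on squares *)

Section Goursat.
Context {R : realType}.
Local Notation C := (Cplx R).

Lemma expr_lt_eps (q M e : R) : 0 <= q < 1 -> 0 < e ->
  exists n0, forall n, (n0 <= n)%N -> M * q ^+ n < e.
Proof.
move=> /andP[q0 q1] e0.
have : (fun n => M * q ^+ n) @ \oo --> M * 0.
  by apply: cvgM; [exact: cvg_cst|apply: cvg_expr; rewrite ger0_norm].
rewrite mulr0 => /cvgr_lt /(_ _ e0)[n0 _ H]; exists n0 => n; exact: H.
Qed.

Definition insq (a : C) (s : R) (z : C) :=
  (re a <= re z <= re a + s) /\ (im a <= im z <= im a + s).

Let h (s : R) := s / 2.

(** If [P] failed on the square it would fail on one of the quarters, then on a quarter of that one,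
    and so on; these squares shrink to a common point, near which [P] holds by the local
    hypothesis. *)
Lemma square_bisection (P : C -> R -> Prop) (a : C) (s : R) : 0 < s ->
  (forall a s, P a (h s) -> P (a + rc (h s)) (h s) ->
     P (a + ii * rc (h s)) (h s) -> P (a + rc (h s) + ii * rc (h s)) (h s) ->
     P a s) ->
  (forall z, insq a s z -> exists2 d, 0 < d & forall a' s', 0 < s' -> s' < d ->
     insq a' s' z -> P a' s') ->
  P a s.
Proof.
move=> s0 Pq Ploc; apply: contrapT => nP.
pose good (x : C * R) (y : C * R) := [/\ y.2 = h x.2, ~ P y.1 y.2,
  re x.1 <= re y.1 <= re x.1 + h x.2 & im x.1 <= im y.1 <= im x.1 + h x.2].
have step x : ~ P x.1 x.2 -> 0 < x.2 -> exists y, good x y.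
  case: x => b t /= nPt t0; have ht : 0 <= h t by rewrite /h divr_ge0// ltW.
  apply: contrapT => ny; apply: nPt; apply: Pq; apply: contrapT => nb; apply: ny;
  [exists (b, h t)|exists (b + rc (h t), h t)|exists (b + ii * rc (h t), h t)
   |exists (b + rc (h t) + ii * rc (h t), h t)]; split=> //=; rewrite ?reimE; lra.
have [nxt nxtP] : {nxt & forall x, ~ P x.1 x.2 -> 0 < x.2 -> good x (nxt x)}.
  apply: (@choice _ _ (fun x y => ~ P x.1 x.2 -> 0 < x.2 -> good x y)) => x.
  by have [H|H] := pselect (~ P x.1 x.2 /\ 0 < x.2);
    [have [y gy] := step x H.1 H.2; exists y|exists x => ? ?; case: H].
pose u n := iter n nxt (a, s).
have uP n : ~ P (u n).1 (u n).2 /\ (u n).2 = s / 2 ^+ n.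
  elim: n => [|n [IH1 IH2]]; first by rewrite expr0 divr1.
  have u0 : 0 < (u n).2 by rewrite IH2 divr_gt0// exprn_gt0.
  have [E nPn _ _] := nxtP _ IH1 u0; split=> //; rewrite -[u n.+1]/(nxt (u n)) E.
  by rewrite /h IH2 exprSr invfM mulrA.
have u0 n : 0 < (u n).2 by rewrite (uP n).2 divr_gt0// exprn_gt0.
have uS n : good (u n) (u n.+1) by apply: nxtP; [exact: (uP n).1|exact: u0].
(* In each coordinate [p] the lower ends increase and the upper ends decrease, so every lower end is
   below every upper end. *)
have mon (p : C -> R) : (forall n, p (u n).1 <= p (u n.+1).1 <= p (u n).1 + h (u n).2) ->
    forall i j, p (u i).1 <= p (u j).1 + (u j).2.
  move=> pS i j.
  have up m k : p (u m).1 <= p (u (m + k)%N).1.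
    elim: k => [|k IH]; rewrite ?addn0// addnS (le_trans IH)//.
    by have /andP[] := pS (m + k)%N.
  have dn m k : p (u (m + k)%N).1 + (u (m + k)%N).2 <= p (u m).1 + (u m).2.
    elim: k => [|k IH]; rewrite ?addn0// addnS (le_trans _ IH)//.
    have [E _ _ _] := uS (m + k)%N.
    have /andP[_ le] := pS (m + k)%N; rewrite E; move: le; rewrite /h; lra.
  apply: le_trans (up i j) _; apply: le_trans (dn j i).
  by rewrite addnC lerDl ltW.
have lim (p : C -> R) : (forall n, p (u n).1 <= p (u n.+1).1 <= p (u n).1 + h (u n).2) ->
    exists l, forall n, p (u n).1 <= l <= p (u n).1 + (u n).2.
  move=> /mon pm; pose A := [set p (u n).1 | n in setT].
  have A0 : A !=set0 by exists (p (u 0%N).1); exists 0%N.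
  have Au j : ubound A (p (u j).1 + (u j).2) by move=> _ [i _ <-]; exact: pm.
  exists (sup A) => n; apply/andP; split.
    by apply: ub_le_sup; [exists (p (u 0%N).1 + (u 0%N).2)|exists n].
  by apply: ge_sup.
have [x xP] := lim re (fun n => let: And4 _ _ r _ := uS n in r).
have [y yP] := lim im (fun n => let: And4 _ _ _ r := uS n in r).
have [d d0 dP] : exists2 d, 0 < d & forall a' s', 0 < s' -> s' < d ->
     insq a' s' (rc x + ii * rc y) -> P a' s'.
  apply: Ploc; rewrite /insq !reimE.
  have := xP 0%N; have := yP 0%N; rewrite /=; lra.
have [n nd] : exists n, s / 2 ^+ n < d.
  have [] := @expr_lt_eps 2^-1 s d _ d0; first by lra.
  by move=> n /(_ n (leqnn n)); rewrite exprVn; exists n.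
case: (uP n) => nPn E; apply: nPn; apply: dP; rewrite ?E//.
  by rewrite divr_gt0// exprn_gt0.
rewrite -E /insq !reimE.
have := xP n; have := yP n; lra.
Qed.

(* Twice the trapezoidal sum of [f] along [[a, b]] with [2 ^ k] steps: it is exact on
   affine functions and additive under subdivision, so no integral is needed. *)
Fixpoint trap (k : nat) (f : C -> C) (a b : C) : C :=
  if k is k'.+1 then trap k' f a ((a + b) / 2) + trap k' f ((a + b) / 2) b
  else (f a + f b) * (b - a).

Definition seg (a b z : C) := exists2 t : R, 0 <= t <= 1 & z = a + rc t * (b - a).

Lemma two_neq0 : (2 : C) != 0. Proof. by rewrite pnatr_eq0. Qed.

Lemma seg_mid a b z :
  seg a ((a + b) / 2) z \/ seg ((a + b) / 2) b z -> seg a b z.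
Proof.
have h2 := two_neq0.
case=> -[t t01 ->].
  exists (t / 2); first lra.
  by rewrite rcM rcV rcn; field.
exists ((1 + t) / 2); first lra.
by rewrite rcM rcV rcD rcn rc1; field.
Qed.

Lemma trapN k f a b : trap k f b a = - trap k f a b.
Proof.
elim: k a b => [|k IH] a b /=; first by ring.
by rewrite (addrC b a) IH [in X in _ + X]IH; ring.
Qed.

Lemma trapD k (f g : C -> C) a b :
  trap k (fun z => f z + g z) a b = trap k f a b + trap k g a b.
Proof. by elim: k a b => [|k IH] a b /=; rewrite ?IH; ring. Qed.

Lemma trap_lin k (al be : C) a b :
  trap k (fun z => al * z + be) a b = (al * (a + b) + 2 * be) * (b - a).
Proof.
have h2 := two_neq0.
by elim: k a b => [|k IH] a b /=; rewrite ?IH; [ring|field].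
Qed.

Lemma half_nrm (a b : C) : nrm ((a + b) / 2 - a) = nrm (b - a) / 2 /\
  nrm (b - (a + b) / 2) = nrm (b - a) / 2.
Proof.
have h2 := two_neq0.
by split; rewrite -[RHS]mulrC -(nrm_n 2) -nrmV -nrmcM; congr nrm; field.
Qed.

Lemma trap_bound k f a b M : (forall z, seg a b z -> nrm (f z) <= M) ->
  nrm (trap k f a b) <= 2 * M * nrm (b - a).
Proof.
elim: k a b => [|k IH] a b fM /=.
  rewrite nrmcM ler_wpM2r ?nrm_ge0//; apply: le_trans (nrmD _ _) _.
  rewrite mulr_natl mulr2n; apply: lerD; apply: fM; [exists 0|exists 1].
  - lra.
  - by rewrite rc0; ring.
  - lra.
  - by rewrite rc1; ring.
apply: le_trans (nrmD _ _) _.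
have [E1 E2] := half_nrm a b.
have /IH H1 : forall z, seg a ((a + b) / 2) z -> nrm (f z) <= M.
  by move=> z sz; apply: fM; apply: seg_mid; left.
have /IH H2 : forall z, seg ((a + b) / 2) b z -> nrm (f z) <= M.
  by move=> z sz; apply: fM; apply: seg_mid; right.
move: H1 H2; rewrite E1 E2; set x := nrm (b - a); lra.
Qed.

(** With [d] the direction of the segment, [f z * d] is the integrand; the imaginary part of the sum
    is monotone in that of the integrand. *)
Lemma trap_im k f a b (d : C) (m L : R) : 0 <= L -> b - a = rc L * d ->
  (forall z, seg a b z -> m <= im (f z * d)) ->
  2 * m * L <= im (trap k f a b).
Proof.
have h2 := two_neq0.
elim: k a b L => [|k IH] a b L L0 bd fm /=.
  have fa : m <= im (f a * d) by apply: fm; exists 0; [lra|rewrite rc0; ring].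
  have fb : m <= im (f b * d) by apply: fm; exists 1; [lra|rewrite rc1; ring].
  have -> : (f a + f b) * (b - a) = (f a * d + f b * d) * rc L by rewrite bd; ring.
  move: fa fb; set x := f a * d; set y := f b * d; rewrite !reimE; nra.
have E1 : (a + b) / 2 - a = rc (L / 2) * d.
  have -> : (a + b) / 2 - a = (b - a) / 2 by field.
  by rewrite bd rcM rcV rcn; field.
have E2 : b - (a + b) / 2 = rc (L / 2) * d.
  have -> : b - (a + b) / 2 = (b - a) / 2 by field.
  by rewrite bd rcM rcV rcn; field.
have L20 : 0 <= L / 2 by lra.
have H1 := IH _ _ _ L20 E1 (fun z sz => fm z (seg_mid (or_introl sz))).
have H2 := IH _ _ _ L20 E2 (fun z sz => fm z (seg_mid (or_intror sz))).
by move: H1 H2; rewrite imD; nra.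
Qed.

Definition sqtrap k f (a : C) (s : R) :=
  trap k f a (a + rc s) + trap k f (a + rc s) (a + rc s + ii * rc s) +
  trap k f (a + rc s + ii * rc s) (a + ii * rc s) + trap k f (a + ii * rc s) a.

(** Each inner side is traversed twice in opposite directions and cancels; the outer sides are the
    halves of the given ones, which costs one level of [k]. *)
Lemma sqtrapS k f a s : sqtrap k.+1 f a s =
  sqtrap k f a (h s) + sqtrap k f (a + rc (h s)) (h s) +
  sqtrap k f (a + ii * rc (h s)) (h s) +
  sqtrap k f (a + rc (h s) + ii * rc (h s)) (h s).
Proof.
have h2 := two_neq0.
rewrite /sqtrap /=; set t := rc (h s); have -> : rc s = 2 * t.
  by rewrite /t /h rcM rcV rcn; field.
set c := ii.
have -> : (a + (a + 2 * t)) / 2 = a + t by field.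
have -> : (a + 2 * t + (a + 2 * t + c * (2 * t))) / 2 = a + 2 * t + c * t by field.
have -> : (a + 2 * t + c * (2 * t) + (a + c * (2 * t))) / 2 = a + t + c * (2 * t).
  by field.
have -> : (a + c * (2 * t) + a) / 2 = a + c * t by field.
have -> : a + t + t = a + 2 * t by ring.
have -> : a + c * t + t = a + t + c * t by ring.
have -> : a + c * t + c * t = a + c * (2 * t) by ring.
have -> : a + t + c * t + t = a + 2 * t + c * t by ring.
have -> : a + t + c * t + c * t = a + t + c * (2 * t) by ring.
have -> : a + 2 * t + c * t + c * t = a + 2 * t + c * (2 * t) by ring.
rewrite (trapN k f (a + t) (a + t + c * t)) (trapN k f (a + t + c * t) (a + c * t)).
rewrite (trapN k f (a + t + c * t) (a + t + c * (2 * t))).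
rewrite (trapN k f (a + 2 * t + c * t) (a + t + c * t)).
ring.
Qed.

Definition onsq (a : C) (s : R) (z : C) :=
  seg a (a + rc s) z \/ seg (a + rc s) (a + rc s + ii * rc s) z \/
  seg (a + rc s + ii * rc s) (a + ii * rc s) z \/ seg (a + ii * rc s) a z.

Lemma onsq_insq a s : 0 <= s -> forall z, onsq a s z -> insq a s z.
Proof.
move=> s0 z; rewrite /insq.
by case=> [|[|[|]]] [t /andP[t0 t1] ->]; rewrite !reimE; nra.
Qed.

Lemma sqtrap_bound k f a s M : 0 <= s ->
  (forall z, onsq a s z -> nrm (f z) <= M) ->
  nrm (sqtrap k f a s) <= 8 * M * s.
Proof.
move=> s0 fM.
have b (x y : C) : nrm (y - x) = s ->
    (forall z, seg x y z -> onsq a s z) -> nrm (trap k f x y) <= 2 * M * s.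
  by move=> E H; rewrite -[X in _ * X]E; apply: trap_bound => z sz; apply: fM; exact: H.
have ns : nrm (rc s) = s by rewrite nrm_rc ger0_norm.
have nis : nrm (ii * rc s) = s by rewrite nrmcM nrm_ii mul1r.
have b1 : nrm (trap k f a (a + rc s)) <= 2 * M * s.
  apply: b => [|z sz]; last by left.
  by rewrite -[RHS]ns; congr nrm; ring.
have b2 : nrm (trap k f (a + rc s) (a + rc s + ii * rc s)) <= 2 * M * s.
  apply: b => [|z sz]; last by right; left.
  by rewrite -[RHS]nis; congr nrm; ring.
have b3 : nrm (trap k f (a + rc s + ii * rc s) (a + ii * rc s)) <= 2 * M * s.
  apply: b => [|z sz]; last by right; right; left.
  by rewrite -[RHS]ns -[RHS]nrmN; congr nrm; ring.
have b4 : nrm (trap k f (a + ii * rc s) a) <= 2 * M * s.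
  apply: b => [|z sz]; last by right; right; right.
  by rewrite -[RHS]nis -[RHS]nrmN; congr nrm; ring.
rewrite /sqtrap; move: b1 b2 b3 b4.
set x1 := trap _ _ _ _; set x2 := trap _ _ _ _; set x3 := trap _ _ _ _.
set x4 := trap _ _ _ _ => b1 b2 b3 b4.
have := nrmD (x1 + x2 + x3) x4; have := nrmD (x1 + x2) x3; have := nrmD x1 x2.
move: b1 b2 b3 b4; set n1 := nrm x1; set n2 := nrm x2; set n3 := nrm x3.
set n4 := nrm x4; lra.
Qed.

Lemma sqtrapD k (f g : C -> C) a s :
  sqtrap k (fun z => f z + g z) a s = sqtrap k f a s + sqtrap k g a s.
Proof. by rewrite /sqtrap !trapD; ring. Qed.

Lemma insq_diam a s z w : insq a s z -> insq a s w -> nrm (z - w) <= 2 * s.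
Proof.
move=> [z1 z2] [w1 w2]; apply: le_trans (nrm_le_reim _) _; rewrite !reimE.
have -> : 2 * s = s + s by ring.
by apply: lerD; rewrite ler_norml; lra.
Qed.

Lemma linear1 (L : {linear C -> C}) x : L x = L 1 * x.
Proof. by rewrite -{1}(mulr1 x) -[x * 1]/(x *: (1 : C)) linearZ /= mulrC. Qed.

(** The sum need not vanish for a fixed [k], so the conclusion is smallness for all large [k]. Each
    quartering consumes one level of [k], and the thresholds of the four quarters are added. *)
Lemma goursat (f : C -> C) a s : 0 < s ->
  (forall z, insq a s z -> differentiable f z) ->
  forall e : R, 0 < e -> exists k0, forall k, (k0 <= k)%N ->
    nrm (sqtrap k f a s) <= e * s ^+ 2.
Proof.
move=> s0 df e e0.
apply: (@square_bisection (fun a s => exists k0, forall k, (k0 <= k)%N ->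
    nrm (sqtrap k f a s) <= e * s ^+ 2)) => //.
  move=> {s0 df} {}a {}s [k1 H1] [k2 H2] [k3 H3] [k4 H4].
  exists (k1 + k2 + k3 + k4).+1 => -[//|k] kk.
  have {H1} := H1 k (ltac:(lia)); have {H2} := H2 k (ltac:(lia)).
  have {H3} := H3 k (ltac:(lia)); have {H4} := H4 k (ltac:(lia)).
  rewrite sqtrapS.
  set x1 := sqtrap _ _ _ _; set x2 := sqtrap _ _ _ _; set x3 := sqtrap _ _ _ _.
  set x4 := sqtrap _ _ _ _ => b4 b3 b2 b1.
  have := nrmD (x4 + x3 + x2) x1; have := nrmD (x4 + x3) x2; have := nrmD x4 x3.
  move: b1 b2 b3 b4; set n1 := nrm x1; set n2 := nrm x2; set n3 := nrm x3.
  set n4 := nrm x4; rewrite /h; nra.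
(* On a square of side [t] the remainder of the linear approximation is at most [e / 16 * (2 * t)],
   and [sqtrap_bound] multiplies it by [8 * t], which gives [e * t ^+ 2]. *)
move=> z zs; have [d d0 dP] := diff_nrm (df z zs) (divr_gt0 e0 (ltr0n _ 16)).
exists (d / 2); first lra.
move=> b t t0 td zbt; exists 0%N => k _.
set L := 'd f z : C -> C in dP.
have LE x : L x = L 1 * x by rewrite /L linear1.
(* The sum of an affine function around a closed polygon is 0, so only the remainder counts. *)
have -> : sqtrap k f b t = sqtrap k (fun w => f w - f z - L (w - z)) b t.
  pose g (w : C) := f w - f z - L (w - z).
  have fE : f = fun w => g w + (L 1 * w + (f z - L 1 * z)).
    apply/funext => w; rewrite /g (LE (w - z)).
    by generalize (L 1 : C) (f w) (f z) => x y y'; ring.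
  rewrite {1}fE sqtrapD -/g; set x := sqtrap k _ b t.
  by rewrite /sqtrap !trap_lin; ring.
apply: le_trans (_ : 8 * (e / 16 * (2 * t)) * t <= _); last by rewrite -subr_ge0; nra.
apply: sqtrap_bound; first exact: ltW.
move=> w /(onsq_insq (ltW t0)) wbt; have wz := insq_diam wbt zbt.
have := dP (w - z); rewrite [z + _]addrC subrK => H.
apply: le_trans (H _) _; first by apply: le_lt_trans wz _; lra.
by rewrite ler_wpM2l//; lra.
Qed.

(** Substitute for the integral 2 pi i around a pole. On a side of direction [d] the imaginary part
    of d / (z - w) is r / |z - w|^2, which is at least 1 / (2 r) since |z - w|^2 <= 2 r^2; each of
    the four sides thus contributes 2, whatever [k] is. *)
Lemma sqtrap_inv (w : C) (r : R) k : 0 < r ->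
  8 <= im (sqtrap k (fun z => (z - w)^-1) (w - rc r - ii * rc r) (2 * r)).
Proof.
move=> r0; set a := _ - ii * _; set F := fun z => _.
have imF (z d : C) : im (F z * d) =
    (im d * re (z - w) - re d * im (z - w)) / nrm (z - w) ^+ 2.
  have [zw|zw] := eqVneq (z - w) 0.
    by rewrite /F zw invr0 mul0r nrm0 expr0n invr0 mulr0 im0.
  have -> : F z = cj (z - w) * rc (nrm (z - w) ^+ 2)^-1.
    by rewrite rcV -mul_cj invfM mulrCA divff ?mulr1// -nrm_eq0 nrm_cj nrm_eq0.
  rewrite -mulrA [rc _ * d]mulrC mulrA; set y := rc _; rewrite imM re_rc im_rc.
  by rewrite imM re_cj im_cj; ring.
have side (z d : C) : (im d * re (z - w) - re d * im (z - w) = r) ->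
    nrm (z - w) ^+ 2 <= 2 * r ^+ 2 -> 1 / (2 * r) <= im (F z * d).
  move=> Hd Hz; rewrite imF Hd ler_pdivlMr; last first.
    rewrite lt_neqAle sqr_ge0 andbT eq_sym sqrf_eq0 nrm_eq0; apply/eqP => zw.
    by move: Hd; rewrite zw re0 im0; lra.
  apply: le_trans (_ : 1 / (2 * r) * (2 * r ^+ 2) <= _).
    by rewrite ler_wpM2l// divr_ge0//; lra.
  by rewrite le_eqVlt; apply/orP; left; apply/eqP; field; lra.
have r20 : 0 <= 2 * r by lra.
have fin x y d : y - x = rc (2 * r) * d ->
   (forall z, seg x y z -> 1 / (2 * r) <= im (F z * d)) -> 2 <= im (trap k F x y).
  move=> xy H; have := trap_im k r20 xy H.
  by rewrite -mulrA mulfVK ?mulr1//; lra.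
have r2E : rc (2 * r) = 2 * rc r by rewrite rcM rcn.
have H t : 0 <= t <= 1 -> 0 <= t * (1 - t) * r ^+ 2.
  by move=> t01; rewrite mulr_ge0 ?sqr_ge0//; nra.
rewrite /sqtrap !imD.
have b1 : 2 <= im (trap k F a (a + rc (2 * r))).
  apply: (@fin _ _ 1) => [|z [t t01 ->]]; first by ring.
  have tt := H t t01; by apply: side; rewrite ?nrm_sqr /a !reimE; [ring|nra].
have b2 : 2 <= im (trap k F (a + rc (2 * r)) (a + rc (2 * r) + ii * rc (2 * r))).
  apply: (@fin _ _ ii) => [|z [t t01 ->]]; first by ring.
  have tt := H t t01; by apply: side; rewrite ?nrm_sqr /a !reimE; [ring|nra].
have b3 : 2 <= im (trap k F (a + rc (2 * r) + ii * rc (2 * r)) (a + ii * rc (2 * r))).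
  apply: (@fin _ _ (-1)) => [|z [t t01 ->]]; first by ring.
  have tt := H t t01; by apply: side; rewrite ?nrm_sqr /a !reimE; [ring|nra].
have b4 : 2 <= im (trap k F (a + ii * rc (2 * r)) a).
  apply: (@fin _ _ (- ii)) => [|z [t t01 ->]]; first by ring.
  have tt := H t t01; by apply: side; rewrite ?nrm_sqr /a !reimE; [ring|nra].
lra.
Qed.
End Goursat.

(** * The maximum principle *)

Section MaxPrinciple.
Context {R : realType}.
Local Notation C := (Cplx R).

Lemma cont_nrmR {V : normedModType C} (v : V -> R) (p : V) :
  {for p, continuous v} <->
  forall e : R, 0 < e -> exists2 d : R, 0 < d &
    forall x, nrm (x - p) < d -> `|v x - v p| < e.
Proof.
split=> [cv e e0|H].
  move/cvgrPdist_lt: cv => /(_ e e0) /nbhs_nrm[d d0 dH].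
  by exists d => // x /dH; rewrite distrC.
apply/cvgrPdist_lt => e e0; have [d d0 dH] := H e e0.
by apply/nbhs_nrm; exists d => // x /dH; rewrite distrC.
Qed.

Lemma cont_nrmfun {V W : normedModType C} (f : V -> W) (p : V) :
  {for p, continuous f} -> {for p, continuous (fun x => nrm (f x))}.
Proof.
move=> /cont_nrm cf; apply/cont_nrmR => e /cf[d d0 dH]; exists d => // x /dH.
apply: le_lt_trans; rewrite ler_norml lerBlDr.
have := nrmD (f x - f p) (f p); have := nrmD (f p - f x) (f x).
by rewrite !subrK nrmC => ? ?; apply/andP; split; lra.
Qed.

Section PointwiseRules.
Context {V : normedModType C}.
Implicit Types (f g : V -> C) (x : V).

Lemma dfC (a : C) x : differentiable (fun _ : V => a) x.
Proof. exact: differentiable_cst. Qed.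

Lemma dfid (x : C) : differentiable (fun z : C => z) x.
Proof. by apply: (@linear_differentiable _ _ _ idfun) => y; exact: cvg_id. Qed.

Lemma dfD f g x : differentiable f x -> differentiable g x ->
  differentiable (fun y => f y + g y) x.
Proof. exact: differentiableD. Qed.

Lemma dfB f g x : differentiable f x -> differentiable g x ->
  differentiable (fun y => f y - g y) x.
Proof. exact: differentiableB. Qed.

Lemma dfM f g x : differentiable f x -> differentiable g x ->
  differentiable (fun y => f y * g y) x.
Proof. exact: differentiableM. Qed.

Lemma dfV f x : differentiable f x -> f x != 0 ->
  differentiable (fun y => (f y)^-1) x.
Proof. exact: differentiableV. Qed.

Lemma dfX f n x : differentiable f x -> differentiable (fun y => f y ^+ n) x.
Proof.
move=> df; elim: n => [|n IH]; first exact: dfC.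
by under eq_fun do rewrite exprS; exact: dfM.
Qed.

Lemma dfsum I (s : seq I) (F : I -> V -> C) x :
  (forall i, differentiable (F i) x) ->
  differentiable (fun y => \sum_(i <- s) F i y) x.
Proof.
move=> dF; elim: s => [|i s IH].
  by under eq_fun do rewrite big_nil; exact: dfC.
by under eq_fun do rewrite big_cons; exact: dfD.
Qed.

Lemma cfC (a : C) x : {for x, continuous (fun _ : V => a)}.
Proof. exact: cvg_cst. Qed.

Lemma cfid (x : C) : {for x, continuous (fun z : C => z)}.
Proof. exact: cvg_id. Qed.

Lemma cfD f g x : {for x, continuous f} -> {for x, continuous g} ->
  {for x, continuous (fun y => f y + g y)}.
Proof. exact: continuousD. Qed.

Lemma cfB f g x : {for x, continuous f} -> {for x, continuous g} ->
  {for x, continuous (fun y => f y - g y)}.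
Proof. exact: continuousB. Qed.

Lemma cfM f g x : {for x, continuous f} -> {for x, continuous g} ->
  {for x, continuous (fun y => f y * g y)}.
Proof. exact: continuousM. Qed.

Lemma cfX f n x : {for x, continuous f} -> {for x, continuous (fun y => f y ^+ n)}.
Proof.
move=> cf; elim: n => [|n IH]; first exact: cfC.
have -> : (fun y => f y ^+ n.+1) = (fun y => f y * f y ^+ n).
  by apply/funext => y; rewrite exprS.
exact: cfM.
Qed.

End PointwiseRules.

Lemma cont_affR (T : topologicalType) (a b : R) (f : T -> R) (x : T) :
  {for x, continuous f} -> {for x, continuous (fun y => a + b * f y)}.
Proof.
by move=> cf; apply: cvgD; [exact: cvg_cst|apply: cvgM; [exact: cvg_cst|exact: cf]].
Qed.

Lemma closed_ball_nrm {V : normedModType C} (c : V) (r : R) :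
  closed [set z : V | nrm (z - c) <= r].
Proof.
have -> : [set z : V | nrm (z - c) <= r] =
  (fun z => nrm (z - c)) @^-1` [set x | x <= r] by [].
apply: preimage_closed; last exact: closed_le.
move=> x _; apply: (@cont_nrmfun _ _ (fun z => z - c) x).
by apply: continuousB; [exact: cvg_id|exact: cvg_cst].
Qed.

Lemma compact_disc (c : C) (r : R) : compact [set z : C | nrm (z - c) <= r].
Proof.
pose f (x : R * R) : C := rc x.1 + ii * rc x.2.
have cf : continuous f.
  move=> x A /nbhs_nrm[e e0 eA].
  have [h0 h1] : 0 < e / 2 /\ e / 2 + e / 2 = e by lra.
  exists (ball x.1 (e / 2), ball x.2 (e / 2)); first by split; exact: nbhsx_ballx.
  move=> [u v] [/= bu bv]; apply: eA; apply: le_lt_trans (nrm_le_reim _) _.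
  rewrite !reimE; rewrite -h1; apply: ltrD.
    by move: bu; rewrite -ball_normE /ball_ /= distrC; congr (`|_| < _); ring.
  by move: bv; rewrite -ball_normE /ball_ /= distrC; congr (`|_| < _); ring.
pose B := `[re c - r, re c + r] `*` `[im c - r, im c + r] : set (R * R).
have cB : compact B by apply: compact_setX; exact: segment_compact.
apply: (@subclosed_compact _ _ (f @` B)); first exact: closed_ball_nrm.
  by apply: continuous_compact => //; exact: continuous_subspaceT.
move=> z /= zr; exists (re z, im z); last by rewrite /f /= -reimrc.
have := re_le (z - c); have := im_le (z - c); rewrite !reimE.
rewrite !ler_norml => i1 i2; split; rewrite /= in_itv /=; lra.
Qed.

Lemma EVT_max_disc (v : C -> R) (A : set C) (r : R) : A !=set0 -> closed A ->
  (forall z, A z -> nrm z <= r) -> (forall z, A z -> {for z, continuous v}) ->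
  exists2 c, A c & forall z, A z -> v z <= v c.
Proof.
move=> A0 cA Ar cv.
have [||c] := @compact_EVT_max C R v A A0; last 1 first.
- by rewrite inE => Ac H; exists c => // z Az; apply: H; rewrite inE.
- apply: (subclosed_compact cA (@compact_disc 0 r)).
  by move=> z /Ar /=; rewrite subr0.
- by apply: continuous_in_subspaceT => z; rewrite inE; exact: cv.
Qed.

Lemma nrm_diff1 (f : C -> C) (p D : C) :
  (forall e : R, 0 < e -> exists2 d : R, 0 < d &
    forall h, nrm h < d -> nrm (f (p + h) - f p - D * h) <= e * nrm h) ->
  differentiable f p /\ forall h, 'd f p h = D * h.
Proof.
move=> H; have [] // := @nrm_diff R _ _ f p ( *:%R D) (nrm D).
  by move=> h; rewrite nrmcM.
by move=> df dE; split=> // h; rewrite dE.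
Qed.

Lemma diff_nrm1 (f : C -> C) (p : C) : differentiable f p ->
  exists D : C, (forall h, 'd f p h = D * h) /\
    forall e : R, 0 < e -> exists2 d : R, 0 < d &
    forall h : C, nrm h < d -> nrm (f (p + h) - f p - D * h) <= e * nrm h.
Proof.
move=> df; exists ('d f p 1); have dE h : 'd f p h = 'd f p 1 * h by exact: linear1.
split=> // e /(diff_nrm df)[d d0 dH]; exists d => // h hd.
by rewrite -dE; exact: dH.
Qed.

(* The numerator vanishes to second order at [w], hence no removable singularity
   theorem is needed for this variant of the Cauchy kernel. *)
Lemma diff_square_quotient (g : C -> C) (w : C) :
  differentiable g w -> g w = 1 ->
  differentiable (fun z => (1 - g z) ^+ 2 / (z - w)) w.
Proof.
move=> /diff_nrm1[D [_ DP]] gw; set G := fun z => _.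
apply: (proj1 (@nrm_diff1 G w (D ^+ 2) _)).
(* The derivative of [G] at [w] is [D ^+ 2]: as [G w] is 0 and [G (w + h)] is (D h + o)^2 / h, the
   error is (2 D + o / h) o. The bound [e1 <= 1] controls the first factor, the other one the
   product. *)
move=> e e0; pose e1 := Num.min 1 (e / (2 * nrm D + 1)).
have D0 : 0 < 2 * nrm D + 1 by have := nrm_ge0 D; lra.
have e10 : 0 < e1 by rewrite lt_min ltr01 divr_gt0.
have e1e : e1 * (2 * nrm D + 1) <= e by rewrite -ler_pdivlMr// ge_min lexx orbT.
have e11 : e1 <= 1 by rewrite ge_min lexx.
have [d d0 dH] := DP _ e10; exists d => // h hd.
have [->|h0] := eqVneq h 0.
  by rewrite addr0 subrr mulr0 subrr nrm0 mulr0.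
pose o : C := g (w + h) - 1 - D * h.
have ho : nrm o <= e1 * nrm h by rewrite /o -gw; exact: dH.
have -> : G (w + h) - G w - D ^+ 2 * h = (2 * D + o / h) * o.
  have -> : G (w + h) = (D * h + o) ^+ 2 / h.
    have -> : D * h + o = g (w + h) - 1 by rewrite /o; ring.
    rewrite /G; have -> : w + h - w = h by ring.
    by congr (_ / _); ring.
  by rewrite /G gw !subrr expr0n mul0r; field.
have h0' : 0 < nrm h by rewrite nrm_gt0.
rewrite nrmcM; have b : nrm (2 * D + o / h) <= 2 * nrm D + 1.
  apply: le_trans (nrmD _ _) _; rewrite !nrmcM nrm_n lerD2l nrmV.
  by rewrite ler_pdivrMr// (le_trans ho)// ler_wpM2r ?nrm_ge0.
apply: le_trans (_ : (2 * nrm D + 1) * (e1 * nrm h) <= _).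
  by apply: ler_pM; rewrite ?nrm_ge0.
by rewrite mulrA [_ * e1]mulrC ler_wpM2r ?nrm_ge0.
Qed.

Lemma diff_sub (w x : C) : differentiable (fun z : C => z - w) x.
Proof. exact: dfB (dfid _) (dfC _ _). Qed.

(** A high power [g] of F / F w is 1 at [w] and tiny on a square around [w]. Split 1 / (z - w) into
    (1 - g)^2 / (z - w), differentiable also at [w], and (2 g - g^2) / (z - w), which is small on
    the square. Each part has a sum of modulus at most 1, while [sqtrap_inv] gives at least 8 for
    the total. *)
Lemma no_strict_max (F : C -> C) (w : C) (r : R) : 0 < r ->
  (forall z : C, nrm (z - w) <= r -> differentiable F z) ->
  (forall z : C, z != w -> nrm (z - w) <= r -> nrm (F z) < nrm (F w)) -> False.
Proof.
move=> r0 dF maxF.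
(* The square of centre [w] and side [2 * s] then lies within distance [4 * s = r] of [w]. *)
pose s := r / 4; have s0 : 0 < s by rewrite /s; lra.
have Fw : F w != 0.
  rewrite -nrm_gt0; apply: le_lt_trans (nrm_ge0 (F (w + rc s))) _.
  have ws : nrm (w + rc s - w) = s by rewrite [w + _]addrC addrK nrm_rc gtr0_norm.
  apply: maxF; last by rewrite ws /s; lra.
  by rewrite -subr_eq0 -nrm_eq0 ws gt_eqF.
pose f z := F z / F w.
have df z : nrm (z - w) <= r -> differentiable f z.
  move=> /dF dFz; apply: dfM => //; exact: dfC.
have fw : f w = 1 by rewrite /f divff.
pose A := [set z | s <= nrm (z - w)] `&` [set z | nrm (z - w) <= r].
have cN z : {for z, continuous (fun z : C => nrm (z - w))}.
  by apply: (@cont_nrmfun _ _ (fun z => z - w)); apply: cfB; [exact: cfid|exact: cfC].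
have [c [/= cs cr] cmax] : exists2 c, A c & forall z, A z -> nrm (f z) <= nrm (f c).
  apply: (@EVT_max_disc _ _ (r + nrm w)).
  - exists (w + rc s); rewrite /A /= [w + _]addrC addrK nrm_rc gtr0_norm//.
    by split; rewrite /s; lra.
  - apply: closedI; last exact: closed_ball_nrm.
    by apply: (@preimage_closed _ _ (fun z => nrm (z - w)) [set x | s <= x]);
      [move=> z _; exact: cN|exact: closed_ge].
  - by move=> z [/= _ zr]; have := nrmD (z - w) w; rewrite subrK; lra.
  - by move=> z [/= _ zr]; apply: (@cont_nrmfun _ _ f); apply: differentiable_continuous; exact: df.
set q := nrm (f c) in cmax.
have q1 : 0 <= q < 1.
  rewrite nrm_ge0 /= /q /f nrmcM nrmV ltr_pdivrMr ?nrm_gt0// mul1r; apply: maxF => //.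
  by rewrite -subr_eq0 -nrm_gt0; lra.
(* From |g| <= 1/48 follows |2 g - g^2| <= 1/16, hence |H| <= 1 / (16 s) on the square, for which
   [sqtrap_bound] gives exactly 1. *)
have [n0 /(_ n0 (leqnn _)) qn] := expr_lt_eps 1 q1 (ltac:(lra) : 0 < 1 / 48 :> R).
pose g z := f z ^+ n0.
have gw : g w = 1 by rewrite /g fw expr1n.
have dg z : nrm (z - w) <= r -> differentiable g z by move=> /df; exact: dfX.
pose G z := (1 - g z) ^+ 2 / (z - w).
have dG z : nrm (z - w) <= r -> differentiable G z.
  move=> zr; have [->|zw] := eqVneq z w.
    by apply: diff_square_quotient => //; apply: dg; rewrite subrr nrm0 ltW.
  apply: dfM.
    by apply: dfX; apply: dfB; [exact: dfC|exact: dg].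
  by apply: dfV; [exact: diff_sub|rewrite subr_eq0].
pose H z := (2 * g z - g z ^+ 2) / (z - w).
pose a := w - rc s - ii * rc s.
have s2 : 0 < 2 * s by lra.
have inr_ z : insq a (2 * s) z -> nrm (z - w) <= r.
  move=> za; apply: le_trans (@insq_diam R a (2 * s) z w za _) _; last by rewrite /s; lra.
  by rewrite /insq /a !reimE; lra.
have out z : onsq a (2 * s) z -> s <= nrm (z - w).
  rewrite /onsq /a => -[[t _ ->]|[[t _ ->]|[[t _ ->]|[t _ ->]]]].
  - by apply: le_trans (im_le _); rewrite !reimE ler_normr; apply/orP; right; nra.
  - by apply: le_trans (re_le _); rewrite !reimE ler_normr; apply/orP; left; nra.
  - by apply: le_trans (im_le _); rewrite !reimE ler_normr; apply/orP; left; nra.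
  - by apply: le_trans (re_le _); rewrite !reimE ler_normr; apply/orP; right; nra.
have e0 : 0 < 1 / (2 * s) ^+ 2 by rewrite divr_gt0// exprn_gt0.
have [k /(_ k (leqnn _)) Gk] := goursat s2 (fun z za => dG z (inr_ z za)) e0.
have Hk : nrm (sqtrap k H a (2 * s)) <= 8 * (1 / (16 * s)) * (2 * s).
  apply: sqtrap_bound; first exact: ltW.
  move=> z za; rewrite /H nrmcM nrmV.
  have zs := out z za; have zr := inr_ z (onsq_insq (ltW s2) za).
  have gz : nrm (g z) <= 1 / 48.
    rewrite /g nrmX; apply/ltW; apply: le_lt_trans qn; rewrite mul1r.
    by apply: lerXn2r; rewrite ?nnegrE ?nrm_ge0//; apply: cmax.
  have b : nrm (2 * g z - g z ^+ 2) <= 1 / 16.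
    apply: le_trans (nrmB _ _) _; rewrite nrmcM nrmX nrm_n.
    by have := nrm_ge0 (g z); nra.
  rewrite ler_pdivrMr; last lra.
  apply: le_trans b _; apply: le_trans (_ : 1 / (16 * s) * s <= _).
    by rewrite le_eqVlt; apply/orP; left; apply/eqP; field; lra.
  by rewrite ler_wpM2l// divr_ge0//; lra.
have := sqtrap_inv w k s0; rewrite -/a.
have -> : (fun z : C => (z - w)^-1) = (fun z => G z + H z).
  by apply/funext => z; rewrite /G /H; ring.
rewrite sqtrapD imD; move: Gk Hk; rewrite divfK ?gt_eqF ?exprn_gt0//.
have -> : 8 * (1 / (16 * s)) * (2 * s) = 1 by field; lra.
have := im_le (sqtrap k G a (2 * s)); have := im_le (sqtrap k H a (2 * s)).
set x := sqtrap _ G _ _; set y := sqtrap _ H _ _ => i1 i2.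
have := le_trans (ler_norm _) i1; have := le_trans (ler_norm _) i2; lra.
Qed.

(* [|F z| (1 + eta |z|^2)] is maximal at some [c]; multiplying [F] by a suitable
   [(1 + be (z - c))^2] turns this into a strict local maximum of a modulus. *)
Lemma max_principle (F : C -> C) (M : R) : 0 <= M ->
  (forall z : C, nrm z <= 1 -> {for z, continuous F}) ->
  (forall z : C, nrm z < 1 -> F z != 0 -> differentiable F z) ->
  (forall z : C, nrm z = 1 -> nrm (F z) <= M) ->
  forall z : C, nrm z <= 1 -> nrm (F z) <= M.
Proof.
move=> M0 cF dF FM w w1; rewrite leNgt; apply/negP => Mw.
(* On the unit circle [v] is at most [M * (1 + eta)], and this [eta] keeps that below
   [nrm (F w) <= v w]. The maximum of [v] is thus inside the disc, at a point where [F] does not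
   vanish. *)
pose eta := (nrm (F w) - M) / (2 * (M + 1)).
have eta0 : 0 < eta by rewrite divr_gt0//; lra.
have etaM : M * (1 + eta) < nrm (F w).
  have : eta * (2 * (M + 1)) = nrm (F w) - M by rewrite /eta divfK//; apply/eqP; lra.
  nra.
pose v z := nrm (F z) * (1 + eta * nrm z ^+ 2).
have [c c1 cmax] : exists2 c, nrm c <= 1 & forall z, nrm z <= 1 -> v z <= v c.
  apply: (@EVT_max_disc v [set z | nrm z <= 1] 1) => //.
  - by exists w.
  - have := @closed_ball_nrm C 0 1; congr closed; apply/funext => z.
    by rewrite /= subr0.
  - move=> z z1; apply: (@continuousM _ _ (fun z => nrm (F z)) (fun z => 1 + eta * nrm z ^+ 2)).
      by apply: (@cont_nrmfun _ _ F); exact: cF.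
    have cn : {for z, continuous (fun z : C => nrm z)}.
      by apply: (@cont_nrmfun _ _ (fun z => z)); exact: cfid.
    have cn2 := continuousM cn cn.
    exact: (@cont_affR C 1 eta (fun z : C => nrm z ^+ 2) z cn2).
have Mc : M * (1 + eta) < v c.
  apply: lt_le_trans etaM (le_trans _ (cmax w w1)); rewrite /v.
  rewrite ler_peMr ?nrm_ge0//; have := sqr_ge0 (nrm w); nra.
have c1' : nrm c < 1.
  rewrite lt_neqAle c1 andbT; apply/eqP => c_1; move: Mc; rewrite /v c_1 expr1n mulr1.
  by have := FM c c_1; nra.
have vc : 0 < v c by apply: le_lt_trans Mc; nra.
have Fc : F c != 0.
  by apply/eqP => F0; move: vc; rewrite /v F0 nrm0 mul0r ltxx.
pose A := 1 + eta * nrm c ^+ 2.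
have A0 : 0 < A by have := sqr_ge0 (nrm c); rewrite /A; nra.
(* This [be] makes the first order terms in z - c of A |1 + be (z - c)|^2 and of 1 + eta |z|^2
   agree. The second order coefficients eta^2 |c|^2 / A and eta compare strictly because A > eta
   |c|^2. *)
pose be : C := cj c * rc (eta / A).
pose G z := F z * (1 + be * (z - c)) ^+ 2.
have /cont_nrm /(_ _ (_ : 0 < nrm (F c))) := cF c c1.
rewrite nrm_gt0 Fc => /(_ isT)[d d0 dH].
pose r := Num.min (d / 2) ((1 - nrm c) / 2).
have r0 : 0 < r by rewrite lt_min; apply/andP; split; lra.
have rd : r < d by rewrite gt_min; apply/orP; left; lra.
have rc1 : nrm c + r < 1.
  have : r <= (1 - nrm c) / 2 by rewrite ge_min lexx orbT.
  lra.
have inr_ z : nrm (z - c) <= r -> nrm z < 1.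
  by move=> zr; have := nrmD (z - c) c; rewrite subrK; lra.
apply: (@no_strict_max G c r r0).
  move=> z zr; have Fz : F z != 0.
    apply/eqP => F0; have := dH z (le_lt_trans zr rd).
    by rewrite F0 sub0r nrmN ltxx.
  apply: dfM; first exact: dF (inr_ _ zr) Fz.
  by apply: dfX; apply: dfD (dfC _ _) _; apply: dfM (dfC _ _) _; exact: diff_sub.
move=> z zc zr; rewrite /G subrr mulr0 addr0 expr1n mulr1.
have := cmax z (ltW (inr_ _ zr)); rewrite /v -/A nrmcM nrmX.
set d1 := z - c; have zE : z = c + d1 by rewrite /d1; ring.
have d10 : 0 < nrm d1 ^+ 2 by rewrite exprn_gt0// nrm_gt0 subr_eq0.
have key : A * nrm (1 + be * d1) ^+ 2 < 1 + eta * nrm z ^+ 2.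
  have E1 : nrm z ^+ 2 = nrm c ^+ 2 + 2 * re (cj c * d1) + nrm d1 ^+ 2.
    by rewrite zE !nrm_sqr !reimE; ring.
  have E2 : nrm (1 + be * d1) ^+ 2 =
      1 + 2 * (eta / A) * re (cj c * d1) + (eta / A) ^+ 2 * nrm c ^+ 2 * nrm d1 ^+ 2.
    have -> : be * d1 = (cj c * d1) * rc (eta / A) by rewrite /be; ring.
    have -> : (eta / A) ^+ 2 * nrm c ^+ 2 * nrm d1 ^+ 2 =
        (eta / A) ^+ 2 * nrm (cj c * d1) ^+ 2 by rewrite nrmcM nrm_cj; ring.
    by set y := cj c * d1; rewrite !nrm_sqr !reimE; ring.
  have -> : A * nrm (1 + be * d1) ^+ 2 =
      A + 2 * eta * re (cj c * d1) + eta ^+ 2 * nrm c ^+ 2 / A * nrm d1 ^+ 2.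
    by rewrite E2; field; rewrite gt_eqF.
  rewrite E1; suff : eta ^+ 2 * nrm c ^+ 2 / A < eta by rewrite /A; nra.
  by rewrite ltr_pdivrMr// /A; nra.
move=> le; have n0 := nrm_ge0 (F z).
have [Fz|Fz] := eqVneq (nrm (F z)) 0.
  by rewrite Fz mul0r nrm_gt0.
have Fz0 : 0 < nrm (F z) by rewrite lt_neqAle eq_sym Fz.
rewrite -(ltr_pM2r A0); apply: lt_le_trans le.
by rewrite -mulrA ltr_pM2l// mulrC.
Qed.

End MaxPrinciple.

(** * Rado's theorem and Cauchy estimates *)

Section Rado.
Context {R : realType}.
Local Notation C := (Cplx R).

Lemma uniform_cont {V W : normedModType C} (K : set V) (F : V -> W) : compact K ->
  (forall x, K x -> {for x, continuous F}) ->
  forall e : R, 0 < e -> exists2 d : R, 0 < d &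
    forall x y, K x -> nrm (y - x) < d -> nrm (F y - F x) < e.
Proof.
move=> /compact_near_coveringP cK cF e e0.
pose P (d : R) (x : V) := forall y, nrm (y - x) < d -> nrm (F y - F x) < e.
have : \forall d \near (0 : R)^'+, K `<=` P d.
  apply: cK => x Kx.
  have [d d0 dH] := (proj1 (cont_nrm _ _)) (cF x Kx) (e / 2) (ltac:(lra)).
  have d2 : 0 < d / 2 by lra.
  exists ([set y | nrm (y - x) < d / 2], [set t | t < d / 2]).
    by split; [apply/nbhs_nrm; exists (d / 2)|exact: nbhs_right_lt].
  move=> [y t] [/= yx td] z zy.
  have yF := dH y (lt_trans yx (ltac:(lra) : d / 2 < d)).
  have zF : nrm (F z - F x) < e / 2.
    by apply: dH; apply: le_lt_trans (nrm_tri _ y _) _; lra.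
  by apply: le_lt_trans (nrm_tri _ (F x) _) _; move: zF; rewrite (nrmC (F x)); lra.
move=> H; near (0 : R)^'+ => d; exists d => //.
by move=> x y Kx; move: x Kx y; near: d.
Unshelve. all: by end_near. Qed.

Lemma circle_bound (F : C -> C) : (forall z : C, nrm z <= 1 -> {for z, continuous F}) ->
  exists2 M : R, 0 <= M & forall z : C, nrm z <= 1 -> nrm (F z) <= M.
Proof.
move=> cF; have [c _ cM] : exists2 c : C, nrm c <= 1 &
    forall z : C, nrm z <= 1 -> nrm (F z) <= nrm (F c).
  apply: (@EVT_max_disc R (fun z => nrm (F z)) [set z | nrm z <= 1] 1) => //.
  - by exists 0; rewrite /= nrm0.
  - have := @closed_ball_nrm _ C 0 1; congr closed; apply/funext => z.
    by rewrite /= subr0.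
  - by move=> z /= z1; apply: (@cont_nrmfun _ _ _ F); exact: cF.
by exists (nrm (F c)) => //; exact: nrm_ge0.
Qed.

(** [hol_off u u] is the hypothesis of Rado's theorem on [u]; [hol_off u F] allows [F] the zeros of
    [u] as exceptional set. *)
Definition hol_off (u F : C -> C) :=
  (forall z : C, nrm z <= 1 -> {for z, continuous F}) /\
  (forall z : C, nrm z < 1 -> u z != 0 -> differentiable F z).

(* The maximum principle applied to [u * G ^+ n], which vanishes where [G] may fail to
   be differentiable; then [n] tends to infinity. *)
Lemma mp_off u G (M : R) : hol_off u u -> hol_off u G -> 0 <= M ->
  (forall z : C, nrm z = 1 -> nrm (G z) <= M) ->
  forall w : C, nrm w < 1 -> u w != 0 -> nrm (G w) <= M.
Proof.
move=> [cu du] [cG dG] M0 GM w w1 uw; rewrite leNgt; apply/negP => Mw.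
have [B B0 uB] := circle_bound cu.
have g0 : 0 < nrm (G w) by apply: le_lt_trans M0 Mw.
have q01 : 0 <= M / nrm (G w) < 1.
  by rewrite divr_ge0 ?nrm_ge0//= ltr_pdivrMr// mul1r.
have uw0 : 0 < nrm (u w) by rewrite nrm_gt0.
have [n /(_ n (leqnn n))] := expr_lt_eps B q01 uw0.
rewrite ltNge => /negP; apply; rewrite expr_div_n mulrA ler_pdivlMr ?exprn_gt0//.
have := @max_principle _ (fun z => u z * G z ^+ n) (B * M ^+ n) _ _ _ _ w (ltW w1).
rewrite nrmcM nrmX; apply.
- by rewrite mulr_ge0 ?exprn_ge0.
- by move=> z z1; apply: cfM; [exact: cu|apply: cfX; exact: cG].
- move=> z z1 nz; have uz : u z != 0.
    by apply: contraNneq nz => ->; rewrite mul0r.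
  by apply: dfM; [exact: du|apply: dfX; exact: dG].
- move=> z z1; rewrite nrmcM nrmX ler_pM ?nrm_ge0 ?exprn_ge0 ?nrm_ge0//.
    by apply: uB; rewrite z1.
  by apply: lerXn2r; rewrite ?nnegrE ?nrm_ge0//; exact: GM.
Qed.

Lemma hol_offC u a : hol_off u (fun _ => a).
Proof. by split=> *; [exact: cfC|exact: dfC]. Qed.

Lemma hol_offD u F G : hol_off u F -> hol_off u G -> hol_off u (fun z => F z + G z).
Proof.
by move=> [cF dF] [cG dG]; split=> z z1 *; [apply: cfD; [exact: cF|exact: cG]|
  apply: dfD; [exact: dF|exact: dG]].
Qed.

Lemma hol_offM u F G : hol_off u F -> hol_off u G -> hol_off u (fun z => F z * G z).
Proof.
by move=> [cF dF] [cG dG]; split=> z z1 *; [apply: cfM; [exact: cF|exact: cG]|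
  apply: dfM; [exact: dF|exact: dG]].
Qed.

Lemma hol_off_diff u F : (forall z : C, nrm z <= 1 -> differentiable F z) -> hol_off u F.
Proof.
move=> dF; split=> z z1; first by apply: differentiable_continuous; exact: dF.
by move=> _; apply: dF; exact: ltW.
Qed.

(* Apply [mp_off] to [G + N] for a large real [N]. *)
Lemma remp_off u G (e : R) : hol_off u u -> hol_off u G ->
  (forall z : C, nrm z = 1 -> re (G z) <= e) ->
  forall w : C, nrm w < 1 -> u w != 0 -> re (G w) <= e.
Proof.
move=> hu hG Ge w w1 uw; rewrite leNgt; apply/negP => ew.
have [B B0 GB] := circle_bound hG.1.
(* On the circle |G + N|^2 is at most N^2 + 2 N e + B^2, while at [w] it is at least N^2 + 2 N re (G
   w), which is larger by 1 for this [N]. *)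
pose N := (B ^+ 2 + 1) / (2 * (re (G w) - e)).
have N0 : 0 < N.
  by rewrite divr_gt0//; [have := sqr_ge0 B|]; lra.
have NE : 2 * N * (re (G w) - e) = B ^+ 2 + 1 by rewrite /N; field; lra.
pose M2 := N ^+ 2 + 2 * N * e + B ^+ 2.
have bd (z : C) : nrm z = 1 -> nrm (G z + rc N) ^+ 2 <= M2.
  move=> z1; have := Ge z z1.
  have : nrm (G z) ^+ 2 <= B ^+ 2.
    by apply: lerXn2r; rewrite ?nnegrE ?nrm_ge0//; apply: GB; rewrite z1.
  rewrite !nrm_sqr !reimE /M2; nra.
have M20 : 0 <= M2 by apply: le_trans (bd 1 _); rewrite ?sqr_ge0 ?nrm1.
have := @mp_off u (fun z => G z + rc N) (Num.sqrt M2) hu _ (sqrtr_ge0 _) _ w w1 uw.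
have -> : (nrm (G w + rc N) <= Num.sqrt M2) = (nrm (G w + rc N) ^+ 2 <= M2).
  by rewrite -(@ler_sqr R (nrm _)) ?nnegrE ?nrm_ge0 ?sqrtr_ge0// sqr_sqrtr.
have H : nrm (G w + rc N) ^+ 2 <= M2 -> False.
  rewrite nrm_sqr !reimE addr0 /M2 => le.
  have := sqr_ge0 (im (G w)); have := sqr_ge0 (re (G w)); nra.
move=> K; apply/H/K; first by apply: hol_offD => //; exact: hol_offC.
move=> z z1; rewrite -(@ler_sqr R (nrm _)) ?nnegrE ?nrm_ge0 ?sqrtr_ge0//.
by rewrite sqr_sqrtr//; exact: bd.
Qed.

(** * Means over the roots of unity *)

Lemma prim_root_exists n : exists z : C, (n.+1).-primitive_root z.
Proof.
pose p : {poly R[i]%C} := 'X^(n.+1) - 1.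
have [s ps] := closed_field_poly_normal p.
rewrite (monicP _) ?monicXnsubC // scale1r in ps.
have s1 : all (n.+1).-unity_root s by apply/allP => z; rewrite -root_prod_XsubC -ps.
have sn : (n < size s)%N.
  by rewrite -ltnS -(size_prod_XsubC s id) -ps size_XnsubC.
have us : uniq s.
  by rewrite -separable_prod_XsubC -ps separable_Xn_sub_1// pnatr_eq0.
by have /hasP[z _ pz] := cyclic.has_prim_root (ltn0Sn n) s1 us sn; exists z.
Qed.

Definition rt (n : nat) : C := xget 0 [set z : C | (n.+1).-primitive_root z].

Lemma rtP n : (n.+1).-primitive_root (rt n).
Proof.
have [z pz] := prim_root_exists n.
exact: (@xgetPex _ 0 [set z : C | (n.+1).-primitive_root z] (ex_intro _ z pz)).
Qed.

Lemma nrm_rt n : nrm (rt n) = 1.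
Proof.
have /(congr1 nrm) := prim_expr_order (rtP n); rewrite nrmX nrm1 => /eqP.
by rewrite pexpr_eq1 ?nrm_ge0// => /eqP.
Qed.

Lemma nrm_rtX n j : nrm (rt n ^+ j) = 1.
Proof. by rewrite nrmX nrm_rt expr1n. Qed.

Lemma cj1 : cj 1 = 1 :> C.
Proof. by apply: eqC; rewrite !reimE ?oppr0. Qed.

Lemma cjX (z : C) k : cj (z ^+ k) = cj z ^+ k.
Proof. by elim: k => [|k IH]; rewrite ?expr0 ?cj1// !exprS cjM IH. Qed.

(** Stands for the normalized integral over the unit circle. *)
Definition avg n (f : C -> C) : C := (n.+1%:R)^-1 * \sum_(j < n.+1) f (rt n ^+ j).

Lemma nS0 n : (n.+1%:R : C) != 0. Proof. by rewrite pnatr_eq0. Qed.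

Lemma avg_ext n f g : (forall z : C, nrm z = 1 -> f z = g z) -> avg n f = avg n g.
Proof. by move=> fg; congr (_ * _); apply: eq_bigr => i _; rewrite fg ?nrm_rtX. Qed.

Lemma avgD n f g : avg n (fun z => f z + g z) = avg n f + avg n g.
Proof. by rewrite /avg big_split mulrDr. Qed.

Lemma avgZ n a f : avg n (fun z => a * f z) = a * avg n f.
Proof. by rewrite /avg -mulr_sumr mulrCA. Qed.

Lemma avg_cst n a : avg n (fun=> a) = a.
Proof. by rewrite /avg sumr_const card_ord -[a *+ _]mulr_natl mulrA mulVf ?mul1r ?nS0. Qed.

Lemma avg_bound n f M : (forall z : C, nrm z = 1 -> nrm (f z) <= M) -> nrm (avg n f) <= M.
Proof.
move=> fM; rewrite /avg nrmcM nrmV nrm_n ler_pdivrMl ?ltr0n//.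
apply: le_trans (nrm_sum _ _ _) _.
apply: (@le_trans _ _ (\sum_(i < n.+1) M)).
  by apply: ler_sum => i _; apply: fM; exact: nrm_rtX.
by rewrite sumr_const card_ord mulr_natl.
Qed.

Lemma re_avg_le n f g : (forall z : C, nrm z = 1 -> re (f z) <= re (g z)) ->
  re (avg n f) <= re (avg n g).
Proof.
move=> fg; rewrite /avg -rcn -rcV ![rc _ * _]mulrC !reMr.
rewrite ler_wpM2r ?invr_ge0// !re_sum; apply: ler_sum => i _.
by apply: fg; exact: nrm_rtX.
Qed.

Lemma one_sub_neq0 (x : C) : nrm x < 1 -> 1 - x != 0.
Proof. by move=> x1; rewrite subr_eq0; apply: contraTneq x1 => <-; rewrite nrm1 ltxx. Qed.

(** Since 1 - x^(n+1) = 1 - (x cj z)^(n+1) at the roots of unity, multiplying by it turns the kernel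
    into a finite geometric sum, of which only the constant term has a nonzero mean. The integral
    would give 1; the right-hand side is the exact discretization error. *)
Lemma avg_cauchy n (x : C) : nrm x < 1 ->
  avg n (fun z => (1 - x * cj z)^-1) = (1 - x ^+ n.+1)^-1.
Proof.
move=> x1.
have xn : nrm (x ^+ n.+1) < 1.
  by rewrite nrmX exprn_ilt1 ?nrm_ge0.
have nz0 := one_sub_neq0 xn.
apply: (mulIf nz0); rewrite mulVf// mulrC -avgZ.
have -> : avg n (fun z => (1 - x ^+ n.+1) * (1 - x * cj z)^-1) =
   (n.+1%:R)^-1 * \sum_(j < n.+1) \sum_(k < n.+1) x ^+ k * (cj (rt n) ^+ k) ^+ j.
  congr (_ * _); apply: eq_bigr => j _.
  rewrite cjX; set y := x * cj (rt n) ^+ j.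
  have yn : y ^+ n.+1 = x ^+ n.+1.
    by rewrite exprMn -exprM mulnC exprM -cjX (prim_expr_order (rtP n)) cj1 expr1n mulr1.
  have y0 : 1 - y != 0.
    by apply: one_sub_neq0; rewrite nrmcM nrmX nrm_cj nrm_rt expr1n mulr1.
  apply: (mulIf y0); rewrite mulfVK// -yn -opprB subrX1 -mulNr opprB mulrC.
  congr (_ * _); apply: eq_bigr => k _.
  by rewrite exprMn -!exprM mulnC.
rewrite exchange_big /= big_ord_recl /= [X in _ * (_ + X)]big1 ?addr0.
  rewrite (eq_bigr (fun=> 1)) => [|i _]; last by rewrite ?expr0 ?mul1r ?expr1n.
  by rewrite sumr_const card_ord mulVf ?nS0.
move=> k _; rewrite -mulr_sumr.
set a := cj (rt n) ^+ _.
have a1 : a ^+ n.+1 = 1.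
  by rewrite -exprM mulnC exprM -cjX (prim_expr_order (rtP n)) cj1 expr1n.
have a0 : a - 1 != 0.
  apply/eqP => /subr0_eq /(congr1 cj); rewrite /a cjX cjK cj1 => /eqP.
  rewrite -(prim_order_dvd (rtP n)) => /dvdn_leq; rewrite /= /bump /= add1n => /(_ isT).
  by rewrite ltnS leqNgt ltn_ord.
have := subrX1 a n.+1; rewrite a1 subrr => /esym/eqP.
by rewrite mulf_eq0 (negPf a0) /= => /eqP ->; rewrite mulr0.
Qed.
End Rado.

(** * Poisson and Cauchy kernels, Cauchy estimates *)

Section CauchyEstimate.
Context {R : realType}.
Local Notation C := (Cplx R).

Lemma re_rcM (a : R) (z : C) : re (rc a * z) = a * re z.
Proof. by rewrite reM re_rc im_rc mul0r subr0. Qed.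

(** The Schwarz kernel, whose real part on the circle is the Poisson kernel ([re_poisson]). Sums of
    it are holomorphic, so that they can be compared with [F] by the maximum principle. *)
Definition poisson (r : R) (z : C) : C := (1 + rc r * z) / (1 - rc r * z).

Lemma re_poisson (r : R) (z : C) : 0 <= r < 1 -> nrm z = 1 ->
  re (poisson r z) = (1 - r ^+ 2) / nrm (1 - rc r * z) ^+ 2.
Proof.
move=> r01 z1; have x0 : 1 - rc r * z != 0.
  by apply: one_sub_neq0; rewrite nrmcM z1 nrm_rc mulr1 ger0_norm; lra.
set w := 1 - rc r * z.
have -> : poisson r z = ((1 + rc r * z) * cj w) * rc (nrm w ^+ 2)^-1.
  rewrite rcV -mul_cj /poisson -/w; field.
  by rewrite x0 andbT -nrm_eq0 nrm_cj nrm_eq0.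
rewrite reMr; congr (_ * _); have := nrm_sqr z; rewrite z1 expr1n /w !reimE => E.
transitivity (1 - r ^+ 2 * (re z ^+ 2 + im z ^+ 2)); first by ring.
by rewrite -E mulr1.
Qed.

Lemma avg_poisson n (r : R) (z : C) : 0 <= r < 1 -> nrm z = 1 ->
  avg n (fun x => poisson r (z * cj x)) = 2 / (1 - (rc r * z) ^+ n.+1) - 1.
Proof.
move=> r01 z1; have rz : nrm (rc r * z) < 1.
  by rewrite nrmcM z1 nrm_rc mulr1 ger0_norm; lra.
rewrite -(avg_cauchy n rz) -avgZ -[X in _ - X](avg_cst n) -mulN1r -avgZ -avgD.
apply: avg_ext => x x1; rewrite /poisson.
have y0 : 1 - rc r * z * cj x != 0.
  by apply: one_sub_neq0; rewrite nrmcM nrm_cj x1 mulr1.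
by rewrite mulrA; field.
Qed.

(* [P] is the Poisson integral of [re \o F] discretized at the roots of unity. *)
Lemma poisson_approx (F : C -> C) (e : R) : 0 < e ->
  (forall z : C, nrm z <= 1 -> {for z, continuous F}) ->
  exists n0, forall n, (n0 <= n)%N -> exists P : C -> C,
    [/\ forall z : C, nrm z <= 1 -> differentiable P z,
        P 0 = avg n (fun z => rc (re (F z))) &
        forall z : C, nrm z = 1 -> `|re (F z) - re (P z)| <= e].
Proof.
move=> e0 cF; have [M M0 FM] := circle_bound cF.
have cK : compact [set z : C | nrm z <= 1].
  have := @compact_disc R 0 1; congr compact; apply/funext => z.
  by rewrite /= subr0.
have [d d0 dH] := @uniform_cont _ _ _ _ F cK cF (e / 4) (ltac:(lra)).
pose g z := re (F z).
have gM z : nrm z = 1 -> `|g z| <= M.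
  by move=> z1; apply: le_trans (re_le _) (FM _ _); rewrite z1.
have gd x y : nrm x = 1 -> nrm (y - x) < d -> `|g y - g x| <= e / 4.
  move=> x1 yx; rewrite /g -reB; apply: le_trans (re_le _) (ltW _).
  by apply: dH => //=; rewrite x1.
(* [s <= 1 / 2] keeps the radius [r = 1 - s] positive, [s <= d / 2] gives |x - r z| >= d / 2 when |z
   - x| >= d, and the last bound makes the kernel at such [x], at most 2 s / (d^2 / 4), small
   against [e / (8 * (M + 1))]. *)
pose s := Num.min (1 / 2) (Num.min (d / 2) (e * d ^+ 2 / (64 * (M + 1)))).
have d20 : 0 < d ^+ 2 by rewrite exprn_gt0.
have s0 : 0 < s.
  rewrite !lt_min; apply/and3P; split; [lra|lra|].
  by rewrite divr_gt0 ?mulr_gt0//; lra.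
have s1 : s <= 1 / 2 by rewrite ge_min lexx.
have s2 : s <= d / 2 by rewrite /s !ge_min lexx ?orbT.
have s3 : s * (64 * (M + 1)) <= e * d ^+ 2.
  by rewrite -ler_pdivlMr; [rewrite /s !ge_min lexx ?orbT|lra].
pose r := 1 - s; have r01 : 0 <= r < 1 by rewrite /r; lra.
have e1 : 0 < Num.min 1 (e / (4 * (M + 1))).
  by rewrite lt_min ltr01 divr_gt0//; lra.
(* With y = (r z)^(n+1), the mean of the kernel differs from 1 by 2 y / (1 - y), of modulus at most
   4 |y| once |y| < 1/2; [n1] ensures the latter. *)
have [n0 n0P] := expr_lt_eps 4 r01 e1.
have [n1 n1P] := expr_lt_eps 1 r01 (ltac:(lra) : 0 < 1 / 2 :> R).
exists (n0 + n1)%N => n n0n.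
have nn0 := leq_trans (leq_addr n1 n0) n0n.
have nn1 := leq_trans (leq_addl n0 n1) n0n.
pose P z := avg n (fun x => rc (g x) * poisson r (z * cj x)).
have nz (z x : C) : nrm z <= 1 -> nrm x = 1 -> 1 - rc r * (z * cj x) != 0.
  move=> z1 x1; apply: one_sub_neq0; rewrite !nrmcM nrm_cj nrm_rc x1 mulr1.
  by rewrite ger0_norm; have := nrm_ge0 z; nra.
exists P; split.
- move=> z z1; rewrite /P /avg; apply: dfM (dfC _ _) _.
  apply: dfsum => j; apply: dfM (dfC _ _) _; rewrite /poisson.
  have d1 : differentiable (fun y : C => rc r * (y * cj (rt n ^+ j))) z.
    by apply: dfM (dfC _ _) _; apply: dfM (dfid _) (dfC _ _).
  apply: dfM; first exact: dfD (dfC _ _) d1.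
  by apply: dfV; [exact: dfB (dfC _ _) d1|apply: nz => //; exact: nrm_rtX].
- rewrite /P; apply: avg_ext => z z1.
  by rewrite /poisson !mul0r !mulr0 addr0 subr0 divr1 mulr1.
move=> z z1; pose K x := poisson r (z * cj x).
have K0 x : nrm x = 1 -> 0 <= re (K x).
  move=> x1; rewrite /K re_poisson ?nrmcM ?nrm_cj ?x1 ?z1 ?mulr1//.
  by rewrite divr_ge0 ?sqr_ge0//; nra.
have Kfar x : nrm x = 1 -> d <= nrm (z - x) -> re (K x) * (8 * (M + 1)) <= e.
  move=> x1 zx; rewrite /K re_poisson ?nrmcM ?nrm_cj ?x1 ?z1 ?mulr1//.
  have -> : nrm (1 - rc r * (z * cj x)) = nrm (x - rc r * z).
    have xx : x * cj x = 1 by rewrite mul_cj x1 expr1n rc1.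
    have -> : x - rc r * z = (1 - rc r * (z * cj x)) * x.
      by transitivity (x - rc r * z * (x * cj x)); [rewrite xx mulr1|ring].
    by rewrite nrmcM x1 mulr1.
  have D1 : d / 2 <= nrm (x - rc r * z).
    have := nrm_tri x (rc r * z) z; have -> : rc r * z - z = - (rc s * z).
      by rewrite /r rcB rc1; ring.
    rewrite nrmN nrmcM z1 nrm_rc mulr1 (nrmC x z) gtr0_norm//; lra.
  set D := nrm (x - _) in D1 *.
  have D2 : d ^+ 2 / 4 <= D ^+ 2 by nra.
  have D0 : 0 < D ^+ 2 by lra.
  rewrite mulrAC ler_pdivrMr//.
  apply: le_trans (_ : e * (d ^+ 2 / 4) <= _); last by rewrite ler_wpM2l// ltW.
  have -> : 1 - r ^+ 2 = s * (2 - s) by rewrite /r; ring.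
  have h : s * (2 - s) <= 2 * s by nra.
  apply: le_trans (_ : 2 * s * (8 * (M + 1)) <= _).
    by rewrite ler_wpM2r//; lra.
  move: s3; lra.
set kap := avg n K.
have kapE : nrm (kap - 1) <= Num.min 1 (e / (4 * (M + 1))).
  rewrite /kap /K avg_poisson//; set y := _ ^+ n.+1.
  have yn : nrm y = r ^+ n.+1.
    by rewrite /y nrmX nrmcM z1 nrm_rc mulr1 ger0_norm//; lra.
  have y2 : nrm y < 1 / 2 by rewrite yn -[X in X < _]mul1r; apply: n1P; exact: leqW.
  have y3 : 4 * nrm y < Num.min 1 (e / (4 * (M + 1))) by rewrite yn; apply: n0P; exact: leqW.
  have y0 : 1 - y != 0 by apply: one_sub_neq0; lra.
  have y4 : 1 / 2 <= nrm (1 - y).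
    by have := nrm_tri (1 : C) y 0; rewrite !subr0 nrm1; lra.
  have -> : 2 / (1 - y) - 1 - 1 = 2 * y / (1 - y) by field.
  apply: le_trans (ltW y3); rewrite !nrmcM nrmV nrm_n ler_pdivrMr; last lra.
  by have := nrm_ge0 y; nra.
have kapM : `|re kap - 1| * (M + 1) <= e / 4.
  apply: le_trans (_ : e / (4 * (M + 1)) * (M + 1) <= _).
    rewrite ler_wpM2r; [|lra|]; rewrite -?[X in _ - X](@re1 R) -?reB; first lra.
    by apply: le_trans (re_le _) (le_trans kapE _); rewrite ge_min lexx orbT.
  by rewrite le_eqVlt; apply/orP; left; apply/eqP; field; lra.
have kap2 : re kap <= 2.
  have : `|re kap - 1| <= 1.
    rewrite -[X in _ - X](@re1 R) -reB.
    by apply: le_trans (re_le _) (le_trans kapE _); rewrite ge_min lexx.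
  by rewrite ler_norml; lra.
(* As the average [kap] of [K] is close to 1, it remains to bound the average of
   [(g z - g x) * re (K x)]: by continuity of [g] near [z], by [Kfar] elsewhere. *)
have bd x : nrm x = 1 -> `|(g z - g x) * re (K x)| <= e / 4 * re (K x) + e / 4.
  move=> x1; have k0 := K0 x x1; rewrite normrM (ger0_norm k0).
  have [zx|zx] := ltP (nrm (z - x)) d.
    by apply: le_trans (_ : e / 4 * re (K x) <= _);
      [rewrite ler_wpM2r//; exact: gd|lra].
  have kf := Kfar x x1 zx.
  have : `|g z - g x| <= 2 * M.
    by apply: le_trans (ler_normB _ _) _; have := gM z z1; have := gM x x1; lra.
  have := normr_ge0 (g z - g x); nra.
pose A x := rc (e / 4) * K x + rc (e / 4).
pose B x := rc (g z) * K x + (-1) * (rc (g x) * K x).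
have AE : re (avg n A) = e / 4 * re kap + e / 4.
  by rewrite /A avgD avgZ avg_cst -/kap !reimE; ring.
have BE : re (avg n B) = g z * re kap - re (P z).
  by rewrite /B avgD !avgZ -/kap -/(P z) !reimE; ring.
have reA x : re (A x) = e / 4 * re (K x) + e / 4 by rewrite /A reD re_rcM re_rc.
have reB x : re (B x) = (g z - g x) * re (K x).
  by rewrite /B reD mulN1r reN !re_rcM mulrBl.
have h1 : re (avg n B) <= re (avg n A).
  apply: re_avg_le => x x1; rewrite reA reB; have := bd x x1.
  by rewrite ler_norml => /andP[].
have h2 : re (avg n (fun x => (-1) * A x)) <= re (avg n B).
  apply: re_avg_le => x x1; have -> : re (-1 * A x) = - re (A x).
    by rewrite mulN1r reN.
  by rewrite reA reB; have := bd x x1; rewrite ler_norml => /andP[].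
move: h1 h2; rewrite avgZ mulN1r reN AE BE -/(g z) => h1 h2.
have h3 : `|g z * (1 - re kap)| <= e / 4.
  rewrite normrM distrC; apply: le_trans kapM; rewrite mulrC ler_wpM2l//.
  by have := gM z z1; lra.
move: h3; rewrite !ler_norml; nra.
Qed.

(** Estimates known only off the zeros of [u] extend to such a [w] by continuity. *)
Definition adherent (u : C -> C) (w : C) :=
  forall d : R, 0 < d -> exists w' : C, [/\ nrm (w' - w) < d, nrm w' < 1 & u w' != 0].

Lemma adherent_le u (H : C -> R) (w : C) (e : R) : adherent u w ->
  {for w, continuous H} ->
  (forall w', nrm w' < 1 -> u w' != 0 -> H w' <= e) -> H w <= e.
Proof.
move=> aw /cont_nrmR cH He; rewrite leNgt; apply/negP => eH.
have [d d0 dH] := cH (H w - e) (ltac:(lra)).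
have [w' [/dH w'w w'1 uw']] := aw d d0.
have := He w' w'1 uw'; move: w'w; rewrite ltr_norml; lra.
Qed.

Lemma cont_re (F : C -> C) (w : C) : {for w, continuous F} ->
  {for w, continuous (fun z => re (F z))}.
Proof.
move=> /cont_nrm cF; apply/cont_nrmR => e /cF[d d0 dH]; exists d => // x /dH.
by apply: le_lt_trans; rewrite -reB; exact: re_le.
Qed.

(** For the function [P] of [poisson_approx], the real part of [F - P] is small on the circle, hence
    at 0 by the maximum principle applied to both signs; and [P 0] is the mean of the real part of
    [F]. *)
Lemma re_mean_value u F (e : R) : hol_off u u -> hol_off u F -> adherent u 0 -> 0 < e ->
  exists n0, forall n, (n0 <= n)%N -> `|re (F 0) - re (avg n F)| <= e.
Proof.
move=> hu hF a0 e0; have [n0 nP] := poisson_approx e0 hF.1.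
exists n0 => n /nP[P [dP P0 PF]].
have hP := hol_off_diff u dP.
have -> : re (avg n F) = re (P 0).
  rewrite P0 /avg -rcn -rcV ![rc _ * _]mulrC !reMr; congr (_ * _).
  by rewrite !re_sum.
have nn : nrm (0 : C) <= 1 by rewrite nrm0.
have hN G : hol_off u G -> hol_off u (fun z => (-1) * G z).
  by move=> hG; exact: hol_offM (hol_offC _ _) hG.
have key G : hol_off u G -> (forall z : C, nrm z = 1 -> re (G z) <= e) -> re (G 0) <= e.
  by move=> hG Ge; apply: (adherent_le a0 (cont_re (hG.1 0 nn))); exact: remp_off Ge.
rewrite -reB ler_norml; apply/andP; split.
  have := key _ (hN _ (hol_offD hF (hN _ hP))).
  rewrite !mulN1r reN lerNl; apply => z z1.
  by rewrite !mulN1r reN reB; have := PF z z1; rewrite ler_norml => /andP[? ?]; lra.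
have := key _ (hol_offD hF (hN _ hP)); rewrite !mulN1r; apply => z z1.
by rewrite mulN1r reB; have := PF z z1; rewrite ler_norml => /andP[].
Qed.

Lemma mean_value u F (e : R) : hol_off u u -> hol_off u F -> adherent u 0 -> 0 < e ->
  exists n0, forall n, (n0 <= n)%N -> nrm (F 0 - avg n F) <= e.
Proof.
move=> hu hF a0 e0; have e2 : 0 < e / 2 by lra.
have hG : hol_off u (fun z => (- ii) * F z) by exact: hol_offM (hol_offC _ _) hF.
have [n0 n0P] := re_mean_value hu hF a0 e2.
have [n1 n1P] := re_mean_value hu hG a0 e2.
exists (n0 + n1)%N => n nn.
have := n0P n (leq_trans (leq_addr n1 n0) nn).
have := n1P n (leq_trans (leq_addl n0 n1) nn).
rewrite avgZ; set x := F 0; set y := avg n F => h1 h2.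
apply: le_trans (nrm_le_reim _) _; have -> : e = e / 2 + e / 2 by lra.
apply: lerD; first by rewrite reB.
have E z : re (- ii * z) = im z by rewrite !reimE; ring.
by move: h1; rewrite !E imB.
Qed.

(** On the unit circle [1 - w * cj z] is (z - w) / z: this is the discretized Cauchy integral of [F]
    at [w]. *)
Definition csum n (F : C -> C) (w : C) := avg n (fun z => F z * (1 - w * cj z)^-1).

(* The mean value property of [z (F z - F w) / (z - w)], which vanishes at 0. *)
Lemma cauchy_formula u F (w : C) (e : R) : hol_off u u -> hol_off u F ->
  adherent u 0 -> nrm w < 1 -> u w != 0 -> 0 < e ->
  exists n0, forall n, (n0 <= n)%N -> nrm (F w - csum n F w) <= e.
Proof.
move=> hu hF a0 w1 uw e0.
have [w0|w0] := eqVneq w 0.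
  have [n0 nP] := mean_value hu hF a0 e0; exists n0 => n /nP.
  rewrite w0 /csum; congr (nrm (_ - _) <= _); apply: avg_ext => z _.
  by rewrite mul0r subr0 invr1 mulr1.
have wn0 : 0 < nrm w by rewrite nrm_gt0.
have [D [_ DP]] := diff_nrm1 (hF.2 w w1 uw).
pose Q z : C := if z == w then D else (F z - F w) / (z - w).
pose G z : C := z * Q z.
(* Adding [w] to the exceptional set leaves only the continuity of [Q] to be checked there. *)
pose v z := u z * (z - w).
have vu z : v z != 0 -> u z != 0 /\ z != w.
  by rewrite mulf_eq0 negb_or subr_eq0 => /andP[].
have dv (H : C -> C) : hol_off u H -> hol_off v H.
  by move=> [cH dH]; split=> // z z1 /vu[uz _]; exact: dH.
have hv : hol_off v v.
  apply: hol_offM (dv _ hu) (hol_off_diff _ _) => z _; exact: diff_sub.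
have nearE z : z != w -> \forall y \near z, (F y - F w) / (y - w) = Q y.
  move=> zw; apply/nbhs_nrm; exists (nrm (z - w)).
    by rewrite nrm_gt0 subr_eq0.
  move=> y yz; rewrite /Q; case: eqVneq => // yw.
  by move: yz; rewrite yw nrmC ltxx.
have hQ : hol_off v Q.
  split=> z z1; last first.
    move=> /vu[uz zw]; apply: near_eq_differentiable (nearE z zw) _.
    apply: dfM; first exact: dfB (hF.2 z z1 uz) (dfC _ _).
    by apply: dfV; [exact: diff_sub|rewrite subr_eq0].
  have [->|zw] := eqVneq z w.
    apply/cont_nrm => e1 e10; have [d d0 dH] := DP (e1 / 2) (ltac:(lra)).
    exists d => // x xw; rewrite /Q eqxx; case: eqVneq => [_|xw'].
      by rewrite subrr nrm0.
    have xw0 : x - w != 0 by rewrite subr_eq0.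
    have -> : (F x - F w) / (x - w) - D = (F x - F w - D * (x - w)) / (x - w).
      by field.
    have := dH _ xw; have -> : w + (x - w) = x by ring.
    rewrite nrmcM nrmV => h; rewrite ltr_pdivrMr ?nrm_gt0//.
    by apply: le_lt_trans h _; rewrite ltr_pM2r ?nrm_gt0//; lra.
  have c1 : {for z, continuous (fun y : C => (F y - F w) / (y - w))}.
    apply: cfM; first by apply: cfB; [exact: hF.1|exact: cfC].
    apply: differentiable_continuous; apply: dfV; first exact: diff_sub.
    by rewrite subr_eq0.
  move: c1 => /cont_nrm c1; apply/cont_nrm => e1 /c1[d d0 dH].
  have /nbhs_nrm[d' d'0 d'H] := nearE z zw.
  have Ez := d'H z; rewrite subrr nrm0 in Ez; have {}Ez := Ez d'0.
  exists (Num.min d d'); first by rewrite lt_min d0.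
  by move=> x; rewrite lt_min => /andP[x1 x2]; rewrite -Ez -(d'H _ x2); exact: dH.
have hG : hol_off v G.
  by apply: hol_offM => //; apply: hol_off_diff => z _; exact: dfid.
have av : adherent v 0.
  move=> d d0; have [|w' [ww w'1 uw']] := a0 (Num.min d (nrm w)).
    by rewrite lt_min d0.
  move: ww; rewrite subr0 lt_min => /andP[w'd w'w]; exists w'; split=> //.
    by rewrite subr0.
  rewrite mulf_neq0// subr_eq0; apply: contraTneq w'w => ->.
  by rewrite ltxx.
have [n0 n0P] := mean_value hv hG av (ltac:(lra) : 0 < e / 2).
have wi : 0 <= nrm w < 1 by rewrite nrm_ge0.
have e4 : 0 < Num.min (1 / 2) (e / 2) by rewrite lt_min; lra.
have [n1 n1P] := expr_lt_eps (2 * nrm (F w) + 1) wi e4.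
exists (n0 + n1)%N => n nn.
have {n0P} := n0P n (leq_trans (leq_addr n1 n0) nn).
have {n1P} n1P := n1P n.+1 (leqW (leq_trans (leq_addl n0 n1) nn)).
set y := w ^+ n.+1; have yE : nrm y = nrm w ^+ n.+1 by rewrite nrmX.
rewrite -yE in n1P.
have yn0 := nrm_ge0 y; have Fw0 := nrm_ge0 (F w).
have y1 : nrm y < 1 / 2.
  by move: n1P; rewrite lt_min => /andP[] *; nra.
have ye : 2 * nrm (F w) * nrm y < e / 2.
  by move: n1P; rewrite lt_min => /andP[] *; nra.
have -> : G 0 = 0 by rewrite /G mul0r.
(* On the circle [cj z] is 1 / z, so the mean of F w z / (z - w) is given by [avg_cauchy]: F w / (1
   - y) instead of F w. *)
have -> : avg n G = csum n F w - F w / (1 - y).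
  rewrite -(avg_cauchy n w1) -avgZ -mulN1r -avgZ -avgD; apply: avg_ext => z z1.
  have zw : z != w by apply: contraTneq w1 => <-; rewrite z1 ltxx.
  have zw0 : z - w != 0 by rewrite subr_eq0.
  have z0 : z != 0 by rewrite -nrm_eq0 z1 oner_eq0.
  have -> : cj z = z^-1.
    by apply: (mulfI z0); rewrite mul_cj z1 expr1n rc1 divff.
  by rewrite /G /Q (negPf zw); field; rewrite z0.
rewrite sub0r nrmN => h.
have y0 : 1 - y != 0 by apply: one_sub_neq0; lra.
have y2 : 1 / 2 <= nrm (1 - y).
  by have := nrm_tri (1 : C) y 0; rewrite !subr0 nrm1; lra.
apply: le_trans (nrm_tri _ (F w / (1 - y)) _) _.
have -> : F w - F w / (1 - y) = - (F w * y / (1 - y)) by field.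
have : nrm (F w * y / (1 - y)) <= e / 2.
  apply: le_trans (ltW ye); rewrite !nrmcM nrmV ler_pdivrMr; last lra.
  by have := mulr_ge0 Fw0 yn0; nra.
by rewrite nrmN (nrmC (F w / _)); lra.
Qed.

(** What the Cauchy estimates yield for a function bounded by [M] on the unit circle. Only values of
    [g] on a disc occur, so the property survives uniform limits ([est_lim]). *)
Definition est (M : R) (g : C -> C) := exists2 D : C, nrm D <= M &
  forall t : C, nrm t <= 1 / 2 -> nrm (g t - g 0 - t * D) <= 4 * M * nrm t ^+ 2.

Lemma cluster_seq (D : nat -> C) (M : R) : (forall n, nrm (D n) <= M) ->
  exists2 l : C, nrm l <= M & forall e : R, 0 < e -> forall n0,
    exists2 n, (n0 <= n)%N & nrm (D n - l) < e.
Proof.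
move=> DM; have [] := @compact_disc R 0 M (D @ \oo) _ _.
  by exists 0%N => // n _ /=; rewrite subr0.
move=> l [/=]; rewrite subr0 => lM cl; exists l => // e e0 n0.
have [x [[n nn <-] xe]] := cl [set D n | n in [set n | (n0 <= n)%N]] [set x | nrm (x - l) < e]
  (ltac:(by exists n0 => // n nn; exists n)) (proj2 (nbhs_nrm l _) (ex_intro2 _ _ e e0 (fun _ h => h))).
by exists n.
Qed.

Lemma cont_linR (T : topologicalType) (f g : T -> R) (a : R) (x : T) :
  {for x, continuous f} -> {for x, continuous g} ->
  {for x, continuous (fun y => f y + a * g y)}.
Proof.
by move=> cf cg; apply: cvgD; [exact: cf|apply: cvgM; [exact: cvg_cst|exact: cg]].
Qed.

(* Cauchy estimates of order 2, together with Rado's theorem: differentiability at the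
   zeros of [u] is not assumed. *)
Lemma rado_est u F (M : R) : hol_off u u -> hol_off u F ->
  (forall w : C, nrm w < 1 -> adherent u w) ->
  (forall z : C, nrm z = 1 -> nrm (F z) <= M) -> est M F.
Proof.
move=> hu hF au FM.
have a0 : adherent u 0 by apply: au; rewrite nrm0.
have M0 : 0 <= M by apply: le_trans (FM 1 _); rewrite ?nrm_ge0 ?nrm1.
(* The discretized Cauchy integral for the derivative at 0. A cluster point [D] is enough, as the
   other formulas hold for all large [n]. *)
pose Dn n := avg n (fun z => F z * cj z).
have DM n : nrm (Dn n) <= M.
  by apply: avg_bound => z z1; rewrite nrmcM nrm_cj z1 mulr1 FM.
have [D DM' DP] := cluster_seq DM; exists D => //.
(* The radius 3/4 leaves room beyond 1/2 for the passage to the zeros of [u]; the 4 is the bound of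
   |1 - x|^-1 for |x| <= 3/4. *)
have cs n (w : C) : nrm w <= 3 / 4 ->
    nrm (csum n F w - avg n F - w * Dn n) <= 4 * M * nrm w ^+ 2.
  move=> w34; rewrite /csum /Dn -avgZ -mulN1r -[X in _ - X]mul1r -mulNr -!avgZ -!avgD.
  apply: avg_bound => z z1; set x := w * cj z.
  have xw : nrm x = nrm w by rewrite /x nrmcM nrm_cj z1 mulr1.
  have x0 : 1 - x != 0 by apply: one_sub_neq0; rewrite xw; lra.
  have -> : F z / (1 - x) + -1 * F z + -1 * (w * (F z * cj z)) =
      F z * (x ^+ 2 / (1 - x)).
    have -> : w * (F z * cj z) = F z * x by rewrite /x; ring.
    by field.
  rewrite nrmcM nrmcM nrmX nrmV xw.
  have x4 : 1 / 4 <= nrm (1 - x).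
    by have := nrm_tri (1 : C) x 0; rewrite !subr0 nrm1 xw; lra.
  have -> : 4 * M * nrm w ^+ 2 = M * (4 * nrm w ^+ 2) by ring.
  rewrite ler_pM ?nrm_ge0 ?FM ?mulr_ge0 ?invr_ge0 ?exprn_ge0 ?nrm_ge0//.
  by rewrite ler_pdivrMr; [have := sqr_ge0 (nrm w); nra|lra].
have in34 (w : C) : nrm w <= 3 / 4 -> u w != 0 ->
    nrm (F w - F 0 - w * D) <= 4 * M * nrm w ^+ 2.
  move=> w34 uw; apply/ler_addgt0Pr => e e0; have w1 : nrm w < 1 by lra.
  have [n0 n0P] := cauchy_formula hu hF a0 w1 uw (ltac:(lra) : 0 < e / 3).
  have [n1 n1P] := mean_value hu hF a0 (ltac:(lra) : 0 < e / 3).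
  have [n nn Dn_] := DP (e / 3) (ltac:(lra)) (n0 + n1)%N.
  have h0 := n0P n (leq_trans (leq_addr n1 n0) nn).
  have h1 := n1P n (leq_trans (leq_addl n0 n1) nn); have h2 := cs n w w34.
  have -> : F w - F 0 - w * D = (F w - csum n F w) +
     (csum n F w - avg n F - w * Dn n) - (F 0 - avg n F) + w * (Dn n - D) by ring.
  apply: le_trans (nrmD _ _) _; rewrite nrmcM.
  have hw : nrm w * nrm (Dn n - D) <= e / 3.
    by have := nrm_ge0 (Dn n - D); have := nrm_ge0 w; nra.
  have := nrmB ((F w - csum n F w) + (csum n F w - avg n F - w * Dn n)) (F 0 - avg n F).
  have := nrmD (F w - csum n F w) (csum n F w - avg n F - w * Dn n); lra.
move=> w w12; have w1 : nrm w < 1 by lra.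
pose H (w : C) := nrm (F w - F 0 - w * D) + (- (4 * M)) * (nrm w * nrm w).
have cn : {for w, continuous (fun z : C => nrm z)}.
  by apply: (@cont_nrmfun _ _ _ (fun z => z)); exact: cfid.
suff : H w <= 0 by rewrite /H expr2; lra.
(* Cutting [u] off restricts the comparison in [adherent_le] to points covered by [in34]; nonzeros
   of [u] within 1/4 of [w] survive the cut. *)
pose v z := if nrm z <= 3 / 4 then u z else 0.
apply: (@adherent_le v).
- move=> d d0; have [|w' [w'w w'1 uw']] := au w w1 (Num.min d (1 / 4)).
    by rewrite lt_min d0; lra.
  move: w'w; rewrite lt_min => /andP[w'd w'4]; exists w'; split=> //.
  by rewrite /v ifT//; have := nrmD (w' - w) w; rewrite subrK; lra.
- apply: (@cont_linR _ (fun w => nrm (F w - F 0 - w * D)) (fun w => nrm w * nrm w)).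
    apply: (@cont_nrmfun _ _ _ (fun w => F w - F 0 - w * D)).
    apply: cfB; last by apply: cfM; [exact: cfid|exact: cfC].
    by apply: cfB; [apply: hF.1; lra|exact: cfC].
  exact: (continuousM cn cn).
- move=> w' w'1; rewrite /v; case: ifP => [w'34 uw'|]; last by rewrite eqxx.
  by have := in34 w' w'34 uw'; rewrite /H expr2; lra.
Qed.

End CauchyEstimate.

(** * Holomorphic functions of several variables *)

Section Gateaux.
Context {R : realType}.
Local Notation C := (Cplx R).

(** The derivatives of the approximants are bounded by [M], and any cluster point of them serves as
    the derivative of the limit. *)
Lemma est_lim (M : R) (g : C -> C) :
  (forall e : R, 0 < e -> exists2 g', est M g' &
     forall t : C, nrm t <= 1 / 2 -> nrm (g' t - g t) <= e) -> est M g.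
Proof.
move=> H.
have inv0 n : 0 < n.+1%:R^-1 :> R by rewrite invr_gt0 ltr0n.
have /choice[gD gDP] : forall n : nat, exists x : (C -> C) * C,
    [/\ nrm x.2 <= M,
      forall t : C, nrm t <= 1 / 2 -> nrm (x.1 t - x.1 0 - t * x.2) <= 4 * M * nrm t ^+ 2 &
      forall t : C, nrm t <= 1 / 2 -> nrm (x.1 t - g t) <= n.+1%:R^-1].
  by move=> n; have [g' [D DM DP] gg] := H _ (inv0 n); exists (g', D).
have DnM n : nrm (gD n).2 <= M by have [] := gDP n.
have [D DM DP] := cluster_seq DnM.
exists D => // t t2; apply/ler_addgt0Pr => e e0.
have [n0 n0P] : exists n0 : nat, n0.+1%:R^-1 < e / 3 :> R.
  exists (Num.truncn (3 / e)); rewrite invf_plt ?posrE ?ltr0n//; last lra.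
  by rewrite invf_div; apply: truncnS_gt.
have [n nn Dn] := DP (e / 3) (ltac:(lra)) n0.
have ne : n.+1%:R^-1 < e / 3 :> R.
  by apply: le_lt_trans n0P; rewrite lef_pV2 ?posrE ?ltr0n// ler_nat ltnS.
have [_ h1 h2] := gDP n; have := h1 t t2; have := h2 t t2.
have := h2 0; rewrite nrm0 => /(_ (ltac:(lra))).
set g' := (gD n).1; set D' := (gD n).2 in Dn * => a b c.
have -> : g t - g 0 - t * D =
  (g' t - g' 0 - t * D') - (g' t - g t) + ((g' 0 - g 0) + t * (D' - D)) by ring.
apply: le_trans (nrmD _ _) _.
have := nrmB (g' t - g' 0 - t * D') (g' t - g t).
have := nrmD (g' 0 - g 0) (t * (D' - D)); rewrite nrmcM.
have Dn' : nrm (D' - D) < e / 3 by [].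
have : nrm t * nrm (D' - D) <= e / 3.
  by have := nrm_ge0 t; have := nrm_ge0 (D' - D); nra.
have := le_trans a (ltW ne); have := le_trans b (ltW ne); clear a b ne; lra.
Qed.

Section Frechet.
Context {V : normedModType C}.
Implicit Types (k : V -> C) (p q v w : V).

(** Uniform Cauchy estimates along all short complex lines near [p]. Joint differentiability is not
    part of it but a consequence ([frechet]). *)
Definition lin_est k p (r M : R) := forall q, nrm (q - p) <= r ->
  forall v, nrm v <= r -> est M (fun t => k (q + t *: v)).

Lemma nrm_difflin (f : V -> C) p (L : V -> C) (K : R) : linear L ->
  (forall h, nrm (L h) <= K * nrm h) ->
  (forall e : R, 0 < e -> exists2 d : R, 0 < d &
    forall h, nrm h < d -> nrm (f (p + h) - f p - L h) <= e * nrm h) ->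
  differentiable f p /\ 'd f p = L :> (V -> C).
Proof.
move=> linL; pose aL := GRing.isLinear.Build C V C _ L linL.
pose L' : {linear V -> C} := HB.pack L aL.
exact: (@nrm_diff _ _ _ f p L').
Qed.

Lemma small_eq0 (x : C) (K s0 : R) : 0 < s0 ->
  (forall s, 0 < s -> s <= s0 -> nrm x <= K * s) -> x = 0.
Proof.
move=> s00 H; apply/eqP; rewrite -nrm_eq0 eq_le nrm_ge0 andbT.
apply/ler_addgt0Pr => e e0; rewrite add0r.
pose s := Num.min s0 (e / (`|K| + 1)).
have K1 : 0 < `|K| + 1 by rewrite ltr_wpDl.
have s_0 : 0 < s by rewrite lt_min s00 divr_gt0.
have se : s * (`|K| + 1) <= e by rewrite -ler_pdivlMr// ge_min lexx orbT.
apply: le_trans (H s s_0 _) _; first by rewrite ge_min lexx.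
by have := ler_norm K; nra.
Qed.

Section OneFunction.
Variables (k : V -> C) (p : V) (r M : R).
Hypotheses (r0 : 0 < r) (kE : lin_est k p r M).

Let D q v : C := xget 0 [set D : C | nrm D <= M /\
  forall t : C, nrm t <= 1 / 2 ->
    nrm (k (q + t *: v) - k q - t * D) <= 4 * M * nrm t ^+ 2].

Let DP q v : nrm (q - p) <= r -> nrm v <= r -> nrm (D q v) <= M /\
  forall t : C, nrm t <= 1 / 2 ->
    nrm (k (q + t *: v) - k q - t * D q v) <= 4 * M * nrm t ^+ 2.
Proof.
move=> qp vr; have [d dM dP] := kE qp vr.
apply: (@xgetPex _ 0 [set D : C | nrm D <= M /\ forall t : C, nrm t <= 1 / 2 ->
    nrm (k (q + t *: v) - k q - t * D) <= 4 * M * nrm t ^+ 2]).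
by exists d; split=> // t /dP; rewrite scale0r addr0.
Qed.

Let M0 : 0 <= M.
Proof.
have rp : nrm (p - p) <= r by rewrite subrr nrm0 ltW.
have r_0 : nrm (0 : V) <= r by rewrite nrm0 ltW.
have [DM _] := DP rp r_0.
exact: le_trans (nrm_ge0 _) DM.
Qed.

(** [D] is controlled only on vectors of norm at most [r]; rescaling [v] to norm [r] makes the
    bounds homogeneous in [v]. *)
Let der q v : C := rc (nrm v / r) * D q (rc (r / nrm v) *: v).
Let K := 4 * M / r ^+ 2.

Let K0 : 0 <= K.
Proof. by rewrite divr_ge0 ?sqr_ge0// mulr_ge0. Qed.

Let unit_ v : nrm (rc (r / nrm v) *: v) <= r.
Proof.
have [->|v0] := eqVneq v 0; first by rewrite scaler0 nrm0 ltW.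
rewrite nrmZ nrm_rc ger0_norm ?divr_ge0 ?nrm_ge0 ?(ltW r0)//.
by rewrite divfK ?nrm_eq0.
Qed.

Let der_le q v : nrm (q - p) <= r -> nrm (der q v) <= M / r * nrm v.
Proof.
move=> qp; have [h _] := DP qp (unit_ v); rewrite /der nrmcM nrm_rc.
rewrite ger0_norm ?divr_ge0 ?nrm_ge0 ?(ltW r0)//.
apply: le_trans (ler_wpM2l _ h) _; first by rewrite divr_ge0 ?nrm_ge0 ?ltW.
by rewrite le_eqVlt; apply/orP; left; apply/eqP; ring.
Qed.

Let derP q v (t : C) : nrm (q - p) <= r -> nrm t * nrm v <= r / 2 ->
  nrm (k (q + t *: v) - k q - t * der q v) <= K * (nrm t * nrm v) ^+ 2.
Proof.
have r_gt0 := r0; have M_ge0 := M0.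
move=> qp tv; have [->|v0] := eqVneq v 0.
  rewrite scaler0 addr0 subrr sub0r /der nrm0 mul0r rc0 mul0r mulr0 nrmN nrm0.
  by rewrite mulr0 expr0n mulr0.
have v0' : 0 < nrm v by rewrite nrm_gt0.
pose T := t * rc (nrm v / r).
have TE : T *: (rc (r / nrm v) *: v) = t *: v.
  rewrite scalerA /T -mulrA -rcM mulrA divfK ?gt_eqF// divff ?gt_eqF//.
  by rewrite rc1 mulr1.
have nT : nrm T = nrm t * nrm v / r.
  by rewrite /T nrmcM nrm_rc ger0_norm ?divr_ge0 ?nrm_ge0 ?(ltW r0)// mulrA.
have [_ /(_ T)] := DP qp (unit_ v); rewrite TE nT => H.
have -> : t * der q v = T * D q (rc (r / nrm v) *: v) by rewrite /der /T mulrA.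
apply: le_trans (H _) _; first by rewrite ler_pdivrMr//; lra.
by rewrite le_eqVlt; apply/orP; left; apply/eqP; rewrite /K; field; rewrite gt_eqF.
Qed.

Let lip q v (t : C) : nrm (q - p) <= r -> nrm t * nrm v <= r / 2 ->
  nrm (k (q + t *: v) - k q) <= (3 * M / r) * (nrm t * nrm v).
Proof.
have r_gt0 := r0; have M_ge0 := M0.
move=> qp tv; have h1 := derP qp tv; have h2 := der_le v qp.
have -> : k (q + t *: v) - k q = (k (q + t *: v) - k q - t * der q v) + t * der q v.
  by ring.
apply: le_trans (nrmD _ _) _; rewrite nrmcM.
set a := nrm t * nrm v in tv h1 *.
have a0 : 0 <= a by rewrite mulr_ge0 ?nrm_ge0.
have b : nrm t * nrm (der q v) <= M / r * a.
  by apply: le_trans (ler_wpM2l (nrm_ge0 _) h2) _; rewrite /a mulrCA.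
have c : K * a ^+ 2 <= 2 * M / r * a.
  have -> : 2 * M / r * a = K * (r / 2 * a) by rewrite /K; field; rewrite gt_eqF.
  by rewrite ler_wpM2l// expr2 ler_wpM2r.
have -> : 3 * M / r * a = 2 * M / r * a + M / r * a by ring.
by apply: lerD b; exact: le_trans h1 c.
Qed.

Let Mr0 : 0 <= M / r. Proof. by rewrite divr_ge0// ltW. Qed.

(** Compares increments of [k] along [s v] from [y] and from [q]: these differ by two Lipschitz
    terms in [y - q], and each approximates [s] times a derivative up to second order. The step [s]
    stays free, to be balanced against [y - q]. *)
Let der_cont q y v (s : R) : nrm (q - p) <= r / 2 -> nrm (y - q) <= r / 2 -> 0 < s ->
  s * nrm v <= r / 2 ->
  s * nrm (der y v - der q v) <= 6 * (M / r) * nrm (y - q) + 2 * K * (s * nrm v) ^+ 2.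
Proof.
have r_gt0 := r0; have M_ge0 := M0; have K_ge0 := K0.
move=> qp yq s0 sv; have sE : nrm (rc s) = s by rewrite nrm_rc gtr0_norm.
have yp : nrm (y - p) <= r by apply: le_trans (nrm_tri _ q _) _; lra.
have qp' : nrm (q - p) <= r by apply: le_trans qp _; lra.
have := @derP y v (rc s) yp; have := @derP q v (rc s) qp'; rewrite !sE => /(_ sv) h1 /(_ sv) h2.
have l1 := @lip q (y - q) 1 qp'; rewrite nrm1 mul1r scale1r in l1.
have {l1} l1 := l1 yq.
have qs : nrm (q + rc s *: v - p) <= r.
  by rewrite addrAC; apply: le_trans (nrmD _ _) _; rewrite nrmZ sE; lra.
have := @lip (q + rc s *: v) (y - q) 1 qs; rewrite nrm1 mul1r scale1r => /(_ yq) l2.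
rewrite -{1}sE -nrmcM.
have -> : rc s * (der y v - der q v) =
  (k (q + rc s *: v + (y - q)) - k (q + rc s *: v)) - (k (q + (y - q)) - k q)
  + ((k (q + rc s *: v) - k q - rc s * der q v)
   - (k (y + rc s *: v) - k y - rc s * der y v)).
  have -> : q + (y - q) = y by rewrite addrC subrK.
  have -> : q + rc s *: v + (y - q) = y + rc s *: v.
    by rewrite addrAC [q + _]addrC subrK.
  by ring.
apply: le_trans (nrmD _ _) _; apply: lerD.
  by apply: le_trans (nrmB _ _) _; lra.
by apply: le_trans (nrmB _ _) _; lra.
Qed.

(** The increment along t (a v + w) is the one along t a v, ending at [y], followed by the one along
    t w from [y]; then [der_cont] moves the last derivative from [y] back to [q]. *)
Let der_lin q : nrm (q - p) <= r / 2 -> linear (der q).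
Proof.
have r_gt0 := r0; have M_ge0 := M0; have K_ge0 := K0.
move=> qp; have qp' : nrm (q - p) <= r by apply: le_trans qp _; lra.
move=> a v w; rewrite -[a *: der q v]/(a * der q v).
pose N := nrm a * nrm v + nrm v + nrm w + nrm (a *: v + w) + 1.
have N0 : 0 < N by rewrite /N !ltr_wpDl// ?addr_ge0 ?mulr_ge0 ?nrm_ge0.
have [av [vn [wn an]]] : nrm a * nrm v <= N /\ nrm v <= N /\ nrm w <= N /\ nrm (a *: v + w) <= N.
  have := nrm_ge0 v; have := nrm_ge0 w; have := nrm_ge0 (a *: v + w).
  have := mulr_ge0 (nrm_ge0 a) (nrm_ge0 v); rewrite /N; lra.
pose s0 := Num.min 1 (r / 2 / N).
have s00 : 0 < s0 by rewrite lt_min ltr01 divr_gt0//; lra.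
have [s01 s0N] : s0 <= 1 /\ s0 * N <= r / 2.
  by rewrite -ler_pdivlMr// !ge_min !lexx orbT.
apply: subr0_eq.
apply: (@small_eq0 _ (3 * K * N ^+ 2 + 6 * (M / r) * N + 2 * K * N ^+ 2) s0 s00) => s sp ss.
(* With [t = s ^+ 2] the distance from [y] to [q] is O(s^2), so [der_cont] with step [s] has error
   O(s); the second order errors divided by [t] are O(s) as well. *)
pose t := s ^+ 2; have tp : 0 < t by rewrite exprn_gt0.
have ts : t <= s by rewrite /t expr2; nra.
have tE : nrm (rc t) = t by rewrite nrm_rc gtr0_norm.
have sN : s * N <= r / 2 by nra.
have tN : t * N <= r / 2 by nra.
have tx x : x <= N -> t * x <= r / 2 by nra.
have h1 := @derP q (a *: v + w) (rc t) qp'; rewrite tE in h1; have {}h1 := h1 (tx _ an).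
have h2 := @derP q v (rc t * a) qp'; rewrite nrmcM tE -mulrA in h2; have {}h2 := h2 (tx _ av).
pose y := q + rc t *: (a *: v).
have yq : nrm (y - q) <= r / 2.
  by rewrite /y addrAC subrr add0r !nrmZ tE; exact: tx.
have yqN : nrm (y - q) <= t * N.
  by rewrite /y addrAC subrr add0r !nrmZ tE; rewrite ler_wpM2l// ltW.
have yp : nrm (y - p) <= r by apply: le_trans (nrm_tri _ q _) _; lra.
have h3 := @derP y w (rc t) yp; rewrite tE in h3; have {}h3 := h3 (tx _ wn).
have h4 := @der_cont q y w s qp yq sp (ltac:(nra)).
have {h4} h4 : nrm (der y w - der q w) <= (6 * (M / r) * N + 2 * K * N ^+ 2) * s.
  rewrite -(ler_pM2l sp); apply: le_trans h4 _.
  have e1 : 6 * (M / r) * nrm (y - q) <= 6 * (M / r) * (t * N).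
    by rewrite ler_wpM2l// mulr_ge0.
  have e2 : 2 * K * (s * nrm w) ^+ 2 <= 2 * K * (t * N ^+ 2).
    apply: ler_wpM2l; first by rewrite mulr_ge0.
    rewrite /t exprMn; apply: ler_wpM2l; first exact: sqr_ge0.
    by rewrite lerXn2r ?nnegrE ?nrm_ge0// ltW.
  apply: le_trans (lerD e1 e2) _; rewrite /t le_eqVlt; apply/orP; left; apply/eqP; ring.
have sq x : 0 <= x -> x <= N -> K * (t * x) ^+ 2 <= K * N ^+ 2 * s * t.
  move=> x0 xN; have xN2 : x ^+ 2 <= N ^+ 2 by rewrite lerXn2r ?nnegrE// ltW.
  have -> : K * (t * x) ^+ 2 = K * (t * (t * x ^+ 2)) by ring.
  have -> : K * N ^+ 2 * s * t = K * (t * (s * N ^+ 2)) by ring.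
  apply: ler_wpM2l => //; apply: ler_wpM2l; first exact: ltW.
  by apply: ler_pM => //; [exact: ltW|exact: sqr_ge0].
have {h1} h1 := le_trans h1 (sq _ (nrm_ge0 _) an).
have {h2} h2 := le_trans h2 (sq _ (mulr_ge0 (nrm_ge0 _) (nrm_ge0 _)) av).
have {h3} h3 := le_trans h3 (sq _ (nrm_ge0 _) wn).
have main : nrm (der q (a *: v + w) - a * der q v - der y w) <= 3 * K * N ^+ 2 * s.
  rewrite -(ler_pM2l tp) -{1}tE -nrmcM.
  have -> : rc t * (der q (a *: v + w) - a * der q v - der y w) =
     (k (y + rc t *: w) - k y - rc t * der y w)
   + (k (q + (rc t * a) *: v) - k q - rc t * a * der q v)
   - (k (q + rc t *: (a *: v + w)) - k q - rc t * der q (a *: v + w)).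
    have -> : q + rc t *: (a *: v + w) = y + rc t *: w by rewrite /y scalerDr addrA.
    have -> : q + (rc t * a) *: v = y by rewrite /y scalerA.
    by ring.
  apply: le_trans (nrmB _ _) _; apply: le_trans (lerD (nrmD _ _) (lexx _)) _.
  by apply: le_trans (lerD (lerD h3 h2) h1) _; rewrite le_eqVlt; apply/orP; left; apply/eqP; ring.
have -> : der q (a *: v + w) - (a * der q v + der q w) =
  (der q (a *: v + w) - a * der q v - der y w) + (der y w - der q w) by ring.
apply: le_trans (nrmD _ _) _; apply: le_trans (lerD main h4) _.
by rewrite le_eqVlt; apply/orP; left; apply/eqP; ring.
Qed.

Let frechet_aux q : nrm (q - p) <= r / 2 -> differentiable k q /\ 'd k q = der q :> (V -> C).
Proof.
have r_gt0 := r0; have M_ge0 := M0; have K_ge0 := K0.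
move=> qp; have qp' : nrm (q - p) <= r by apply: le_trans qp _; lra.
apply: (nrm_difflin (der_lin qp) (K := M / r)) => [h|e e0]; first exact: der_le.
have K1 : 0 < K + 1 by rewrite ltr_wpDl.
exists (Num.min (r / 2) (e / (K + 1))); first by rewrite lt_min !divr_gt0.
move=> h; rewrite lt_min => /andP[h1 h2].
have := @derP q h 1 qp'; rewrite nrm1 !mul1r scale1r => /(_ (ltW h1)) H.
apply: le_trans H _; rewrite expr2 mulrA ler_wpM2r ?nrm_ge0//.
by move: h2; rewrite ltr_pdivlMr//; have := nrm_ge0 h; nra.
Qed.

Lemma frechet q : nrm (q - p) <= r / 2 ->
  [/\ differentiable k q, forall v, nrm ('d k q v) <= M / r * nrm v &
  forall v, nrm v <= r / 2 ->
    nrm (k (q + v) - k q - 'd k q v) <= 4 * M / r ^+ 2 * nrm v ^+ 2].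
Proof.
have r_gt0 := r0; have M_ge0 := M0; have K_ge0 := K0.
move=> qp; have [dk ->] := frechet_aux qp.
have qp' : nrm (q - p) <= r by apply: le_trans qp _; lra.
split=> // v; first exact: der_le.
by move=> vr; have := @derP q v 1 qp'; rewrite nrm1 !mul1r scale1r; apply.
Qed.

(** Strict differentiability, the source of local injectivity in [expanding]: the second order
    estimate is taken at [y], and [der_cont] replaces the derivative at [y] by the one at [p]. *)
Lemma strict_diff (e : R) : 0 < e -> exists2 d : R, 0 < d &
  forall x y, nrm (x - p) < d -> nrm (y - p) < d ->
    nrm (k x - k y - 'd k p (x - y)) <= e * nrm (x - y).
Proof.
have r_gt0 := r0; have M_ge0 := M0; have K_ge0 := K0.
move=> e0; have p0 : nrm (p - p) <= r / 2 by rewrite subrr nrm0; lra.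
have K1 : 0 < 4 * K + 1 by rewrite ltr_wpDl// mulr_ge0.
(* [rho] is the length to which [x - y] is rescaled in [der_cont]: small enough for the second order
   terms, while [d] is small against [rho] for the Lipschitz term. *)
pose rho := Num.min (r / 2) (e / 2 / (4 * K + 1)).
have rho0 : 0 < rho by rewrite lt_min !divr_gt0.
have rho1 : rho * (4 * K + 1) <= e / 2 by rewrite -ler_pdivlMr// ge_min lexx orbT.
have rho2 : rho <= r / 2 by rewrite ge_min lexx.
pose L := 6 * (M / r) + 1; have L1 : 0 < L by rewrite ltr_wpDl// mulr_ge0.
pose d := Num.min (rho / 2) (e / 4 * rho / L).
have d0 : 0 < d by rewrite lt_min; apply/andP; split; [|rewrite divr_gt0// mulr_gt0//]; lra.
have d1 : d <= rho / 2 by rewrite ge_min lexx.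
have d2 : d * L <= e / 4 * rho by rewrite -ler_pdivlMr// ge_min lexx orbT.
exists d => // x y xp yp.
have yp2 : nrm (y - p) <= r / 2 by lra.
have [dky der_le' q2] := frechet yp2.
have xy : nrm (x - y) <= rho.
  by apply: le_trans (nrm_tri _ p _) _; rewrite (nrmC p); lra.
have := q2 (x - y) (le_trans xy rho2); rewrite [y + _]addrC subrK => h1.
have [_ dy] := frechet_aux yp2; have [_ dp] := frechet_aux p0.
have [xy0|xy0] := eqVneq x y.
  by rewrite xy0 !subrr linear0 subr0 !nrm0 mulr0.
have n0 : 0 < nrm (x - y) by rewrite nrm_gt0 subr_eq0.
pose s := rho / nrm (x - y); have s0 : 0 < s by rewrite divr_gt0.
have sn : s * nrm (x - y) = rho by rewrite /s divfK// gt_eqF.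
have h2 := @der_cont p y (x - y) s p0 yp2 s0; rewrite sn in h2; have {}h2 := h2 rho2.
have {h2} h2 : nrm (der y (x - y) - der p (x - y)) <= 3 * e / 4 * nrm (x - y).
  rewrite -(ler_pM2l s0) mulrCA sn; apply: le_trans h2 _.
  have : 6 * (M / r) * nrm (y - p) <= e / 4 * rho.
    have h3 : 6 * (M / r) * nrm (y - p) <= 6 * (M / r) * d.
      by apply: ler_wpM2l; [rewrite mulr_ge0|exact: ltW].
    by move: d2; rewrite /L; lra.
  have : 2 * K * rho ^+ 2 <= e / 4 * rho by rewrite expr2; nra.
  have := mulr_gt0 e0 rho0; lra.
have -> : k x - k y - 'd k p (x - y) = (k x - k y - 'd k y (x - y)) +
    (der y (x - y) - der p (x - y)) by rewrite dy dp; ring.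
apply: le_trans (nrmD _ _) _.
have : 4 * M / r ^+ 2 * nrm (x - y) ^+ 2 <= e / 4 * nrm (x - y).
  rewrite expr2 mulrA ler_wpM2r ?nrm_ge0// -/K; nra.
lra.
Qed.

End OneFunction.

Lemma diff_line k q v (t : C) : differentiable k (q + t *: v) ->
  differentiable (fun s : C => k (q + s *: v)) t.
Proof.
move=> dk; apply: (@differentiable_comp _ _ _ _ (fun s : C => q + s *: v)) => //.
Qed.

(** The classical case [u = 1] of [rado_est], on each disc t -> q + t v. *)
Lemma hol_lin_est k p (r M : R) : 0 < r ->
  (forall q, nrm (q - p) <= 2 * r -> differentiable k q /\ nrm (k q) <= M) ->
  lin_est k p r M.
Proof.
move=> r0 H q qp v vr.
have inb (t : C) : nrm t <= 1 -> nrm (q + t *: v - p) <= 2 * r.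
  move=> t1; rewrite addrAC; apply: le_trans (nrmD _ _) _; rewrite nrmZ.
  by have := nrm_ge0 v; nra.
apply: (@rado_est R (fun=> 1)).
- exact: hol_offC.
- by apply: hol_off_diff => t t1; apply: diff_line; apply: (H _ _).1; exact: inb.
- by move=> w w1 d d0; exists w; rewrite subrr nrm0 oner_eq0.
- by move=> t t1; apply: (H _ _).2; apply: inb; rewrite t1.
Qed.

Lemma lin_est_lim k p (r M : R) :
  (forall e : R, 0 < e -> exists2 k', lin_est k' p r M &
    forall q, nrm (q - p) <= 2 * r -> nrm (k' q - k q) <= e) ->
  lin_est k p r M.
Proof.
move=> H q qp v vr; apply: est_lim => e /H[k' k'E k'k].
exists (fun t => k' (q + t *: v)); first exact: k'E.
move=> t t2; apply: k'k; rewrite addrAC; apply: le_trans (nrmD _ _) _; rewrite nrmZ.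
by have := nrm_ge0 v; nra.
Qed.

Lemma hol_lin_est_loc k p (r : R) : 0 < r ->
  (forall q, nrm (q - p) < r -> differentiable k q) ->
  exists r' M, [/\ 0 < r', r' <= r & lin_est k p r' M].
Proof.
move=> r0 dk; have dkp : differentiable k p by apply: dk; rewrite subrr nrm0.
have /cont_nrm/(_ 1 ltr01)[d d0 dH] := differentiable_continuous dkp.
pose r' := Num.min r d / 3.
have m0 : 0 < Num.min r d by rewrite lt_min r0.
have mr : Num.min r d <= r by rewrite ge_min lexx.
exists r', (nrm (k p) + 1); rewrite /r'; split; [lra|lra|].
apply: hol_lin_est => [|q qp]; first lra.
have : nrm (q - p) < Num.min r d by lra.
rewrite lt_min => /andP[qr qd]; split; first exact: dk.
by have := nrmD (k q - k p) (k p); have := dH q qd; rewrite subrK; lra.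
Qed.

(** The difference quotients in direction [v] are holomorphic and, by the second order estimate,
    converge uniformly near [p] to the derivative, so [lin_est] passes to the limit. *)
Lemma diff_derive k p v (r : R) : 0 < r ->
  (forall q, nrm (q - p) < r -> differentiable k q) ->
  differentiable (fun q => 'd k q v) p.
Proof.
move=> r0 dk; have [r1 [M [r10 r1r kE]]] := hol_lin_est_loc r0 dk.
have M0 : 0 <= M.
  have [D DM _] := kE p (ltac:(rewrite subrr nrm0; lra)) 0 (ltac:(rewrite nrm0; lra)).
  exact: le_trans (nrm_ge0 _) DM.
pose K := 4 * M / r1 ^+ 2.
have K0 : 0 <= K by rewrite divr_ge0 ?sqr_ge0// mulr_ge0.
have v0 := nrm_ge0 v; have Mr : 0 <= M / r1 by rewrite divr_ge0// ltW.
have inr1 (q : V) (s : R) : nrm (q - p) <= r1 / 2 -> 0 < s -> s * nrm v < r1 / 2 ->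
    nrm (q + rc s *: v - p) < r.
  move=> qp s0 sv; rewrite addrAC; apply: le_lt_trans (nrmD _ _) _.
  by rewrite nrmZ nrm_rc gtr0_norm//; lra.
suff H : lin_est (fun q => 'd k q v) p (r1 / 4) (M / r1 * nrm v + 1).
  by have [] := @frechet _ p (r1 / 4) _ (ltac:(lra)) H p; rewrite ?subrr ?nrm0//; lra.
apply: lin_est_lim => e e0.
have N1 : 0 < K * nrm v ^+ 2 + nrm v + 1.
  by rewrite ltr_wpDl// addr_ge0// mulr_ge0// sqr_ge0.
pose m := Num.min (Num.min 1 e) (r1 / 2).
have m0 : 0 < m by rewrite !lt_min ltr01 e0; lra.
pose s := m / (K * nrm v ^+ 2 + nrm v + 1).
have s0 : 0 < s by rewrite divr_gt0.
have sE : s * (K * nrm v ^+ 2 + nrm v + 1) = m by rewrite /s divfK// gt_eqF.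
have m1 : m <= 1 by rewrite !ge_min lexx.
have me : m <= e by rewrite !ge_min lexx orbT.
have mr : m <= r1 / 2 by rewrite ge_min lexx orbT.
have Kv : 0 <= K * nrm v ^+ 2 by rewrite mulr_ge0// sqr_ge0.
have sv : s * nrm v < r1 / 2 by nra.
have sK : K * nrm v ^+ 2 * s <= m by nra.
pose k' q := (k (q + rc s *: v) - k q) / rc s.
have snz : rc s != 0 by rewrite rc_eq0 gt_eqF.
have k'k q : nrm (q - p) <= r1 / 2 -> nrm (k' q - 'd k q v) <= m.
  move=> qp; have [dq dle q2] := frechet r10 kE qp.
  have lin : 'd k q (rc s *: v) = rc s * 'd k q v by rewrite linearZ.
  have := q2 (rc s *: v); rewrite nrmZ nrm_rc gtr0_norm// lin.
  move=> /(_ (ltW sv)) h.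
  have -> : k' q - 'd k q v = (k (q + rc s *: v) - k q - rc s * 'd k q v) / rc s.
    by rewrite /k'; field.
  rewrite nrmcM nrmV nrm_rc gtr0_norm// ler_pdivrMr//; apply: le_trans h _.
  by rewrite -/K exprMn expr2; move: sK; nra.
exists k'; last by move=> q qp; apply: le_trans (k'k q _) me; lra.
apply: hol_lin_est => [|q qp]; first lra.
have {}qp : nrm (q - p) <= r1 / 2 by lra.
split.
  apply: dfM (dfC _ _); apply: dfB; last by apply: dk; lra.
  apply: (@differentiable_comp _ _ _ _ (fun q => q + rc s *: v) k); last first.
    exact: dk (inr1 q s qp s0 sv).
  apply: (@differentiableD _ _ _ (fun q => q) (fun=> rc s *: v)).
    by apply: (@linear_differentiable _ _ _ idfun) => y; exact: cvg_id.
  exact: differentiable_cst.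
have [dq dle q2] := frechet r10 kE qp.
have := nrmD (k' q - 'd k q v) ('d k q v); rewrite subrK.
by have := k'k q qp; have := dle v; lra.
Qed.

End Frechet.
End Gateaux.

Lemma unitmx_fieldE (F : fieldType) n (A : 'M[F]_n) : (A \in unitmx) = (\det A != 0).
Proof. by rewrite unitmxE unitfE. Qed.

(** * The inverse function theorem *)

Section FiniteDim.
Context {R : realType}.
Local Notation C := (Cplx R).

Lemma nrm_coord {n} (v : 'rV[C]_n) j : nrm (v 0 j) <= nrm v.
Proof.
suff : `|v 0 j| <= `|v| by rewrite !nrmE lecR.
rewrite -[`|v|]/(mx_norm v) /mx_norm -[leLHS]nngE num_le.
exact: (le_bigmax _ (fun i => `|v i.1 i.2|%:nng) (0, j)).
Qed.

Lemma nrm_row {n} (v : 'rV[C]_n) (e : R) : 0 <= e ->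
  (forall j, nrm (v 0 j) <= e) -> nrm v <= e.
Proof.
move=> e0 H; have [->|v0] := eqVneq v 0; first by rewrite nrm0.
have [|[i j] E] := @mx_norm_neq0 _ _ _ v.
  by rewrite -normr_eq0 in v0.
suff -> : nrm v = nrm (v 0 j) by [].
by rewrite /nrm -[`|v|]/(mx_norm v) E /= (ord1 i).
Qed.

Lemma small_delta (I : finType) (P : I -> R -> Prop) :
  (forall i, exists2 d : R, 0 < d & forall d', 0 < d' -> d' <= d -> P i d') ->
  exists2 d : R, 0 < d & forall i, P i d.
Proof.
move=> H; have : \forall d \near (0 : R)^'+, forall i, P i d.
  apply: filter_forall => i; have [d d0 dP] := H i.
  near=> d'; apply: dP; near: d'; first exact: nbhs_right_gt.
  exact: nbhs_right_le.
move=> H'; near (0 : R)^'+ => d; exists d => //.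
by near: d.
Unshelve. all: by end_near. Qed.

Lemma mulmx_lip {m n} (B : 'M[C]_(m, n)) : exists2 c : R, 0 < c &
  forall v : 'rV[C]_m, nrm (v *m B) <= c * nrm v.
Proof.
exists (\sum_i \sum_j nrm (B i j) + 1).
  by rewrite ltr_wpDl// sumr_ge0// => i _; rewrite sumr_ge0// => j _; exact: nrm_ge0.
have c0 : 0 <= \sum_i \sum_j nrm (B i j).
  by rewrite sumr_ge0// => i _; rewrite sumr_ge0// => j _; exact: nrm_ge0.
move=> v; apply: nrm_row => [|j].
  by rewrite mulr_ge0 ?nrm_ge0// addr_ge0.
rewrite mxE; apply: le_trans (nrm_sum _ _ _) _.
apply: le_trans (_ : (\sum_i \sum_j nrm (B i j)) * nrm v <= _); last first.
  by rewrite ler_wpM2r ?nrm_ge0// lerDl.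
rewrite mulr_suml; apply: ler_sum => i _; rewrite nrmcM mulrC.
apply: ler_pM; rewrite ?nrm_ge0// ?nrm_coord//.
by rewrite (bigD1 j)//= lerDl sumr_ge0// => k _; exact: nrm_ge0.
Qed.

Lemma compact_ball {n} (p : 'rV[C]_n) (r : R) : compact [set x | nrm (x - p) <= r].
Proof.
apply: (subclosed_compact _ (@rV_compact C n (fun j => [set z | nrm (z - p 0 j) <= r]) _)).
- exact: closed_ball_nrm.
- by move=> j; exact: compact_disc.
- move=> x /= xp j; apply: le_trans xp; have := nrm_coord (x - p) j.
  by rewrite !mxE.
Qed.

Lemma df_coord {V : normedModType C} {n} (f : V -> 'rV[C]_n) (q : V) :
  differentiable f q -> forall j, differentiable (fun x => f x 0 j) q /\
    forall v, 'd (fun x => f x 0 j) q v = ('d f q v) 0 j.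
Proof.
move=> df j; pose c (x : 'rV[C]_n) : C := x 0 j.
have lc : linear c by move=> a x y; rewrite /c !mxE.
pose c' : {linear 'rV[C]_n -> C} := HB.pack c (GRing.isLinear.Build _ _ _ _ c lc).
have cc : continuous c' by exact: coord_continuous.
have dc : differentiable c (f q) by exact: differentiable_coord.
split; first exact: (differentiable_comp df dc).
move=> v; have := @diff_comp _ _ _ _ f c q df dc.
have -> : ('d c (f q) : 'rV[C]_n -> C) = c by exact: (@diff_lin _ _ _ c' (f q) cc).
by move=> /(congr1 (fun g => g v)).
Qed.

Lemma df_row {V : normedModType C} {n} (f : V -> 'rV[C]_n) (q : V) (L : V -> 'rV[C]_n) (K : R) :
  linear L -> (forall h, nrm (L h) <= K * nrm h) ->
  (forall e : R, 0 < e -> exists2 d : R, 0 < d &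
    forall h, nrm h < d -> nrm (f (q + h) - f q - L h) <= e * nrm h) ->
  differentiable f q /\ 'd f q = L :> (V -> 'rV[C]_n).
Proof.
move=> linL; pose L' : {linear V -> 'rV[C]_n} := HB.pack L (GRing.isLinear.Build C V _ _ L linL).
exact: (@nrm_diff _ _ _ f q L').
Qed.

Lemma jacobianE {m n} (f : 'rV[C]_m -> 'rV[C]_n) q v : 'd f q v = v *m jacobian f q.
Proof. by rewrite /jacobian mul_rV_lin1. Qed.

Lemma df_mulmx {V : normedModType C} {m n} (f : V -> 'rV[C]_m) (B : 'M[C]_(m, n)) q :
  differentiable f q -> differentiable (fun x => f x *m B) q /\
    forall v, 'd (fun x => f x *m B) q v = 'd f q v *m B.
Proof.
move=> df; pose c (x : 'rV[C]_m) := x *m B.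
have lc : linear c by move=> a x y; rewrite /c mulmxDl scalemxAl.
have [k k0 kP] := mulmx_lip B.
have [dc dE] : differentiable c (f q) /\ 'd c (f q) = c :> (_ -> _).
  apply: (df_row lc kP) => e e0; exists 1 => // h _.
  rewrite /c mulmxDl [f q *m B + _]addrC addrK subrr nrm0.
  by rewrite mulr_ge0 ?nrm_ge0// ltW.
split; first exact: (differentiable_comp df dc).
move=> v; have := @diff_comp _ _ _ _ f c q df dc.
by rewrite dE => /(congr1 (fun g => g v)).
Qed.

Lemma det_jacobian_diff {n} (f : 'rV[C]_n -> 'rV[C]_n) p (r : R) : 0 < r ->
  (forall q, nrm (q - p) < r -> differentiable f q) ->
  forall q, nrm (q - p) < r -> differentiable (fun q => \det (jacobian f q)) q.
Proof.
move=> r0 df q qp.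
pose s := (r - nrm (q - p)) / 2; have s0 : 0 < s by rewrite /s; lra.
have sub x : nrm (x - q) < s -> nrm (x - p) < r.
  by move=> xq; apply: le_lt_trans (nrm_tri _ q _) _; move: xq; rewrite /s; lra.
have dent i j : differentiable (fun q => jacobian f q i j) q.
  apply: (@near_eq_differentiable _ _ _ (fun x => 'd (fun y => f y 0 j) x (delta_mx 0 i))).
    apply/nbhs_nrm; exists s => // x /sub /df /df_coord /(_ j)[_ ->].
    by rewrite jacobianE -rowE mxE.
  apply: (@diff_derive _ _ _ _ _ s) => // x /sub /df /df_coord /(_ j)[] //.
rewrite /determinant; apply: dfsum => t; apply: dfM; first exact: dfC.
elim: (index_enum _) => [|i l IH].
  by under eq_fun do rewrite big_nil; exact: dfC.
by under eq_fun do rewrite big_cons; exact: dfM.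
Qed.

Lemma compact_pos_min {n} (K : set 'rV[C]_n) (h : 'rV[C]_n -> R) : compact K ->
  (forall x, K x -> {for x, continuous h}) -> (forall x, K x -> 0 < h x) ->
  exists2 d : R, 0 < d & forall x, K x -> d <= h x.
Proof.
move=> cK ch h0; have [[x Kx]|K0] := pselect (K !=set0); last first.
  by exists 1 => // x Kx; case: K0; exists x.
have [|c] := @compact_EVT_min _ R h K (ex_intro _ x Kx) cK.
  by apply: continuous_in_subspaceT => z; rewrite inE; exact: ch.
rewrite inE => Kc cm; exists (h c); first exact: h0.
by move=> y Ky; apply: cm; rewrite inE.
Qed.

Lemma diff_eps {V W : normedModType C} (f : V -> W) (p : V) : differentiable f p ->
  forall e : R, 0 < e -> exists2 d : R, 0 < d &
    forall x, nrm (x - p) < d -> nrm (f x - f p) < e.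
Proof. by move=> df; apply/cont_nrm; exact: differentiable_continuous. Qed.

Lemma cont_nrm_subc {V W : normedModType C} (f : V -> W) (p : V) w :
  {for p, continuous f} -> {for p, continuous (fun x => nrm (f x - w))}.
Proof.
move=> cf; apply: (@cont_nrmfun _ _ _ (fun x => f x - w)).
by apply: (@continuousB _ _ _ f (fun=> w)) => //; exact: cvg_cst.
Qed.

Lemma cont_nrm_sub {V W : normedModType C} (f : V -> W) (p : V) w :
  differentiable f p -> {for p, continuous (fun x => nrm (f x - w))}.
Proof. by move=> /differentiable_continuous; exact: cont_nrm_subc. Qed.

Section Inverse.
Context {n : nat}.
Local Notation V := 'rV[C]_n.
Implicit Types (f : V -> V) (p q x y w : V).

Lemma unitmx_det (A : 'M[C]_n) : A \in unitmx <-> nrm (\det A : C) > 0.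
Proof. by rewrite nrm_gt0 (@unitmx_fieldE C). Qed.

Lemma jacobian_unit_fun f p (r : R) : 0 < r ->
  (forall q, nrm (q - p) < r -> differentiable f q) ->
  exists J : V -> C, (forall q, jacobian f q \in unitmx <-> J q != 0) /\
    forall q, nrm (q - p) < r -> differentiable J q.
Proof.
move=> r0 df; exists (fun q => \det (jacobian f q)); split.
  by move=> q; rewrite -nrm_gt0; exact: unitmx_det.
exact: (det_jacobian_diff r0 df).
Qed.

Lemma unit_nbhd f p (r : R) : 0 < r ->
  (forall q, nrm (q - p) < r -> differentiable f q) -> jacobian f p \in unitmx ->
  exists2 d : R, 0 < d & forall q, nrm (q - p) < d -> jacobian f q \in unitmx.
Proof.
move=> r0 df; have [J [JP dJ]] := jacobian_unit_fun r0 df => /JP J0.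
have pp : nrm (p - p) < r by rewrite subrr nrm0.
have J0' : 0 < nrm (J p) by rewrite nrm_gt0.
have [d d0 dP] := diff_eps (dJ p pp) J0'; exists d => // q /dP qp.
by apply/JP; apply: contraTneq qp => ->; rewrite sub0r nrmN ltxx.
Qed.

(** With [k] a bound for the inverse of the Jacobian at [p], strict differentiability with error 1 /
    (2 k) loses only half of the lower bound 1 / k. It is scalar, hence applied to each
    coordinate. *)
Lemma expanding f p (r : R) : 0 < r ->
  (forall q, nrm (q - p) < r -> differentiable f q) -> jacobian f p \in unitmx ->
  exists c d : R, [/\ 0 < c, 0 < d, d <= r & forall x y, nrm (x - p) < d ->
    nrm (y - p) < d -> c * nrm (x - y) <= nrm (f x - f y)].
Proof.
move=> r0 df u; have [k k0 kP] := mulmx_lip (invmx (jacobian f p)).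
have e0 : 0 < 1 / (2 * k) by rewrite divr_gt0// mulr_gt0.
have [d d0 dP] : exists2 d : R, 0 < d & forall j : 'I_n, forall x y, nrm (x - p) < d ->
    nrm (y - p) < d ->
    nrm (f x 0 j - f y 0 j - 'd (fun x => f x 0 j) p (x - y)) <= 1 / (2 * k) * nrm (x - y).
  apply: (@small_delta _ (fun (j : 'I_n) d => forall x y, nrm (x - p) < d ->
    nrm (y - p) < d ->
    nrm (f x 0 j - f y 0 j - 'd (fun x => f x 0 j) p (x - y)) <= 1 / (2 * k) * nrm (x - y))) => j.
  have [r' [M [r'0 r'r kE]]] := hol_lin_est_loc r0 (fun q qp => (df_coord (df q qp) j).1).
  have [d d0 dP] := strict_diff r'0 kE e0; exists d => // d' _ d'd x y xp yp.
  by apply: dP; exact: lt_le_trans d'd.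
have pp : nrm (p - p) < r by rewrite subrr nrm0.
exists (1 / (2 * k)), (Num.min d r); split=> //.
- by rewrite lt_min d0.
- by rewrite ge_min lexx orbT.
move=> x y; rewrite !lt_min => /andP[xp _] /andP[yp _].
pose v := x - y; pose o := f x - f y - v *m jacobian f p.
have ov : nrm o <= 1 / (2 * k) * nrm v.
  apply: nrm_row => [|j]; first by rewrite mulr_ge0 ?nrm_ge0 ?ltW.
  have := dP j x y xp yp; rewrite (df_coord (df p pp) j).2 jacobianE -/v.
  by rewrite /o !mxE.
have vE : v = (v *m jacobian f p) *m invmx (jacobian f p) by rewrite mulmxK.
have h1 : nrm v <= k * nrm (v *m jacobian f p) by rewrite {1}vE; exact: kP.
have h2 : nrm (v *m jacobian f p) <= nrm (f x - f y) + nrm o.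
  have -> : v *m jacobian f p = (f x - f y) - o.
    by rewrite /o opprB addrC subrK.
  exact: nrmB.
have h3 : 1 / (2 * k) * nrm v * 2 <= nrm (v *m jacobian f p).
  have -> : 1 / (2 * k) * nrm v * 2 = nrm v / k by field; rewrite gt_eqF.
  by rewrite ler_pdivrMr// mulrC.
by move: ov h2 h3; rewrite -/v; clear; lra.
Qed.

(** At a minimum of |f - w| over a small closed ball, attained inside by [expanding], a short step
    in the Newton direction would decrease a nonzero value. *)
Lemma open_map f p (r : R) : 0 < r ->
  (forall q, nrm (q - p) < r -> differentiable f q) -> jacobian f p \in unitmx ->
  exists2 e : R, 0 < e & forall w, nrm (w - f p) < e ->
    exists2 x, nrm (x - p) < r & f x = w.
Proof.
move=> r0 df u; have [d1 d10 d1P] := unit_nbhd r0 df u.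
have [c [d2 [c0 d20 d2r d2P]]] := expanding r0 df u.
pose s := Num.min d1 d2 / 2.
have m0 : 0 < Num.min d1 d2 by rewrite lt_min d10.
have md1 : Num.min d1 d2 <= d1 by rewrite ge_min lexx.
have md2 : Num.min d1 d2 <= d2 by rewrite ge_min lexx orbT.
have [s0 sd1 sd2] : [/\ 0 < s, s < d1 & s < d2] by rewrite /s; split; lra.
have sr : s < r by lra.
(* The minimizer [z] satisfies |f z - f p| < 2 e < c s, which excludes the boundary |z - p| = s. *)
pose e := c * s / 4; have e0 : 0 < e by rewrite /e divr_gt0// mulr_gt0.
exists e => // w we; pose K := [set x : V | nrm (x - p) <= s].
pose h x := nrm (f x - w).
have ch x : K x -> {for x, continuous h}.
  by move=> xK; apply: cont_nrm_sub; apply: df; exact: le_lt_trans sr.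
have [||z] := @compact_EVT_min _ R h K (ex_intro _ p _) (@compact_ball n p s).
- by rewrite /K /= subrr nrm0 ltW.
- by apply: continuous_in_subspaceT => x; rewrite inE; exact: ch.
rewrite inE => zK zmin.
have {}zmin x : nrm (x - p) <= s -> h z <= h x by move=> xK; apply: zmin; rewrite inE.
have hp : h p < e by rewrite /h nrmC.
have hz : h z < e by apply: le_lt_trans hp; apply: zmin; rewrite subrr nrm0 ltW.
have zs : nrm (z - p) < s.
  have pp : nrm (p - p) < d2 by rewrite subrr nrm0.
  have := d2P z p (le_lt_trans zK sd2) pp; have := nrm_tri (f z) w (f p).
  rewrite -/(h z) => t1 t2.
  have : c * nrm (z - p) < c * s by have := mulr_gt0 c0 s0; move: t1 t2 hz we; rewrite /e; clear; lra.
  by rewrite ltr_pM2l.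
have zr : nrm (z - p) < r by exact: lt_trans zs sr.
exists z => //; apply: contrapT => nz.
have hz0 : 0 < h z by rewrite /h nrm_gt0 subr_eq0; exact/eqP.
have uz : jacobian f z \in unitmx by apply: d1P; exact: lt_trans zs sd1.
have [k k0 kP] := mulmx_lip (invmx (jacobian f z)).
pose v := (w - f z) *m invmx (jacobian f z).
have vJ : 'd f z v = w - f z by rewrite jacobianE /v mulmxKV.
have vk : nrm v <= k * h z by rewrite /h nrmC; exact: kP.
have [d3 d30 d3P] := diff_nrm (df z zr) (ltac:(rewrite divr_gt0// mulr_gt0//) : 0 < 1 / (2 * k)).
have N0 : 0 < nrm v + 1 by rewrite ltr_wpDl// nrm_ge0.
pose t := Num.min (1 / 2) (Num.min (d3 / 2) (s - nrm (z - p)) / (nrm v + 1)).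
have t0 : 0 < t by rewrite !lt_min !divr_gt0//= lt_min divr_gt0//= subr_gt0.
have t1 : t <= 1 / 2 by rewrite ge_min lexx.
have tv : t * (nrm v + 1) <= Num.min (d3 / 2) (s - nrm (z - p)).
  by rewrite -ler_pdivlMr// ge_min lexx orbT.
have tvn : nrm (rc t *: v) = t * nrm v by rewrite nrmZ nrm_rc gtr0_norm.
have tv1 : t * nrm v < d3.
  have h5 : Num.min (d3 / 2) (s - nrm (z - p)) <= d3 / 2 by rewrite ge_min lexx.
  by move: tv t0 d30 h5; clear; lra.
have tv2 : t * nrm v <= s - nrm (z - p).
  have h5 : Num.min (d3 / 2) (s - nrm (z - p)) <= s - nrm (z - p).
    by rewrite ge_min lexx orbT.
  by move: tv t0 h5; clear; lra.
have := d3P (rc t *: v); rewrite tvn => /(_ tv1); rewrite linearZ /= vJ => h3.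
have zt : nrm (z + rc t *: v - p) <= s.
  by rewrite addrAC; apply: le_trans (nrmD _ _) _; rewrite tvn; move: tv2; clear; lra.
have := zmin _ zt; rewrite {2}/h.
have -> : f (z + rc t *: v) - w = (f (z + rc t *: v) - f z - rc t *: (w - f z)) +
    rc (1 - t) *: (f z - w).
  rewrite rcB rc1 scalerBl scale1r scalerBr [rc t *: (f z - w)]scalerBr.
  by apply/rowP => j; rewrite !mxE; ring.
move=> le; have := le_trans le (nrmD _ _).
rewrite nrmZ nrm_rc ger0_norm -/(h z); last by move: t1; clear; lra.
have h4 : 1 / (2 * k) * (t * nrm v) <= t * h z / 2.
  apply: le_trans (_ : 1 / (2 * k) * (t * (k * h z)) <= _).
    apply: ler_wpM2l; first by rewrite divr_ge0// mulr_ge0// ltW.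
    by apply: ler_wpM2l; first exact: ltW.
  by rewrite le_eqVlt; apply/orP; left; apply/eqP; field; rewrite gt_eqF.
by have := mulr_gt0 t0 hz0; move: h3 h4; clear; lra.
Qed.

(** Continuity of the right inverse [g] makes the linear approximation of [f] applicable at [g w];
    it yields |v| <= 2 k |h|, which turns an error relative to [v] into one relative to [h]. *)
Lemma inv_diff f (g : V -> V) q : differentiable f q -> jacobian f q \in unitmx ->
  g (f q) = q ->
  (forall e : R, 0 < e -> exists2 d : R, 0 < d & forall w, nrm (w - f q) < d ->
    f (g w) = w /\ nrm (g w - q) < e) ->
  differentiable g (f q).
Proof.
move=> df u gq H; set A := jacobian f q in u.
have [k k0 kP] := mulmx_lip (invmx A).
pose L v : V := v *m invmx A.
have linL : linear L by move=> a x y; rewrite /L mulmxDl scalemxAl.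
apply: (proj1 (@df_row _ _ g (f q) L k linL kP _)) => e e0.
pose e1 := Num.min (1 / (2 * k)) (e / (2 * k * k)).
have e10 : 0 < e1 by rewrite lt_min !divr_gt0 ?mulr_gt0.
have e1k : e1 * (2 * k) <= 1 by rewrite -ler_pdivlMr ?mulr_gt0// ge_min lexx.
have e1e : e1 * (2 * k * k) <= e.
  by rewrite -ler_pdivlMr ?mulr_gt0// ge_min lexx orbT.
have [d1 d10 d1P] := diff_nrm df e10.
have [d2 d20 d2P] := H d1 d10.
exists d2 => // h hd; have [] := d2P (f q + h); first by rewrite addrAC subrr add0r.
set x := g (f q + h) => fx xq; rewrite gq.
have := d1P (x - q) xq; rewrite [q + (x - q)]addrC subrK fx [f q + h - f q]addrAC subrr add0r jacobianE -/A.
set v := x - q => h1.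
have vE : v - L h = - (h - v *m A) *m invmx A by rewrite mulNmx mulmxBl mulmxK// opprB.
have h2 : nrm (v - L h) <= k * (e1 * nrm v).
  rewrite vE; apply: le_trans (kP _) _; rewrite nrmN ler_wpM2l// ltW//.
have vb : nrm v <= 2 * k * nrm h.
  have := nrmD (v - L h) (L h); rewrite subrK; have := kP h; rewrite -/(L h) => a b.
  have := nrm_ge0 v => v0; have : k * (e1 * nrm v) <= nrm v / 2 by nra.
  lra.
apply: le_trans h2 _; apply: le_trans (_ : k * (e1 * (2 * k * nrm h)) <= _).
  apply: ler_wpM2l; first exact: ltW.
  by apply: ler_wpM2l; first exact: ltW.
have := nrm_ge0 h; have -> : k * (e1 * (2 * k * nrm h)) = e1 * (2 * k * k) * nrm h by ring.
by move=> h0; rewrite ler_wpM2r.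
Qed.

End Inverse.
End FiniteDim.

(** * Injective holomorphic maps *)

Section ConstantRank.
Context {R : realType}.
Local Notation C := (Cplx R).

(** Dividing the segment from 0 to [t] into [m.+1] steps, each with a second order error, bounds the
    total change by K |t|^2 / (m+1). *)
Lemma zero_diff_const (k : C -> C) (r : R) : 0 < r ->
  (forall t : C, nrm t < r -> differentiable k t /\ 'd k t 1 = 0) ->
  exists2 d : R, 0 < d & forall t : C, nrm t < d -> k t = k 0.
Proof.
move=> r0 H; have [|r' [M [r'0 r'r kE]]] := @hol_lin_est_loc _ _ k 0 r r0.
  by move=> q; rewrite subr0 => /H[].
exists (r' / 2) => [|t tr]; first by rewrite divr_gt0.
pose K := 4 * M / r' ^+ 2.
have step (x h : C) : nrm x <= r' / 2 -> nrm h <= r' / 2 ->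
    nrm (k (x + h) - k x) <= K * nrm h ^+ 2.
  move=> xr hr; have [|_ _ q2] := frechet r'0 kE (q := x); first by rewrite subr0.
  have [|_ d0] := H x; first lra.
  have lin : 'd k x h = 0 by rewrite (linear1 ('d k x)) d0 mul0r.
  by have := q2 h hr; rewrite lin subr0.
apply: subr0_eq; apply: (@small_eq0 _ _ (K * nrm t ^+ 2) 1) => // s s0 _.
have [m ms] : exists m : nat, m.+1%:R^-1 <= s.
  exists (Num.truncn s^-1); rewrite invf_ple ?posrE ?ltr0n//.
  by apply/ltW; exact: truncnS_gt.
pose h := t / m.+1%:R; have nm : (m.+1%:R : C) != 0 by rewrite pnatr_eq0.
have hE : nrm h = nrm t / m.+1%:R by rewrite nrmcM nrmV nrm_n.
have m1 : 1 <= m.+1%:R :> R by rewrite ler1n.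
have hr : nrm h <= r' / 2.
  rewrite hE ler_pdivrMr ?ltr0n//; apply: le_trans (ltW tr) _.
  by rewrite ler_peMr// divr_ge0// ltW.
have sum i : (i <= m.+1)%N -> nrm (k (h * i%:R) - k 0) <= i%:R * (K * nrm h ^+ 2).
  elim: i => [_|i IH im]; first by rewrite mulr0 subrr nrm0 mul0r.
  have ir : nrm (h * i%:R) <= r' / 2.
    rewrite nrmcM nrm_n hE mulrAC; apply: le_trans (ltW tr).
    by rewrite ler_pdivrMr ?ltr0n// ler_wpM2l ?nrm_ge0// ler_nat ltnW.
  apply: le_trans (nrm_tri _ (k (h * i%:R)) _) _.
  rewrite -addn1 !natrD mulrDr mulr1 mulrDl mul1r addrC; apply: lerD.
    by apply: IH; exact: ltnW.
  exact: step.
have := sum m.+1 (leqnn _).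
have -> : h * m.+1%:R = t by rewrite /h divfK.
move/le_trans; apply; rewrite hE.
have -> : m.+1%:R * (K * (nrm t / m.+1%:R) ^+ 2) = K * nrm t ^+ 2 * m.+1%:R^-1.
  by field; rewrite gt_eqF// (lt_le_trans ltr01).
have K0 : 0 <= K * nrm t ^+ 2.
  have := step 0 t; rewrite nrm0 => /(_ (ltac:(lra)) (ltW tr)).
  exact: le_trans (nrm_ge0 _).
by rewrite ler_wpM2l.
Qed.

Lemma diff_locally_cst {V W : normedModType C} (f : V -> W) p v (d : R) : 0 < d ->
  (forall y, nrm (y - p) < d -> f y = f p) -> 'd f p v = 0.
Proof.
move=> d0 H; have [||_ ->] // := @nrm_diff R V W f p (\0 : {linear V -> W}) 0.
  by move=> h; rewrite nrm0 mul0r.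
move=> e e0; exists d => // h hd; rewrite H.
  by rewrite subrr subr0 nrm0 mulr_ge0 ?nrm_ge0// ltW.
by rewrite addrAC subrr add0r.
Qed.

Lemma df_affine {V : normedModType C} (a v : V) (t : C) :
  differentiable (fun s : C => a + s *: v) t.
Proof. exact: differentiableD (differentiable_cst _ _) (differentiableZl _ (dfid _)). Qed.

Lemma diff_addE {V W : normedModType C} (f g : V -> W) x v :
  differentiable f x -> differentiable g x ->
  'd (fun y => f y + g y) x v = 'd f x v + 'd g x v.
Proof. by move=> df dg; have /(congr1 (fun h => h v)) := diffD df dg. Qed.

Lemma dfidV {V : normedModType C} (x : V) : differentiable (fun y : V => y) x.
Proof. by apply: (@linear_differentiable _ _ _ idfun) => y; exact: cvg_id. Qed.

Lemma diff_idE {V : normedModType C} (x v : V) : 'd (fun y : V => y) x v = v.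
Proof.
have cid : continuous (idfun : V -> V) by move=> y; exact: cvg_id.
by have := @diff_lin _ _ _ (idfun : {linear V -> V}) x cid => /(congr1 (fun h => h v)).
Qed.

Lemma df_idmulmx {m k} (B : 'M[C]_(m, k)) q :
  differentiable (fun x : 'rV[C]_m => x *m B) q /\
  forall v, 'd (fun x : 'rV[C]_m => x *m B) q v = v *m B.
Proof.
have [d dE] := df_mulmx B (dfidV q); split; first exact: d.
by move=> v; apply: etrans (dE v) _; congr (_ *m _); exact: diff_idE.
Qed.

Context {n : nat}.
Local Notation V := 'rV[C]_n.
Implicit Types (f : V -> V) (p q x y w : V).

(** The second summand has rank at most [n - r], so [B *m pid_mx r] has rank at least [r]. As [B]
    has rank at most [r], the kernels of both have the same dimension. *)
Lemma kermx_maxrank (B : 'M[C]_n) (L : 'M[C]_n) (r : nat) (v : V) : (r <= n)%N ->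
  (\rank B <= r)%N -> B *m (pid_mx r : 'M[C]_n) + L *m copid_mx r \in unitmx ->
  v *m (B *m (pid_mx r : 'M[C]_n)) = 0 -> v *m B = 0.
Proof.
move=> rn Br u /eqP; rewrite -sub_kermx => vk.
suff : (kermx (B *m (pid_mx r : 'M[C]_n)) <= kermx B)%MS.
  by move=> s; apply/eqP; rewrite -sub_kermx (submx_trans vk s).
have s : (kermx B <= kermx (B *m (pid_mx r : 'M[C]_n)))%MS.
  by rewrite sub_kermx mulmxA mulmx_ker mul0mx.
rewrite -(geq_leqif (mxrank_leqif_sup s)) !mxrank_ker; apply: leq_sub2l.
apply: leq_trans Br _.
have := mxrank_add (B *m (pid_mx r : 'M[C]_n)) (L *m copid_mx r).
rewrite mxrank_unit// => /leq_trans/(_ (leq_add (leqnn _) (mxrankM_maxr _ _))).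
by rewrite rank_copid_mx// addnC -leq_subLR subKn.
Qed.

Lemma local_inverse f p (r : R) : 0 < r ->
  (forall q, nrm (q - p) < r -> differentiable f q) -> jacobian f p \in unitmx ->
  exists (e : R) (g : V -> V), [/\ 0 < e, g (f p) = p &
    forall w, nrm (w - f p) < e ->
      [/\ nrm (g w - p) < r, f (g w) = w, jacobian f (g w) \in unitmx &
        differentiable g w]].
Proof.
move=> r0 df u; have [d1 d10 d1P] := unit_nbhd r0 df u.
have [c [d2 [c0 d20 d2r d2P]]] := expanding r0 df u.
pose d := Num.min d1 d2; have d0 : 0 < d by rewrite lt_min d10.
have dd1 : d <= d1 by rewrite ge_min lexx.
have dd2 : d <= d2 by rewrite ge_min lexx orbT.
have dr : d <= r by apply: le_trans d2r.
have [e e0 eP] := open_map d0 (fun q qd => df q (lt_le_trans qd dr)) u.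
pose g w := xget p [set x | nrm (x - p) < d /\ f x = w].
have inj x y : nrm (x - p) < d -> nrm (y - p) < d -> f x = f y -> x = y.
  move=> xd yd fxy; have := d2P x y (lt_le_trans xd dd2) (lt_le_trans yd dd2).
  rewrite fxy subrr nrm0 pmulr_rle0// => h.
  by apply/eqP; rewrite -subr_eq0 -nrm_eq0 eq_le h nrm_ge0.
have gP w : nrm (w - f p) < e -> nrm (g w - p) < d /\ f (g w) = w.
  move=> /eP[x xd fx].
  exact: (@xgetPex _ p [set x | nrm (x - p) < d /\ f x = w] (ex_intro _ x (conj xd fx))).
have pp : nrm (p - p) < d by rewrite subrr nrm0.
exists e, g; split; first exact: e0.
  by have [|h1 h2] := gP (f p); [rewrite subrr nrm0|exact: inj].
move=> w we; have [gd fg] := gP w we.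
have ug : jacobian f (g w) \in unitmx by apply: d1P; exact: lt_le_trans dd1.
split; [exact: lt_le_trans dr|exact: fg|exact: ug|].
have dfg : differentiable f (g w) by apply: df; exact: lt_le_trans dr.
have gfg : g (f (g w)) = g w by rewrite fg.
suff : differentiable g (f (g w)) by rewrite fg.
apply: inv_diff dfg ug gfg _ => e1 e10.
exists (Num.min (e - nrm (w - f p)) (c * e1)).
  by rewrite lt_min subr_gt0 we mulr_gt0.
move=> w'; rewrite fg lt_min => /andP[w'1 w'2].
have [gd' fg'] : nrm (g w' - p) < d /\ f (g w') = w'.
  by apply: gP; apply: le_lt_trans (nrm_tri _ w _) _; lra.
split=> //; have := d2P _ _ (lt_le_trans gd' dd2) (lt_le_trans gd dd2).
rewrite fg' fg => h; rewrite -(ltr_pM2l c0); exact: le_lt_trans h w'2.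
Qed.

(* If the rank [m] at [q] is maximal but not full, then [f] is constant along a curve
   through [q] on which [m] independent components of [f] are kept fixed. *)
Lemma jacobian_nondegenerate f p (r : R) : 0 < r ->
  (forall q, nrm (q - p) < r -> differentiable f q) ->
  (forall x y, nrm (x - p) < r -> nrm (y - p) < r -> f x = f y -> x = y) ->
  exists2 q, nrm (q - p) < r & jacobian f q \in unitmx.
Proof.
move=> r0 df injf; apply: contrapT => nounit.
have {}nounit q : nrm (q - p) < r -> jacobian f q \notin unitmx.
  by move=> qr; apply/negP => uq; apply: nounit; exists q.
pose P m := `[< exists2 q, nrm (q - p) < r & \rank (jacobian f q) = m >].
have pp : nrm (p - p) < r by rewrite subrr nrm0.
have exP : exists m, P m by exists (\rank (jacobian f p)); apply/asboolP; exists p.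
have Pn m : P m -> (m <= n)%N by move=> /asboolP[q _ <-]; exact: rank_leq_row.
case: (ex_maxnP exP Pn) => m /asboolP[q qr rq] mmax.
have mn : (m < n)%N.
  rewrite ltn_neqAle -{2}rq rank_leq_row andbT; apply/eqP => mn.
  have := nounit q qr; rewrite -row_full_unit /row_full rq mn eqxx //.
have rk x : nrm (x - p) < r -> (\rank (jacobian f x) <= m)%N.
  by move=> xr; apply: mmax; apply/asboolP; exists x.
pose A := jacobian f q; pose L := col_ebase A; pose U := row_ebase A.
have uL : L \in unitmx by exact: col_ebase_unit.
have uU : U \in unitmx by exact: row_ebase_unit.
have AE : A *m invmx U = L *m (pid_mx m : 'M[C]_n).
  by rewrite -{1}(mulmx_ebase A) -/L -/U rq mulmxK.
pose h x := f x *m invmx U.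
have fE x : f x = h x *m U by rewrite /h mulmxKV.
pose B x := jacobian f x *m invmx U.
have dh x : nrm (x - p) < r -> differentiable h x /\ forall v, 'd h x v = v *m B x.
  move=> /df dfx; have [d1 d2] := df_mulmx (invmx U) dfx; split=> // v.
  by rewrite d2 jacobianE mulmxA.
(* [G] completes the first [m] components of [h] by linear functions so that its Jacobian at [q] is
   L pid + L copid = L. *)
pose G x := h x *m (pid_mx m : 'M[C]_n) + x *m (L *m copid_mx m).
pose s := r - nrm (q - p); have s0 : 0 < s by rewrite /s subr_gt0.
have sr x : nrm (x - q) < s -> nrm (x - p) < r.
  by move=> xq; apply: le_lt_trans (nrm_tri _ q _) _; move: xq; rewrite /s; lra.
have dG x : nrm (x - p) < r -> differentiable G x /\
    jacobian G x = B x *m (pid_mx m : 'M[C]_n) + L *m copid_mx m.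
  move=> xr; have [d1 d1E] := dh x xr.
  have [d2 d2E] := df_mulmx (pid_mx m : 'M[C]_n) d1.
  have [d3 d3E] := df_idmulmx (L *m copid_mx m) x.
  have dGx : differentiable G x by exact: (differentiableD d2 d3).
  split; first exact: dGx.
  apply/row_matrixP => i; rewrite !rowE -jacobianE.
  set dv : V := delta_mx 0 i.
  have E2 : 'd (fun y => h y *m (pid_mx m : 'M[C]_n)) x dv = dv *m (B x *m pid_mx m).
    exact: etrans (d2E dv) (etrans (congr1 (fun y => y *m _) (d1E dv)) (esym (mulmxA _ _ _))).
  have E : 'd G x dv = dv *m (B x *m pid_mx m) + dv *m (L *m copid_mx m).
    exact: etrans (diff_addE dv d2 d3) (congr2 +%R E2 (d3E dv)).
  by apply: etrans E _; rewrite -mulmxDr.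
have [dGq JGq] := dG q qr.
have uG : jacobian G q \in unitmx.
  rewrite JGq /B -/A AE -mulmxA pid_mx_id ?(ltnW mn)// -mulmxDr.
  by rewrite /copid_mx addrC subrK mulmx1.
have [e [g [e0 gq gP]]] := local_inverse s0 (fun x xs => (dG x (sr x xs)).1) uG.
(* A direction that the projection on the first [m] components kills: along the curve [z t] these
   components of [h] are constant. *)
pose ev : V := delta_mx 0 (Ordinal mn).
have evpid : ev *m (pid_mx m : 'M[C]_n) = 0.
  by apply/rowP => j; rewrite -rowE !mxE /= ltnn andbF.
have ev0 : ev != 0.
  by apply/eqP => /rowP/(_ (Ordinal mn)); rewrite !mxE !eqxx => /eqP; rewrite oner_eq0.
have nev : 0 < nrm ev by rewrite nrm_gt0.
pose w (t : C) := G q + t *: ev.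
have wP t : nrm t < e / nrm ev -> nrm (w t - G q) < e.
  by rewrite ltr_pdivlMr// /w addrAC subrr add0r nrmZ.
pose z t := g (w t).
have e1 : 0 < e / nrm ev by rewrite divr_gt0.
have zP (t : C) : nrm t < e / nrm ev -> [/\ nrm (z t - p) < r, G (z t) = w t,
    jacobian G (z t) \in unitmx & differentiable z t].
  move=> /wP /gP[h1 h2 h3 h4]; split; [exact: sr|exact: h2|exact: h3|].
  exact: (@differentiable_comp _ _ _ _ w g t (df_affine (G q) ev t) h4).
have hpid (t : C) : nrm t < e / nrm ev -> h (z t) *m (pid_mx m : 'M[C]_n) = h q *m (pid_mx m : 'M[C]_n).
  move=> /zP[_ Gz _ _].
  have GE x : G x *m (pid_mx m : 'M[C]_n) = h x *m (pid_mx m : 'M[C]_n).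
    rewrite /G mulmxDl -!mulmxA pid_mx_id ?(ltnW mn)//.
    by rewrite mul_copid_mx_pid ?(ltnW mn)// !mulmx0 addr0.
  by rewrite -GE Gz /w mulmxDl -scalemxAl evpid scaler0 addr0 GE.
have dhz (t : C) : nrm t < e / nrm ev ->
    differentiable (fun t => h (z t)) t /\ 'd (fun t => h (z t)) t 1 = 0.
  move=> te; have [zr Gz uz dz] := zP t te.
  have [dhz dhE] := dh (z t) zr.
  have dc : differentiable (fun t => h (z t)) t by exact: (differentiable_comp dz dhz).
  split=> //; have := @diff_comp _ _ _ _ z h t dz dhz.
  move=> /(congr1 (fun g => g 1)) /= E.
  have {}E : 'd (fun t => h (z t)) t 1 = 'd z t 1 *m B (z t).
    by rewrite -dhE; exact: E.
  (* The first [m] components of the derivative of h (z t) vanish; by maximality of the rank so do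
     the others. *)
  rewrite E; apply: (@kermx_maxrank _ L m).
  - exact: ltnW.
  - by apply: leq_trans (mxrankM_maxl _ _) (rk _ zr).
  - by have [_ <-] := dG (z t) zr.
  rewrite mulmxA -E.
  have [_ dpE] := df_mulmx (pid_mx m : 'M[C]_n) dc.
  apply: etrans (esym (dpE 1)) _.
  apply: (@diff_locally_cst _ _ _ t _ (e / nrm ev - nrm t)); first by rewrite subr_gt0.
  move=> y yt; rewrite !hpid//.
  by have := nrmD (y - t) t; rewrite subrK; lra.
have [d d0 dP] : exists2 d : R, 0 < d & forall j : 'I_n, forall t : C, nrm t < d ->
    h (z t) 0 j = h (z 0) 0 j.
  apply: (@small_delta _ _ (fun (j : 'I_n) d => forall t : C, nrm t < d ->
    h (z t) 0 j = h (z 0) 0 j)) => j.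
  have [|d d0 dP] := @zero_diff_const (fun t => h (z t) 0 j) _ e1.
    move=> t /dhz[d1 d2]; have [d3 d4] := df_coord d1 j; split=> //.
    by rewrite d4 d2 mxE.
  exists d; first exact: d0.
  by move=> d' _ d'd t td; exact: dP t (lt_le_trans td d'd).
pose t : C := rc (Num.min d (e / nrm ev) / 2).
have m0 : 0 < Num.min d (e / nrm ev) by rewrite lt_min d0.
have md : Num.min d (e / nrm ev) <= d by rewrite ge_min lexx.
have me : Num.min d (e / nrm ev) <= e / nrm ev by rewrite ge_min lexx orbT.
have nt : nrm t = Num.min d (e / nrm ev) / 2 by rewrite nrm_rc gtr0_norm ?divr_gt0.
have t0 : t != 0 by rewrite -nrm_gt0 nt divr_gt0.
have td : nrm t < d by rewrite nt; lra.
have te : nrm t < e / nrm ev by rewrite nt; lra.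
have hz : h (z t) = h (z 0) by apply/rowP => j; exact: dP.
have e00 : nrm (0 : C) < e / nrm ev by rewrite nrm0.
have [zr1 Gz1 _ _] := zP t te; have [zr0 Gz0 _ _] := zP 0 e00.
have zz : z t = z 0.
  apply: (injf _ _ zr1 zr0).
  exact: etrans (fE _) (etrans (congr1 (fun y => y *m U) hz) (esym (fE _))).
have : w t = w 0 by exact: etrans (esym Gz1) (etrans (congr1 G zz) Gz0).
move=> /addrI/eqP; rewrite scale0r scaler_eq0 (negPf ev0) orbF.
by rewrite (negPf t0).
Qed.

End ConstantRank.

(** * Holomorphy of the inverse of an injective map *)

Section Osgood.
Context {R : realType}.
Local Notation C := (Cplx R).

(* The maximum principle bounds [h z / z ^+ n] uniformly in [n]. *)
Lemma identity_disc (h : C -> C) (e : R) : 0 < e ->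
  (forall z : C, nrm z <= 1 -> {for z, continuous h}) ->
  (forall z : C, nrm z < 1 -> h z != 0 -> differentiable h z) ->
  (forall z : C, nrm z < e -> h z = 0) ->
  forall z : C, nrm z < 1 -> h z = 0.
Proof.
move=> e0 ch dh h0 z z1; have [->|zn0] := eqVneq z 0; first by apply: h0; rewrite nrm0.
have [M M0 hM] := circle_bound ch.
have bd n : nrm (h z) <= M * nrm z ^+ n.
  have zn : 0 < nrm z ^+ n by rewrite exprn_gt0// nrm_gt0.
  rewrite -ler_pdivrMr//.
  have := @max_principle _ (fun z => h z / z ^+ n) M M0 _ _ _ z (ltW z1).
  rewrite nrmcM nrmV nrmX; apply.
  - move=> y y1; have [->|y0] := eqVneq y 0.
      apply/cont_nrm => e1 e10; exists e => // x; rewrite subr0 => xe.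
      by rewrite !h0 ?nrm0// !mul0r subrr nrm0.
    apply: cfM; first exact: ch.
    apply: differentiable_continuous; apply: dfV; last by rewrite expf_neq0.
    by apply: dfX; exact: dfid.
  - move=> y y1 ny; have hy : h y != 0 by apply: contraNneq ny => ->; rewrite mul0r.
    have y0 : y != 0 by apply: contraNneq hy => ->; rewrite h0// nrm0.
    apply: dfM; first exact: dh.
    by apply: dfV; [apply: dfX; exact: dfid|rewrite expf_neq0].
  - by move=> y y1; rewrite nrmcM nrmV nrmX y1 expr1n invr1 mulr1 hM// y1.
apply/eqP; rewrite -nrm_eq0 eq_le nrm_ge0 andbT; apply/ler_addgt0Pr => e1 e10.
have zi : 0 <= nrm z < 1 by rewrite nrm_ge0.
have [n /(_ n (leqnn n)) nP] := expr_lt_eps M zi e10.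
by rewrite add0r; apply: le_trans (bd n) (ltW nP).
Qed.

Lemma cont_line {V : normedModType C} (u : V -> C) (a v : V) (t : C) :
  {for (a + t *: v), continuous u} -> {for t, continuous (fun s : C => u (a + s *: v))}.
Proof.
move=> /cont_nrm cu; apply/cont_nrm => e /cu[d d0 dH].
have N0 : 0 < nrm v + 1 by rewrite ltr_wpDl// nrm_ge0.
exists (d / (nrm v + 1)) => [|x xt]; first by rewrite divr_gt0.
apply: dH; have -> : a + x *: v - (a + t *: v) = (x - t) *: v.
  by rewrite scalerBl opprD addrACA subrr add0r.
rewrite nrmZ; move: xt; rewrite ltr_pdivlMr//; apply: le_lt_trans.
by rewrite ler_wpM2l ?nrm_ge0// lerDl.
Qed.

Lemma closed_far {V : normedModType C} (x : V) (e : R) : closed [set y | e <= nrm (y - x)].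
Proof.
apply: (@preimage_closed V R (fun y => nrm (y - x)) [set t | e <= t]).
  by move=> y _; apply: cont_nrm_sub; exact: dfidV.
exact: closed_ge.
Qed.

Context {n : nat}.
Local Notation V := 'rV[C]_n.

(* With [J] the Jacobian determinant of [f], the function [J \o f^-1], extended by 0
   outside the image of a ball, is continuous, and holomorphic off its zeros. By the
   identity theorem the image is a neighbourhood of [f p], and by Rado's theorem along
   complex lines [k \o f^-1] is holomorphic. *)
Lemma osgood (f : V -> V) (k : V -> C) (p : V) (r : R) : 0 < r ->
  (forall q, nrm (q - p) < r -> differentiable f q) ->
  (forall x y, nrm (x - p) < r -> nrm (y - p) < r -> f x = f y -> x = y) ->
  (forall q, nrm (q - p) < r -> differentiable k q) ->
  exists (d : R) (g : V -> V), [/\ 0 < d,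
    forall w, nrm (w - f p) < d -> nrm (g w - p) < r /\ f (g w) = w &
    differentiable (fun w => k (g w)) (f p)].
Proof.
move=> r0 df injf dk.
have [J [JP dJ]] := jacobian_unit_fun r0 df.
pose s := r / 2; have s0 : 0 < s by rewrite divr_gt0.
have sr : s < r by rewrite /s; lra.
pose K := [set x : V | nrm (x - p) <= s].
have cK : compact K by exact: compact_ball.
have Kr x : K x -> nrm (x - p) < r by move=> xK; exact: le_lt_trans sr.
have injK x y : K x -> K y -> f x = f y -> x = y.
  by move=> /Kr xr /Kr yr; exact: injf.
have cf x w : K x -> {for x, continuous (fun y => nrm (f y - w))}.
  by move=> /Kr xr; apply: cont_nrm_sub; exact: df.
have cn (x w : V) : {for x, continuous (fun y : V => nrm (y - w))}.
  by apply: cont_nrm_sub; exact: dfidV.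
have Kp : K p by rewrite /K /= subrr nrm0 ltW.
(* The function s - |x - p| + |f x - f p| is positive on [K], because only [p] is mapped to [f p].
   Below its minimum [d], preimages in [K] stay off the sphere of radius [s]. *)
have [d d0 dP] : exists2 d : R, 0 < d & forall x, K x -> d <= s +
    1 * (nrm (f x - f p) + (-1) * nrm (x - p)).
  apply: compact_pos_min => // x xK.
    apply: cont_affR; apply: cont_linR; [exact: cf|exact: cn].
  have [->|xp] := eqVneq x p; first by rewrite !subrr nrm0; lra.
  have : 0 < nrm (f x - f p).
    rewrite nrm_gt0 subr_eq0; apply: contra_neq xp; exact: injK.
  by move: xK; rewrite /K /=; lra.
have inK x : K x -> nrm (f x - f p) < d -> nrm (x - p) < s.
  by move=> /dP; lra.
pose Im w := exists2 x, K x & f x = w.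
pose g w := xget p [set x | K x /\ f x = w].
have gP w : Im w -> K (g w) /\ f (g w) = w.
  move=> [x xK fx].
  exact: (@xgetPex _ p [set x | K x /\ f x = w] (ex_intro _ x (conj xK fx))).
have gf x : K x -> g (f x) = x.
  by move=> xK; have [|gK fg] := gP (f x); [exists x|exact: injK].
(* A continuous injection of a compact set has a continuous inverse: |f y - f x| has a positive
   minimum over the [y] in [K] at distance at least [e] from [x]. *)
have gcont x (e : R) : K x -> 0 < e -> exists2 d1 : R, 0 < d1 &
    forall y, K y -> nrm (f y - f x) < d1 -> nrm (y - x) < e.
  move=> xK e0; pose K1 := K `&` [set y | e <= nrm (y - x)].
  have cK1 : compact K1.
    apply: (subclosed_compact _ cK); last exact: subIsetl.
    by apply: closedI; [exact: closed_ball_nrm|exact: closed_far].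
  have [|||d1 d10 d1P] := @compact_pos_min R n K1 (fun y => nrm (f y - f x)).
  - exact: cK1.
  - by move=> y [yK _]; exact: cf.
  - move=> y [yK /= yx]; rewrite nrm_gt0 subr_eq0; apply: contraTneq (lt_le_trans e0 yx).
    by move=> /(injK _ _ yK xK) ->; rewrite subrr nrm0 ltxx.
  exists d1; first exact: d10.
  move=> y yK fyx; rewrite ltNge; apply/negP => ye.
  by have := d1P y (conj yK ye); rewrite leNgt fyx.
have nIm w : ~ Im w -> exists2 d1 : R, 0 < d1 & forall w', nrm (w' - w) < d1 -> ~ Im w'.
  move=> wI; have [|||d1 d10 d1P] := @compact_pos_min R n K (fun y => nrm (f y - w)).
  - exact: cK.
  - by move=> y yK; exact: cf.
  - move=> y yK; rewrite nrm_gt0 subr_eq0; apply/eqP => fy; apply: wI.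
    by exists y.
  exists d1; first exact: d10.
  move=> w' w'w [y yK fy]; have := d1P y yK; rewrite fy leNgt w'w.
  by [].
pose u w : C := if `[< Im w >] then J (g w) else 0.
have uIm w : Im w -> u w = J (g w) by move=> wI; rewrite /u asboolT.
have unIm w : ~ Im w -> u w = 0 by move=> wI; rewrite /u asboolF.
have gdiff w : nrm (w - f p) < d -> u w != 0 -> [/\ Im w, differentiable u w &
    differentiable (fun w => k (g w)) w].
  move=> wd uw; have wI : Im w.
    by apply: contrapT => /unIm uw0; rewrite uw0 eqxx in uw.
  have [xK fx] := gP w wI; rewrite (uIm w wI) in uw.
  set x := g w in xK fx uw.
  have xs : nrm (x - p) < s by apply: inK; rewrite ?fx.
  have s1 : 0 < s - nrm (x - p) by rewrite subr_gt0.
  have subK y : nrm (y - x) < s - nrm (x - p) -> K y.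
    by move=> yx; apply: le_trans (nrm_tri _ x _) _; lra.
  have ux : jacobian f x \in unitmx by apply/JP.
  have dfs y : nrm (y - x) < s - nrm (x - p) -> differentiable f y.
    by move=> /subK /Kr; exact: df.
  have [e e0 eP] := open_map s1 dfs ux; rewrite fx in eP.
  have eI w' : nrm (w' - w) < e -> Im w'.
    by move=> /eP[y /subK yK fy]; exists y.
  have xr := Kr x xK.
  have dg : differentiable g (f x).
    apply: (inv_diff (df x xr) ux (gf x xK)) => e1 e10.
    have [d1 d10 d1P] := gcont x e1 xK e10.
    exists (Num.min d1 e); first by rewrite lt_min d10.
    move=> w'; rewrite fx lt_min => /andP[w'1 w'2].
    have [gK fg] := gP w' (eI w' w'2); split; first exact: fg.
    by apply: (d1P _ gK); rewrite fg fx.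
  rewrite fx in dg; split; first exact: wI.
    apply: (@near_eq_differentiable _ _ _ (fun w => J (g w))).
      apply/nbhs_nrm; exists e; first exact: e0.
      by move=> w' /eI /uIm ->.
    exact: (differentiable_comp dg (dJ _ xr)).
  exact: (differentiable_comp dg (dk _ xr)).
(* At a zero of [u] there are two cases: off the image [u] vanishes nearby, and on it [J \o g] is
   small nearby while values off the image are 0. *)
have uc w : nrm (w - f p) < d -> {for w, continuous u}.
  move=> wd; have [uw|uw] := eqVneq (u w) 0; last first.
    by have [_ du _] := gdiff w wd uw; exact: differentiable_continuous du.
  apply/cont_nrm => e e0; rewrite uw.
  have [wI|wI] := pselect (Im w); last first.
    have [d1 d10 d1P] := nIm w wI; exists d1; first exact: d10.
    by move=> w' /d1P /unIm ->; rewrite subr0 nrm0.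
  have [xK fx] := gP w wI; rewrite (uIm w wI) in uw.
  have [d1 d10 d1P] := diff_eps (dJ _ (Kr _ xK)) e0.
  have [d2 d20 d2P] := gcont _ d1 xK d10.
  exists d2; first exact: d20.
  move=> w' w'w; have [w'I|/unIm ->] := pselect (Im w'); last by rewrite subr0 nrm0.
  have [gK fg] := gP w' w'I; rewrite (uIm w' w'I) -[X in _ - X]uw; apply: d1P.
  by apply: (d2P _ gK); rewrite fg fx.
(* If [u] vanished near [w0], the identity theorem on discs centred at [w0] would make it vanish on
   the ball of radius [d / 2] about [w0]. That ball contains [f q] for all [q] close to [p], and one
   of these has an invertible Jacobian. *)
have dense0 w0 (e : R) : nrm (w0 - f p) < d / 4 -> 0 < e ->
    exists2 w, nrm (w - w0) < e & u w != 0.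
  move=> w0d e0; apply: contrapT => H.
  have {}H w : nrm (w - w0) < e -> u w = 0.
    by move=> we; apply/eqP; apply: contrapT => /negP uw; apply: H; exists w.
  have H2 w : nrm (w - w0) < d / 2 -> u w = 0.
    move=> wd; have [->|ww0] := eqVneq w w0; first by apply: H; rewrite subrr nrm0.
    have nw : 0 < nrm (w - w0) by rewrite nrm_gt0 subr_eq0.
    pose v := rc (d / 2 / nrm (w - w0)) *: (w - w0).
    have nv : nrm v = d / 2.
      by rewrite nrmZ nrm_rc gtr0_norm ?divr_gt0// divfK// gt_eqF.
    have inb (z : C) : nrm z <= 1 -> nrm (w0 + z *: v - f p) < d.
      move=> z1; rewrite addrAC; apply: le_lt_trans (nrmD _ _) _; rewrite nrmZ nv.
      by have := nrm_ge0 z; nra.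
    have wE : w = w0 + rc (nrm (w - w0) / (d / 2)) *: v.
      rewrite /v scalerA -rcM mulrA divfK ?gt_eqF ?divr_gt0// divff ?gt_eqF//.
      by rewrite rc1 scale1r addrC subrK.
    rewrite wE.
    apply: (@identity_disc (fun z => u (w0 + z *: v)) (e / d)).
    - by rewrite divr_gt0.
    - by move=> z z1; apply: cont_line; apply: uc; exact: inb.
    - move=> z z1 uz; apply: diff_line.
      by have [] := gdiff _ (inb z (ltW z1)) uz.
    - move=> z ze; apply: H; rewrite addrAC subrr add0r nrmZ nv.
      by move: ze; rewrite ltr_pdivlMr//; have := nrm_ge0 z; nra.
    rewrite nrm_rc gtr0_norm ?divr_gt0// ltr_pdivrMr ?divr_gt0// mul1r.
    exact: wd.
  have pr : nrm (p - p) < r by rewrite subrr nrm0.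
  have [d1 d10 d1P] := diff_eps (df p pr) (divr_gt0 d0 (ltr0n _ 4)).
  pose m := Num.min d1 s; have m0 : 0 < m by rewrite lt_min d10.
  have ms : m <= s by rewrite ge_min lexx orbT.
  have md : m <= d1 by rewrite ge_min lexx.
  have mr := le_trans ms (ltW sr).
  have [||q qm uq] := @jacobian_nondegenerate R n f p m m0.
  - by move=> q qm; apply: df; exact: lt_le_trans mr.
  - by move=> x y xm ym; apply: injf; exact: lt_le_trans mr.
  have qK : K q by apply: ltW; exact: lt_le_trans ms.
  have := proj1 (JP q) uq; rewrite -[q in J q](gf q qK) -uIm; last by exists q.
  rewrite H2 ?eqxx//.
  have fq := d1P q (lt_le_trans qm md).
  by apply: le_lt_trans (nrm_tri _ (f p) _) _; rewrite (nrmC (f p)); move: fq w0d; clear; lra.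
(* The complement of the image is open and [u] vanishes on it, so density of the nonzeros leaves no
   room for it. *)
have allIm w : nrm (w - f p) < d / 4 -> Im w.
  move=> wd; apply: contrapT => /nIm[e e0 eP].
  have [w' w'w] := dense0 w e wd e0.
  by rewrite (unIm w' (eP w' w'w)) eqxx.
have d4d w : nrm (w - f p) < d / 4 -> nrm (w - f p) < d by lra.
have [M M0 kM] : exists2 M : R, 0 <= M & forall x, K x -> nrm (k x) <= M.
  have ck x : K x -> {for x, continuous (fun y => nrm (k y - 0))}.
    by move=> /Kr xr; apply: cont_nrm_sub; exact: dk.
  have [||c _ cM] := @compact_EVT_max _ R (fun y => nrm (k y - 0)) K (ex_intro _ p Kp).
  - exact: cK.
  - by apply: continuous_in_subspaceT => z; rewrite inE; exact: ck.
  exists (nrm (k c)); first exact: nrm_ge0.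
  by move=> x xK; have := cM x; rewrite inE !subr0; apply.
pose kg w := k (g w).
have kgc w : nrm (w - f p) < d / 4 -> {for w, continuous kg}.
  move=> wd; apply/cont_nrm => e e0.
  have [xK fx] := gP w (allIm w wd).
  have [d1 d10 d1P] := diff_eps (dk _ (Kr _ xK)) e0.
  have [d2 d20 d2P] := gcont _ d1 xK d10.
  exists (Num.min d2 (d / 4 - nrm (w - f p))); first by rewrite lt_min d20 subr_gt0.
  move=> w'; rewrite lt_min => /andP[w'1 w'2].
  have w'd : nrm (w' - f p) < d / 4 by apply: le_lt_trans (nrm_tri _ w _) _; lra.
  have [gK fg] := gP w' (allIm w' w'd); apply: d1P.
  by apply: (d2P _ gK); rewrite fg fx.
(* Points [q' + t v] with |q' - f p| <= 2 rho, |t| <= 3 and |v| <= rho stay within 5 rho < d / 8. *)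
pose rho := d / 64; have rho0 : 0 < rho by rewrite divr_gt0.
suff kE : lin_est kg (f p) rho M.
  exists (d / 4), g; split; first by rewrite divr_gt0.
    move=> w wd; have [xK fx] := gP w (allIm w wd); split; last exact: fx.
    exact: Kr.
  by have [|dkg _ _] := frechet rho0 kE (q := f p); [rewrite subrr nrm0 divr_ge0// ltW|].
have [Kw cKw KwP] : exists2 Kw : set V, compact Kw & forall w, Kw w <-> nrm (w - f p) <= d / 8.
  by exists [set w | nrm (w - f p) <= d / 8]; first exact: compact_ball.
(* The line through [q] in direction [v] may lie in the zero set of [u]. A nearby [q'] with [u q']
   nonzero avoids this, and uniform continuity of [kg] lets [est_lim] return to [q]. *)
move=> q qp v vr; apply: est_lim => e e0.
have [|d1 d10 d1P] := @uniform_cont R V C Kw kg cKw _ e e0.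
  by move=> w /KwP wd; apply: kgc; lra.
have q4 : nrm (q - f p) < d / 4 by move: qp; rewrite /rho; lra.
have m0 : 0 < Num.min d1 rho by rewrite lt_min d10.
have [q' q'q uq'] := dense0 q _ q4 m0.
have q'1 : nrm (q' - q) < d1 by apply: lt_le_trans q'q _; rewrite ge_min lexx.
have q'2 : nrm (q' - q) < rho by apply: lt_le_trans q'q _; rewrite ge_min lexx orbT.
have q'p : nrm (q' - f p) <= 2 * rho.
  by apply: le_trans (nrm_tri _ q _) _; move: q'2 qp; clear; lra.
have inb (t : C) : nrm t <= 3 -> nrm (q' + t *: v - f p) < d / 8.
  move=> t3; rewrite addrAC; apply: le_lt_trans (nrmD _ _) _; rewrite nrmZ.
  have : nrm t * nrm v <= 3 * rho by apply: ler_pM; rewrite ?nrm_ge0.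
  by move: q'p rho0; rewrite /rho; clear; lra.
have inb4 (t : C) : nrm t <= 3 -> nrm (q' + t *: v - f p) < d / 4.
  by move=> /inb; move: d0; clear; lra.
exists (fun t => kg (q' + t *: v)); last first.
  move=> t t2; apply: ltW; apply: d1P.
    apply/KwP; rewrite addrAC; apply: le_trans (nrmD _ _) _; rewrite nrmZ.
    have : nrm t * nrm v <= 3 * rho.
      by apply: ler_pM; rewrite ?nrm_ge0//; move: t2; clear; lra.
    by move: qp d0; rewrite /rho; clear; lra.
  by have -> : q' + t *: v - (q + t *: v) = q' - q by rewrite opprD addrACA subrr addr0.
have lw (t : C) : nrm t <= 1 -> nrm t <= 3 by clear; lra.
apply: (@rado_est R (fun t => u (q' + t *: v))).
- split=> t t1; first by apply: cont_line; apply: uc; apply: d4d; apply: inb4; exact: lw.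
  move=> ut; apply: diff_line.
  by have [] := gdiff _ (d4d _ (inb4 t (lw t (ltW t1)))) ut.
- split=> t t1; first by apply: cont_line; apply: kgc; apply: inb4; exact: lw.
  move=> ut; apply: (@diff_line R V kg).
  by have [] := gdiff _ (d4d _ (inb4 t (lw t (ltW t1)))) ut.
- move=> w w1 e1 e10; apply: contrapT => H.
  pose m := Num.min e1 (1 - nrm w).
  have mp : 0 < m by rewrite lt_min e10 subr_gt0.
  have {}H (t : C) : nrm (t - w) < m -> u (q' + t *: v) = 0.
    rewrite lt_min => /andP[t1 t2]; apply/eqP; apply: contrapT => /negP ut.
    apply: H; exists t; split; [exact: t1| |exact: ut].
    by have := nrmD (t - w) w; rewrite subrK; move: t2; clear; lra.
  have in3 (z : C) : nrm z <= 1 -> nrm (w + 2 * z) <= 3.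
    by move=> z1; apply: le_trans (nrmD _ _) _; rewrite nrmcM nrm_n; move: w1 z1; clear; lra.
  have E (z : C) : q' + (w + 2 * z) *: v = (q' + w *: v) + z *: (2 *: v).
    by rewrite scalerA -addrA -scalerDl [z * 2]mulrC.
  (* The disc of radius 2 about [w], parametrized by t = w + 2 z, contains t = 0; vanishing near [w]
     would spread to [u q'] by the identity theorem. *)
  suff h0 : u (q' + w *: v + (- w / 2) *: (2 *: v)) = 0.
    have wz : w + 2 * (- w / 2) = 0 by have h2 := @two_neq0 R; field.
    by move: uq'; rewrite -h0 -E wz scale0r addr0 eqxx.
  apply: (@identity_disc (fun z => u (q' + w *: v + z *: (2 *: v))) (m / 2)).
  - by rewrite divr_gt0.
  - move=> z z1; apply: cont_line; apply: uc; rewrite -E; apply: d4d.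
    by apply: inb4; exact: in3.
  - move=> z z1 uz; apply: diff_line.
    have zd : nrm (q' + w *: v + z *: (2 *: v) - f p) < d.
      by rewrite -E; apply: d4d; apply: inb4; apply: in3; exact: ltW.
    by have [] := gdiff _ zd uz.
  - move=> z zm; rewrite -E; apply: H; rewrite addrAC subrr add0r nrmcM nrm_n.
    by move: zm; clear; lra.
  by rewrite nrmcM nrmV nrmN nrm_n; move: w1; clear; lra.
- move=> t t1; have t3 : nrm t <= 3 by rewrite t1; clear; lra.
  have [xK fx] := gP _ (allIm _ (inb4 t t3)).
  exact: kM.
Qed.

End Osgood.

(** * Holomorphic functions on a manifold *)

Section Manifold.
Context {R : realType} {N : nat}.
Local Notation C := (Cplx R).
Local Notation V := 'rV[C]_N.
Context {M : complex_manifold R N}.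
Implicit Types (f g : M -> C) (p q x : M).

Lemma hol_cst (a : C) : holomorphic (fun _ : M => a).
Proof. by move=> e Ae p _ ep; exact: dfC. Qed.

Lemma holD f g : holomorphic f -> holomorphic g -> holomorphic (fun x => f x + g x).
Proof. by move=> hf hg e Ae p Tp ep; exact: dfD (hf e Ae p Tp ep) (hg e Ae p Tp ep). Qed.

Lemma holB f g : holomorphic f -> holomorphic g -> holomorphic (fun x => f x - g x).
Proof. by move=> hf hg e Ae p Tp ep; exact: dfB (hf e Ae p Tp ep) (hg e Ae p Tp ep). Qed.

Lemma holM f g : holomorphic f -> holomorphic g -> holomorphic (fun x => f x * g x).
Proof. by move=> hf hg e Ae p Tp ep; exact: dfM (hf e Ae p Tp ep) (hg e Ae p Tp ep). Qed.

Lemma holX f n : holomorphic f -> holomorphic (fun x => f x ^+ n).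
Proof. by move=> hf e Ae p Tp ep; exact: dfX (hf e Ae p Tp ep). Qed.

Lemma holV f : holomorphic f -> (forall x, f x != 0) -> holomorphic (fun x => (f x)^-1).
Proof.
move=> hf f0 e Ae p Tp ep; apply: dfV (hf e Ae p Tp ep) _.
exact: f0.
Qed.

Lemma chart_ball (e : chart M V) p (A : set M) : chart_dom e p -> nbhs p A ->
  exists2 r : R, 0 < r & forall x : V, nrm (x - chart_fwd e p) < r ->
    exists q, [/\ chart_dom e q, chart_fwd e q = x & A q].
Proof.
move=> ep Ap.
have h1 : nbhs (chart_fwd e p) (chart_fwd e @` chart_dom e).
  by apply: open_nbhs_nbhs; split; [exact: chart_img_open|exists p].
have h2 : nbhs (chart_fwd e p) (chart_inv e @^-1` A).
  by apply: (chart_inv_continuous ep); rewrite chart_fwdK.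
have [r r0 rP] := proj1 (nbhs_nrm (chart_fwd e p) _) (filterI h1 h2).
exists r => // x /rP[[q eq qx] /= Ax]; exists q; split=> //.
by rewrite -(chart_fwdK eq) qx.
Qed.

Lemma hol_continuous f : holomorphic f -> continuous f.
Proof.
move=> hf p; have [e Ae ep] := atlas_cover p.
have cf : {for (chart_fwd e p), continuous (f \o chart_inv e)}.
  by apply: differentiable_continuous; exact: hf.
have cc := continuous_comp (chart_fwd_continuous ep) cf.
move=> A Afp; have := cc A; rewrite /= chart_fwdK// => /(_ Afp).
have dp : nbhs p (chart_dom e) by apply: open_nbhs_nbhs; split; [exact: chart_dom_open|].
rewrite !nbhs_simpl => cA; apply: filterS2 dp cA => x ex /=.
by rewrite chart_fwdK.
Qed.

Lemma hol_bounded f (K : set M) : holomorphic f -> compact K ->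
  exists2 B : R, 0 <= B & forall x, K x -> nrm (f x) <= B.
Proof.
move=> /hol_continuous cf cK; have [[x Kx]|K0] := pselect (K !=set0); last first.
  by exists 0 => // x Kx; case: K0; exists x.
have cn : {within K, continuous (fun x => nrm (f x))}.
  apply: continuous_subspaceT => y A An.
  have cy : {for (f y), continuous (fun z : C => nrm z)}.
    by apply: (@cont_nrmfun _ _ _ (fun z => z)); exact: cfid.
  exact: (continuous_comp (cf y) cy).
have [c _ cM] := compact_EVT_max (ex_intro _ x Kx) cK cn.
by exists (nrm (f c)) => [|y Ky]; [exact: nrm_ge0|apply: cM; rewrite inE].
Qed.

(** The Cauchy estimates in a chart depend on [f] only through [B], hence [U] serves all [f] at
    once. *)
Lemma equicontinuity p (W : set M) (B eps : R) : nbhs p W -> 0 < eps ->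
  exists2 U : set M, nbhs p U & forall f, holomorphic f ->
    (forall x, W x -> nrm (f x) <= B) -> forall x, U x -> nrm (f x - f p) <= eps.
Proof.
move=> Wp e0; have [e Ae ep] := atlas_cover p.
have [r0 r00 rP] := chart_ball ep Wp.
pose r := r0 / 4; have r_0 : 0 < r by rewrite divr_gt0.
have rr0 : 2 * r < r0 by rewrite /r; lra.
pose B1 := `|B| + 1.
have B10 : 0 < B1 by rewrite ltr_wpDl.
have BB1 : B <= B1 by have := ler_norm B; rewrite /B1; lra.
pose K := 4 * B1 / r ^+ 2 * (r / 2) + B1 / r.
have K0 : 0 < K.
  by rewrite ltr_wpDl ?divr_gt0// mulr_ge0 ?divr_ge0 ?mulr_ge0 ?exprn_ge0// ltW.
pose s := Num.min (r / 2) (eps / K).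
have s0 : 0 < s by rewrite lt_min !divr_gt0.
have sr : s <= r / 2 by rewrite ge_min lexx.
have sK : s * K <= eps by rewrite -ler_pdivlMr// ge_min lexx orbT.
have cfp : nbhs p (chart_fwd e @^-1` [set x | nrm (x - chart_fwd e p) < s]).
  by apply: (chart_fwd_continuous ep); apply/nbhs_nrm; exists s.
have dp : nbhs p (chart_dom e) by apply: open_nbhs_nbhs; split; [exact: chart_dom_open|].
exists (chart_dom e `&` (chart_fwd e @^-1` [set x | nrm (x - chart_fwd e p) < s])).
  exact: filterI.
move=> f hf fB x [ex /= xs]; set a := chart_fwd e p in rP xs *.
have kE : lin_est (f \o chart_inv e) a r B1.
  apply: hol_lin_est => // y ya.
  have [q [eq qy Wq]] := rP y (le_lt_trans ya rr0).
  rewrite -qy; split; first exact: hf.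
  by rewrite /= chart_fwdK// (le_trans (fB q Wq)).
have [|_ d1 d2] := frechet r_0 kE (q := a).
  by rewrite subrr nrm0 divr_ge0// ltW.
pose v := chart_fwd e x - a.
have vs : nrm v <= s by exact: ltW.
have vr : nrm v <= r / 2 by apply: le_trans vs sr.
have := d2 v vr; have := d1 v; rewrite /= -[a + v](addrC v) subrK !chart_fwdK//.
set D := 'd _ _ _ => h1 h2.
have -> : f x - f p = (f x - f p - D) + D by rewrite subrK.
apply: le_trans (nrmD _ _) _; apply: le_trans sK.
have v0 := nrm_ge0 v.
have h3 : 4 * B1 / r ^+ 2 * nrm v ^+ 2 <= 4 * B1 / r ^+ 2 * (r / 2) * nrm v.
  rewrite expr2 mulrA ler_wpM2r// ler_wpM2l//.
  by rewrite divr_ge0 ?mulr_ge0 ?exprn_ge0// ltW.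
apply: le_trans (_ : K * nrm v <= _); last by rewrite mulrC ler_wpM2r// ltW.
by rewrite /K mulrDl; apply: lerD => //; exact: le_trans h2 h3.
Qed.

(** Weierstrass' theorem: on a compact set of a chart all close approximants share the bound
    [B + 2], hence the same [lin_est]. *)
Lemma hol_limit f : (forall (K : set M), compact K -> forall eps : R, 0 < eps ->
    exists2 g, holomorphic g & forall x, K x -> nrm (g x - f x) <= eps) ->
  holomorphic f.
Proof.
move=> H e Ae p _ ep; have [r0 r00 rP] := chart_ball ep filterT.
set a := chart_fwd e p in rP *.
pose r := r0 / 4; have r_0 : 0 < r by rewrite divr_gt0.
have rr0 : 2 * r < r0 by rewrite /r; lra.
pose Kb := [set x : V | nrm (x - a) <= 2 * r].
pose K := chart_inv e @` Kb.
have cK : compact K.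
  apply: continuous_compact; last exact: compact_ball.
  apply: continuous_in_subspaceT => x; rewrite inE => xK.
  by have [q [eq <- _]] := rP x (le_lt_trans xK rr0); exact: chart_inv_continuous.
have [g1 hg1 g1P] := H K cK 1 ltr01.
have [B B0 BP] := hol_bounded hg1 cK.
have kE : lin_est (f \o chart_inv e) a r (B + 2).
  apply: lin_est_lim => eps e0; pose m := Num.min eps 1.
  have m0 : 0 < m by rewrite lt_min e0 ltr01.
  have [g hg gP] := H K cK m m0.
  exists (g \o chart_inv e); last first.
    move=> x xr; apply: le_trans (gP _ _) _; last by rewrite ge_min lexx.
    by exists x.
  apply: hol_lin_est => // x xr; split.
    by have [q [eq <- _]] := rP x (le_lt_trans xr rr0); exact: hg.
  have Kx : K (chart_inv e x) by exists x.
  have m1 : m <= 1 by rewrite ge_min lexx orbT.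
  rewrite /=; set y := chart_inv e x in Kx *.
  have := nrmD (g y - f y) (f y); rewrite subrK => h1.
  have := nrmD (g1 y) (f y - g1 y); rewrite addrC subrK nrmC => h2.
  have := gP y Kx; have := g1P y Kx; have := BP y Kx; lra.
by have [|dk _ _] := frechet r_0 kE (q := a); first by rewrite subrr nrm0 divr_ge0// ltW.
Qed.

Lemma holo_inverse (phi : M -> M) g : holomorphic_map phi -> injective phi ->
  holomorphic g ->
  exists2 F : M -> C, holomorphic_on (range phi) F & forall x, F (phi x) = g x.
Proof.
move=> [cphi hphi] iphi hg.
pose F y := g (xget y [set x | phi x = y]).
have Fphi x : F (phi x) = g x.
  rewrite /F; congr g; apply: iphi.
  exact: (@xgetPex _ (phi x) [set y | phi y = phi x] (ex_intro _ x erefl)).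
exists F => //.
move=> e' Ae' _ [p _ <-] e'p; have [e Ae ep] := atlas_cover p.
have Np : nbhs p (phi @^-1` chart_dom e').
  by apply: cphi; apply: open_nbhs_nbhs; split; [exact: chart_dom_open|].
have [r r0 rP] := chart_ball ep Np.
pose f := chart_fwd e' \o phi \o chart_inv e.
have df (x : V) : nrm (x - chart_fwd e p) < r -> differentiable f x.
  by move=> /rP[q [eq <- e'q]]; exact: hphi.
have dk (x : V) : nrm (x - chart_fwd e p) < r -> differentiable (g \o chart_inv e) x.
  by move=> /rP[q [eq <- e'q]]; exact: hg.
have injf (x y : V) : nrm (x - chart_fwd e p) < r -> nrm (y - chart_fwd e p) < r ->
    f x = f y -> x = y.
  move=> /rP[q [eq <- e'q]] /rP[q' [eq' <- e'q']]; rewrite /f /= !chart_fwdK//.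
  move=> /(congr1 (chart_inv e')); rewrite !chart_fwdK// => /iphi.
  by move=> ->.
have [d [gg [d0 gP dkg]]] := osgood r0 df injf dk.
have fp : f (chart_fwd e p) = chart_fwd e' (phi p) by rewrite /f /= chart_fwdK.
rewrite fp in gP dkg.
apply: near_eq_differentiable dkg; apply/nbhs_nrm; exists d => // w /gP[gr fg].
have [q [eq qE e'q]] := rP _ gr.
rewrite /= -{2}fg -qE /f /= !chart_fwdK//.
Qed.

(** The Runge hypothesis concerns [range phi] only, so the iterate is peeled off one factor at a
    time: [h1] settles [m] factors, and its transport to [range phi] is approximated on the image of
    [K]. *)
Lemma runge_iter (phi : M -> M) (m : nat) g (K : set M) (eps : R) :
  holomorphic_map phi -> injective phi -> runge_domain (range phi) ->
  holomorphic g -> compact K -> 0 < eps ->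
  exists2 h, holomorphic h & forall x, K x -> nrm (h (iter m phi x) - g x) < eps.
Proof.
move=> hphi iphi [_ rphi] hg cK.
have cphi := hphi.1.
have citer k : continuous (iter k phi).
  elim: k => [|k IH] x; first exact: cvg_id.
  exact: (continuous_comp (IH x) (cphi _)).
elim: m eps => [|m IH] eps e0.
  by exists g => // x _; rewrite /= subrr nrm0.
have e2 : 0 < eps / 2 by rewrite divr_gt0.
have [h1 hh1 h1P] := IH _ e2.
have [F hF FP] := holo_inverse hphi iphi hh1.
pose K1 := iter m.+1 phi @` K.
have cK1 : compact K1 by apply: continuous_compact => //; apply: continuous_subspaceT; exact: citer.
have K1r : K1 `<=` range phi by move=> _ [x _ <-]; exists (iter m phi x).
have [h hh hP] := rphi F hF K1 cK1 K1r _ e2.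
exists h => // x Kx; have K1x : K1 (iter m.+1 phi x) by exists x.
have a : nrm (h (iter m.+1 phi x) - h1 (iter m phi x)) < eps / 2.
  by have := hP _ K1x; rewrite cmodE [iter m.+1 _ _]/= FP nrmC.
have b := h1P x Kx; apply: le_lt_trans (nrm_tri _ (h1 (iter m phi x)) _) _.
by move: a b; set y := nrm _; set z := nrm _ => a b; lra.
Qed.

End Manifold.

(** * Separation by bounded functions *)

Section Transitivity.
Context {R : realType} {N : nat}.
Local Notation C := (Cplx R).
Context {M : complex_manifold R N}.
Implicit Types (f g : M -> C) (p q x y : M).

(** The competitors in [caratheodory_star _ z0]. *)
Definition schwarz_class z0 f :=
  [/\ holomorphic f, forall x, nrm (f x) < 1 & f z0 = 0].

Lemma moebius_identity (a b : C) :
  nrm (1 - cj b * a) ^+ 2 - nrm (a - b) ^+ 2 = (1 - nrm a ^+ 2) * (1 - nrm b ^+ 2).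
Proof. by rewrite !nrm_sqr !reimE; ring. Qed.

Lemma moebius_neq0 (a b : C) : nrm a < 1 -> nrm b < 1 -> 1 - cj b * a != 0.
Proof.
move=> a1 b1; apply: one_sub_neq0; rewrite nrmcM nrm_cj.
by have := nrm_ge0 a; have := nrm_ge0 b; nra.
Qed.

Lemma moebius_class f y : holomorphic f -> (forall x, nrm (f x) < 1) ->
  schwarz_class y (fun x => (f x - f y) / (1 - cj (f y) * f x)).
Proof.
move=> hf f1; split.
- apply: holM; first by apply: holB => //; exact: hol_cst.
  apply: holV => [|x]; last exact: moebius_neq0.
  apply: holB; first exact: hol_cst.
  by apply: holM => //; exact: hol_cst.
- move=> x; have n0 : 0 < nrm (1 - cj (f y) * f x) by rewrite nrm_gt0 moebius_neq0.
  rewrite nrmcM nrmV ltr_pdivrMr// mul1r.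
  rewrite -(@ltr_pXn2r _ 2) ?nnegrE ?nrm_ge0// -subr_gt0 moebius_identity.
  by rewrite mulr_gt0// subr_gt0 expr_lt1 ?nrm_ge0.
- by rewrite subrr mul0r.
Qed.

Lemma schwarz_local p : exists2 U : set M, nbhs p U & forall y f, U y ->
  schwarz_class y f -> forall x, U x -> nrm (f x) <= 1 / 2.
Proof.
have [|U Up UP] := @equicontinuity R N M p setT 1 (1 / 4) filterT _; first lra.
exists U => // y f Uy [hf f1 fy] x Ux.
have f1' z : [set: M] z -> nrm (f z) <= 1 by move=> _; exact: ltW.
have := UP f hf f1' x Ux; have := UP f hf f1' y Uy; rewrite fy sub0r nrmN => a b.
by have := nrmD (f x - f p) (f p); rewrite subrK; lra.
Qed.

(** A crude triangle inequality for the pseudohyperbolic distance. By [moebius_identity], (1 -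
    |a|^2)(1 - |b|^2) is at least 3/4 |1 - cj b a|^2, hence at least 3/4 (1 - |b|)^2; bounding 1 +
    |b| and 1 + |a| by 2 gives 3/16. *)
Lemma schwarz_step (a b : C) (rho : R) : nrm a < 1 -> nrm b <= rho -> 0 <= rho < 1 ->
  nrm ((a - b) / (1 - cj b * a)) <= 1 / 2 -> nrm a <= 1 - 3 / 16 * (1 - rho).
Proof.
move=> a1 br rho01; have b1 : nrm b < 1 by lra.
have n0 : 0 < nrm (1 - cj b * a) by rewrite nrm_gt0 moebius_neq0.
rewrite nrmcM nrmV ler_pdivrMr// => h.
have := moebius_identity a b.
have a0 := nrm_ge0 a; have b0 := nrm_ge0 b; have d0 := nrm_ge0 (a - b).
have lb : 1 - nrm b <= nrm (1 - cj b * a).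
  have := nrm_tri (1 : C) (cj b * a) 0; rewrite !subr0 nrm1 nrmcM nrm_cj.
  nra.
move: h lb; set A := nrm a in a1 a0 *; set B := nrm b in br b1 b0 *.
set D := nrm (1 - cj b * a); set X := nrm (a - b) => h lb E.
have e1 : X ^+ 2 <= D ^+ 2 / 4 by nra.
have e2 : (1 - B) ^+ 2 <= D ^+ 2 by nra.
have e3 : 3 / 4 * (1 - B) ^+ 2 <= (1 - A ^+ 2) * (1 - B ^+ 2) by lra.
have e4 : 3 / 4 * (1 - B) <= (1 - A ^+ 2) * (1 + B).
  have B1 : 0 < 1 - B by lra.
  rewrite -(ler_pM2l B1); have -> : (1 - B) * (3 / 4 * (1 - B)) = 3 / 4 * (1 - B) ^+ 2 by ring.
  by have -> : (1 - B) * ((1 - A ^+ 2) * (1 + B)) = (1 - A ^+ 2) * (1 - B ^+ 2) by ring.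
have e5 : 0 <= 1 - A ^+ 2 by nra.
have e6 : 3 / 8 * (1 - rho) <= 1 - A ^+ 2 by nra.
rewrite leNgt; apply/negP => lt; nra.
Qed.

(** The points where the whole class is bounded away from 1 form an open and closed set containing
    [z0]: near any point, a bound at one place yields a slightly weaker one around it. *)
Lemma schwarz_compact z0 (K : set M) : connected [set: M] -> compact K ->
  exists2 rho : R, 0 <= rho < 1 & forall f, schwarz_class z0 f ->
    forall x, K x -> nrm (f x) <= rho.
Proof.
move=> conM cK.
pose P x (rho : R) := forall f, schwarz_class z0 f -> nrm (f x) <= rho.
pose A := [set x | exists2 rho : R, 0 <= rho < 1 & P x rho].
have step p : exists2 U : set M, nbhs p U & forall y, U y -> A y ->
    exists2 rho : R, 0 <= rho < 1 & forall x, U x -> P x rho.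
  have [U Up UP] := schwarz_local p; exists U => // y Uy [rho rho01 yr].
  exists (1 - 3 / 16 * (1 - rho)); first lra.
  move=> x Ux f [hf f1 f0].
  apply: (schwarz_step (f1 x) (yr f (And3 hf f1 f0)) rho01).
  exact: (UP y _ Uy (moebius_class y hf f1) x Ux).
have oA : open A.
  rewrite openE => p Ap; have [U Up UP] := step p.
  have [rho rho01 H] := UP p (nbhs_singleton Up) Ap.
  by apply: filterS Up => x Ux; exists rho => //; exact: H.
have cA : closed A.
  move=> p clp; have [U Up UP] := step p.
  have [y [Ay Uy]] := clp U Up.
  have [rho rho01 H] := UP y Uy Ay.
  by exists rho => //; apply: H; exact: nbhs_singleton.
have AT : A = setT.
  apply: conM.
  - by exists z0, 0 => [|f [_ _ ->]]; rewrite ?nrm0// lexx ltr01.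
  - by exists A => //; rewrite setTI.
  - by exists A => //; rewrite setTI.
have /compact_near_coveringP nK := cK.
have H : \forall rho \near (1 : R)^'-, K `<=` (fun x => P x rho).
  apply: nK => x Kx; have [U Ux UP] := step x.
  have Ax : A x by rewrite AT.
  have [rho rho01 H] := UP x (nbhs_singleton Ux) Ax.
  exists (U, [set t | rho < t]).
    by split => //=; apply: nbhs_left_gt; lra.
  move=> [x' t] [/= Ux' rt] f cf; apply: le_trans (H x' Ux' f cf) _.
  exact: ltW.
near (1 : R)^'- => rho; exists rho.
  by apply/andP; split; near: rho; [apply: nbhs_left_ge|apply: nbhs_left_lt].
by move=> f cf x Kx; move: x Kx f cf; near: rho; exact: H.
Unshelve. all: by end_near. Qed.

(** 0 and 1 are fixed points with derivative 0, and z -> 1 - z conjugates the polynomial to itself,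
    so estimates near 0 carry over to 1. *)
Definition smooth_step (z : C) : C := 3 * z ^+ 2 - 2 * z ^+ 3.

Lemma smooth_step_small m (z : C) : nrm z <= 1 / 4 ->
  nrm (iter m smooth_step z) <= (7 / 8) ^+ m / 4.
Proof.
move=> z4; elim: m => [|m IH]; first by rewrite expr0 /=.
rewrite iterS; set w := iter m _ _ in IH *.
have q1 : (7 / 8) ^+ m <= 1 :> R by apply: exprn_ile1; lra.
have w4 : nrm w <= 1 / 4 by lra.
have -> : smooth_step w = w * (3 * w - 2 * w ^+ 2) by rewrite /smooth_step; ring.
rewrite nrmcM; have w0 := nrm_ge0 w.
(* 3/4 + 2/16 = 7/8. *)
have : nrm (3 * w - 2 * w ^+ 2) <= 7 / 8.
  by apply: le_trans (nrmB _ _) _; rewrite !nrmcM !nrm_n; nra.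
move=> h; apply: le_trans (ler_wpM2l w0 h) _.
by move: IH; rewrite [(7 / 8) ^+ m.+1]exprS; set Q := (7 / 8) ^+ m; lra.
Qed.

Lemma smooth_step_one m (z : C) : nrm (1 - z) <= 1 / 4 ->
  nrm (1 - iter m smooth_step z) <= (7 / 8) ^+ m / 4.
Proof.
move=> /(smooth_step_small m); congr (nrm _ <= _).
elim: m => [//|m IH]; rewrite !iterS IH.
by rewrite /smooth_step; ring.
Qed.

Lemma hol_smooth_step m f : holomorphic f -> holomorphic (fun x => iter m smooth_step (f x)).
Proof.
move=> hf; elim: m => [//|m IH].
have -> : (fun x => iter m.+1 smooth_step (f x)) = (fun x =>
    3 * iter m smooth_step (f x) ^+ 2 - 2 * iter m smooth_step (f x) ^+ 3) by [].
by apply: holB; (apply: holM; [exact: hol_cst|exact: holX]).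
Qed.

Lemma pow_near_one (k : nat) : exists2 s : R, 0 < s &
  forall z : C, nrm (z - 1) < s -> nrm (1 - z ^+ k) <= 1 / 4.
Proof.
have d : differentiable (fun z : C => z ^+ k) (1 : C) by apply: dfX; exact: dfid.
have [s s0 sP] := diff_eps d (ltac:(lra) : 0 < 1 / 4 :> R).
by exists s => // z /sP; rewrite expr1n nrmC => /ltW.
Qed.

Lemma caratheodory_witness z0 (th : R) :
  tends_to_infty_at_infty (fun z : M => caratheodory z z0) -> 0 < th < 1 ->
  exists2 L : set M, compact L & forall z, ~ L z ->
    exists2 f, schwarz_class z0 f & 1 - th < nrm (f z).
Proof.
move=> /tends_to_infty_at_inftyP lim th01.
(* If the supremum [c] were at most [1 - th], then (1 + c) / (1 - c) <= 2 / th would bound the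
   Caratheodory distance by the second term; the 1 only ensures [0 < r]. *)
pose r := Num.max 1 (2^-1 * ln (2 / th)).
have r0 : 0 < r by rewrite lt_max ltr01.
have [L cL LP] := lim r r0; exists L => // z /LP.
set S := [set cmod (F z) | F in [set F : M -> C |
    [/\ holomorphic F, forall x, cmod (F x) < 1 & F z0 = 0]]].
have S0 : S 0.
  exists (fun=> 0); last by rewrite cmodE nrm0.
  by split=> [|x|//]; [exact: hol_cst|rewrite cmodE nrm0 ltr01].
have hS : has_sup S.
  by split; [exists 0|exists 1 => _ [F [_ F1 _] <-]; exact: ltW].
rewrite /caratheodory -[caratheodory_star z z0]/(sup S); set c := sup S => rc.
have c0 : 0 <= c by apply: ub_le_sup S0; exact: hS.2.
have cth : 1 - th < c.
  rewrite ltNge; apply/negP => cth; move: rc; apply/negP; rewrite -leNgt.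
  rewrite /r le_max; apply/orP; right; rewrite ler_pM2l ?invr_gt0//.
  rewrite ler_ln ?posrE; [|by rewrite divr_gt0//; lra|by rewrite divr_gt0//; lra].
  rewrite ler_pdivrMr; last lra.
  have -> : 2 / th * (1 - c) = 2 * ((1 - c) / th) by ring.
  have : 1 <= (1 - c) / th by rewrite ler_pdivlMr; lra.
  lra.
have [_ [F [hF F1 F0] <-]] := sup_adherent (ltac:(lra) : 0 < c - (1 - th)) hS.
rewrite -/c cmodE => h; exists F; last lra.
by split=> // x; rewrite -cmodE.
Qed.

Lemma transitivity z0 (phi : M -> M) (n : nat -> nat) f g (K : set M) (eps : R) :
  connected [set: M] -> tends_to_infty_at_infty (fun z : M => caratheodory z z0) ->
  holomorphic_map phi -> injective phi -> runge_domain (range phi) -> run_away phi n ->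
  holomorphic f -> holomorphic g -> compact K -> 0 < eps ->
  exists l h, [/\ holomorphic h, forall x, K x -> nrm (h x - f x) < eps &
    forall x, K x -> nrm (h (iter (n l) phi x) - g x) < eps].
Proof.
move=> conM lim hphi iphi rphi run hf hg cK e0.
pose K1 := K `|` [set z0].
have cK1 : compact K1 by apply: compactU => //; exact: compact_set1.
have [rho rho01 rhoP] := schwarz_compact z0 conM cK1.
(* A lower bound for |b| fixed before [b] exists: on [K] then |F / b| <= rho / be < 1, so the power
   [k] can be chosen now. *)
pose be := (1 + rho) / 2; have be01 : rho < be /\ be < 1 by rewrite /be; lra.
have q01 : 0 <= rho / be < 1.
  by rewrite divr_ge0 /=; [rewrite ltr_pdivrMr; lra|lra|lra].
have [k /(_ k (leqnn k)) kP] := expr_lt_eps 1 q01 (ltac:(lra) : 0 < 1 / 4 :> R).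
have [s s0 sP] := pow_near_one k.
(* The first bound gives |b| >= be. For the second, with w = F (psi x) and D = |1 - cj b w|,
   Schwarz-Pick gives |w - b| <= rho D and then D (1 - rho) <= 1 - |b|^2 <= 2 th, so that |w / b -
   1| < s. *)
pose th := Num.min ((1 - rho) / 2) (s * be * (1 - rho) / 4).
have th0 : 0 < th.
  rewrite lt_min; apply/andP; split; first lra.
  by rewrite divr_gt0// mulr_gt0 ?mulr_gt0//; lra.
have th1 : th <= (1 - rho) / 2 by rewrite ge_min lexx.
have th2 : th <= s * be * (1 - rho) / 4 by rewrite ge_min lexx orbT.
have [L cL LP] := caratheodory_witness lim (ltac:(lra) : 0 < th < 1).
(* Running away from a compact set that contains both [z0] and [L] forces [psi z0] out of [L]. *)
have cK2 : compact (K1 `|` L) by exact: compactU.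
have [l lP] := run _ cK2.
pose psi := iter (n l) phi.
have z0L : ~ L (psi z0).
  move=> Lz; have : ((psi @` (K1 `|` L)) `&` (K1 `|` L)) (psi z0).
    by split; [exists z0 => //; left; right|right].
  by rewrite /psi lP.
have [F [hF F1 F0] Fb] := LP _ z0L; set b := F (psi z0) in Fb.
have b1 : nrm b < 1 := F1 _.
have bbe : be <= nrm b by rewrite /be; lra.
have b0 : 0 < nrm b by lra.
have bn0 : b != 0 by rewrite -nrm_gt0.
have hpsi (u : M -> C) : holomorphic u -> holomorphic (u \o psi).
  rewrite /psi; elim: (n l) u => [//|i IH] u hu.
  exact: (IH (u \o phi) (holomorphic_comp hphi hu)).
have cpsi : continuous psi.
  have cphi := hphi.1; rewrite /psi; elim: (n l) => [|i IH] x; first exact: cvg_id.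
  exact: (continuous_comp (IH x) (cphi _)).
pose v x := (F x / b) ^+ k.
have hv : holomorphic v by apply: holX; exact: holM hF (hol_cst _).
have vK x : K x -> nrm (v x) <= 1 / 4.
  move=> Kx; rewrite nrmX; apply: le_trans (ltW kP); rewrite mul1r.
  apply: lerXn2r; rewrite ?nnegrE ?nrm_ge0//; first by case/andP: q01.
  rewrite nrmcM nrmV; apply: ler_pM; rewrite ?nrm_ge0 ?invr_ge0 ?nrm_ge0//.
    by apply: rhoP; [split|left].
  by rewrite lef_pV2 ?posrE//; lra.
have vpsi x : K x -> nrm (1 - v (psi x)) <= 1 / 4.
  move=> Kx; apply: sP.
  (* [F \o psi], recentred at [z0], is again in the class, so the same [rho] bounds it on [K]. *)
  have cls := moebius_class z0 (hpsi F hF) (fun x => F1 (psi x)).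
  have := rhoP _ cls x (or_introl Kx); rewrite /= -/b; set w := F (psi x).
  have w1 : nrm w < 1 := F1 _.
  have D0 : 0 < nrm (1 - cj b * w) by rewrite nrm_gt0 moebius_neq0.
  rewrite nrmcM nrmV ler_pdivrMr// => h.
  have -> : w / b - 1 = (w - b) / b by field.
  have D1 : nrm (1 - cj b * w) <= (1 - nrm b ^+ 2) + rho * nrm (1 - cj b * w).
    have -> : 1 - cj b * w = rc (1 - nrm b ^+ 2) - cj b * (w - b).
      by rewrite rcB rc1 -mul_cj; ring.
    apply: le_trans (nrmB _ _) _; rewrite nrm_rc ger0_norm; last by nra.
    rewrite lerD2l nrmcM nrm_cj.
    have -> : rc (1 - nrm b ^+ 2) - cj b * (w - b) = 1 - cj b * w.
      by rewrite rcB rc1 -mul_cj; ring.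
    by apply: le_trans h; have := nrm_ge0 (w - b); nra.
  have D2 : nrm (1 - cj b * w) * (1 - rho) <= 2 * th by nra.
  rewrite nrmcM nrmV ltr_pdivrMr//.
  apply: le_lt_trans h _; have r1 : 0 < 1 - rho by lra.
  rewrite -(ltr_pM2r r1).
  have t1 : rho * nrm (1 - cj b * w) * (1 - rho) <= 2 * th by nra.
  apply: le_lt_trans t1 _.
  have t2 : s * be * (1 - rho) <= s * nrm b * (1 - rho).
    by rewrite ler_pM2r// ler_pM2l.
  have t3 : 0 < s * be * (1 - rho) by rewrite mulr_gt0 ?mulr_gt0//; lra.
  lra.
have e2 : 0 < eps / 2 by rewrite divr_gt0.
have [g1 hg1 g1P] := runge_iter (n l) hphi iphi rphi hg cK e2.
have hgf : holomorphic (fun x => g1 x - f x) by exact: holB.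
have cpK : compact (psi @` K).
  by apply: continuous_compact => //; apply: continuous_subspaceT.
have [B B0 BP] := hol_bounded hgf (compactU cK cpK).
have q78 : 0 <= (7 / 8 : R) < 1 by lra.
have [m /(_ m (leqnn m)) mP] := expr_lt_eps (B + 1) q78 e2.
pose P x := iter m smooth_step (v x).
have hP : holomorphic P by exact: hol_smooth_step.
have Q0 : 0 <= (7 / 8) ^+ m :> R by rewrite exprn_ge0//; lra.
exists l, (fun x => f x + (g1 x - f x) * P x); split.
- exact: holD hf (holM hgf hP).
- move=> x Kx; rewrite addrC addKr nrmcM.
  have := BP x (or_introl Kx); have := smooth_step_small m (vK x Kx).
  rewrite -/(P x); have := nrm_ge0 (P x); have := nrm_ge0 (g1 x - f x).
  set X := nrm _; set Y := nrm _; set Q := (7 / 8) ^+ m in mP Q0 *; nra.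
move=> x Kx; rewrite -/psi; set y := psi x.
have Ky : (psi @` K) y by exists x.
have -> : f y + (g1 y - f y) * P y - g x = (g1 y - g x) - (g1 y - f y) * (1 - P y) by ring.
apply: le_lt_trans (nrmB _ _) _; rewrite nrmcM.
have := g1P x Kx; rewrite -/psi -/y.
have := BP y (or_intror Ky); have := smooth_step_one m (vpsi x Kx).
rewrite -/y -/(P y); have := nrm_ge0 (1 - P y); have := nrm_ge0 (g1 y - f y).
set X := nrm (g1 y - f y); set Y := nrm (1 - P y); set Z := nrm (g1 y - g x).
by set Q := (7 / 8) ^+ m in mP Q0 *; nra.
Qed.

End Transitivity.

(** * Universal functions *)

Section Separability.
Context {R : realType} {N : nat}.
Local Notation C := (Cplx R).
Context {M : complex_manifold R N}.
Implicit Types (f g : M -> C) (p q x y : M).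

Lemma finite_subcover (K : set M) (U : M -> set M) : compact K ->
  (forall x, K x -> nbhs x (U x)) ->
  exists xs : seq M, forall x, K x -> exists p, [/\ p \in xs, K p & U p x].
Proof.
move=> /compact_near_coveringP cK UP.
(* With the filter of finite sequences ordered by inclusion, near-covering compactness is the finite
   subcover property. *)
pose F : set_system (seq M) := [set P : set (seq M) |
  exists xs : seq M, forall ys : seq M, {subset xs <= ys} -> P ys].
have FF : Filter F.
  split.
  - by exists [::].
  - move=> P Q [xs xsP] [ys ysP]; exists (xs ++ ys) => zs sub; split.
      by apply: xsP => x xx; apply: sub; rewrite mem_cat xx.
    by apply: ysP => x xx; apply: sub; rewrite mem_cat xx orbT.
  - by move=> P Q PQ [xs xsP]; exists xs => ys /xsP /PQ.
pose P (ys : seq M) x := exists p, [/\ p \in ys, K p & U p x].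
have : \forall ys \near F, K `<=` P ys.
  apply: cK => x Kx; exists (U x, [set ys : seq M | x \in ys]).
    split=> /=; first exact: UP.
    by exists [:: x] => ys; apply; rewrite mem_head.
  by move=> [y ys] [/= Uy xys]; exists x.
by move=> [xs xsP]; exists xs; apply: xsP.
Qed.

Lemma finite_net (K K' : set M) (B eps : R) : compact K -> K `<=` interior K' -> 0 < eps ->
  exists xs : seq M, forall x, K x -> exists2 p, p \in xs &
    forall f, holomorphic f -> (forall y, K' y -> nrm (f y) <= B) ->
      nrm (f x - f p) <= eps.
Proof.
move=> cK KK' e0.
have /choice[U UP] : forall p, exists U : set M, K p -> nbhs p U /\ forall f, holomorphic f ->
    (forall y, K' y -> nrm (f y) <= B) -> forall x, U x -> nrm (f x - f p) <= eps.
  move=> p; have [Kp|nK] := pselect (K p); last by exists setT.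
  have [U Up UP] := @equicontinuity _ _ _ p K' B eps (KK' p Kp) e0.
  by exists U.
have [|xs xsP] := @finite_subcover K U cK; first by move=> p /UP[].
exists xs => x /xsP[p [px Kp Upx]]; exists p; first exact: px.
by move=> f hf fB; exact: (UP p Kp).2.
Qed.

(** A code of [f] in a countable type: its values at the sample points, rounded to the mesh
    [eps]. *)
Definition pattern (eps : R) (xs : seq M) f : seq (int * int) :=
  [seq (Num.floor (re (f p) / eps), Num.floor (im (f p) / eps)) | p <- xs].

Lemma floor_close (eps a b : R) : 0 < eps -> Num.floor (a / eps) = Num.floor (b / eps) ->
  `|a - b| <= eps.
Proof.
move=> e0 E; have /andP[h1 h2] := Num.Theory.floor_itv (a / eps).
have /andP[h3 h4] := Num.Theory.floor_itv (b / eps).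
rewrite -E in h3 h4; rewrite intrD in h2 h4.
have -> : a - b = (a / eps - b / eps) * eps by field; rewrite gt_eqF.
rewrite normrM (gtr0_norm e0) ger_pMl// ler_norml.
move: h1 h2 h3 h4; set x := a / eps; set y := b / eps; set z := _%:~R.
by move=> *; apply/andP; split; lra.
Qed.

Lemma pattern_close (eps : R) (xs : seq M) f g : 0 < eps ->
  pattern eps xs f = pattern eps xs g -> forall p, p \in xs -> nrm (f p - g p) <= 2 * eps.
Proof.
move=> e0 /eq_in_map E p /E[E1 E2]; apply: le_trans (nrm_le_reim _) _; rewrite reB imB.
by have := floor_close e0 E1; have := floor_close e0 E2; lra.
Qed.

(** [D] picks one function for each code made of a level, a bound, a mesh and a pattern (0 if none
    has that code). Two functions with the same code differ on [E j] by at most 1 + 2 + 1 times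
    [m.+1%:R^-1]: twice the oscillation over the net, and the rounding. *)
Lemma holomorphic_separable (E : nat -> set M) : (forall j, compact (E j)) ->
  (forall j, E j `<=` interior (E j.+1)) ->
  exists D : nat -> M -> C, (forall i, holomorphic (D i)) /\
    forall f, holomorphic f -> forall j (eps : R), 0 < eps ->
      exists i, forall x, E j x -> nrm (D i x - f x) <= eps.
Proof.
move=> cE EE.
have inv0 m : 0 < m.+1%:R^-1 :> R by rewrite invr_gt0 ltr0n.
have /choice[net netP] : forall t : nat * nat * nat, exists xs : seq M,
    forall x, E t.1.1 x -> exists2 p, p \in xs &
    forall f, holomorphic f -> (forall y, E t.1.1.+1 y -> nrm (f y) <= t.1.2%:R) ->
      nrm (f x - f p) <= t.2.+1%:R^-1.
  by move=> t; exact: finite_net.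
pose good (t : nat * nat * nat * seq (int * int)) f :=
  [/\ holomorphic f, forall y, E t.1.1.1.+1 y -> nrm (f y) <= t.1.1.2%:R &
    pattern t.1.2.+1%:R^-1 (net t.1) f = t.2].
pose D i : M -> C := if unpickle i is Some t then xget (fun=> 0) (good t) else fun=> 0.
exists D; split=> [i|f hf j eps e0].
  rewrite /D; case: (unpickle i) => [t|]; last exact: hol_cst.
  by case: xgetP => [g _ []//|_]; exact: hol_cst.
have [B0 B00 B0P] := hol_bounded hf (cE j.+1).
pose B := (Num.truncn B0).+1.
have BB : B0 <= B%:R by apply/ltW; exact: truncnS_gt.
pose m := Num.truncn (4 / eps).
have me : 4 * m.+1%:R^-1 <= eps.
  rewrite ler_pdivrMr ?ltr0n// mulrC -ler_pdivrMr//.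
  by apply/ltW; exact: truncnS_gt.
pose t : nat * nat * nat * seq (int * int) :=
  (j, B, m, pattern m.+1%:R^-1 (net (j, B, m)) f).
have gf : good t f by split=> // y Ey; exact: le_trans (B0P y Ey) BB.
exists (pickle t) => x Ex.
have [hg gB gp] : good t (D (pickle t)).
  rewrite /D pickleK; exact: (@xgetPex _ (fun=> 0) (good t) (ex_intro _ f gf)).
set g := D _ in hg gB gp *.
have [p pn pP] := netP (j, B, m) x Ex.
have h1 := pP g hg gB.
have h2 : nrm (f x - f p) <= m.+1%:R^-1 by apply: pP => //; case: gf.
have h3 := pattern_close (inv0 m) gp pn.
have -> : g x - f x = (g x - g p) + (g p - f p) - (f x - f p) by ring.
apply: le_trans (nrmB _ _) _; apply: le_trans me.
have := nrmD (g x - g p) (g p - f p).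
move: h1 h2 h3 => /=; set e := m.+1%:R^-1; lra.
Qed.

Lemma compact_in_exhaustion (E : nat -> set M) (K : set M) :
  (forall j, E j `<=` interior (E j.+1)) -> \bigcup_j E j = setT -> compact K ->
  exists j, K `<=` E j.
Proof.
move=> EE ET cK.
have Emon i j : (i <= j)%N -> E i `<=` E j.
  move=> /subnK <-; elim: (j - i)%N => [//|k IH] x /IH /EE.
  exact: interior_subset.
have : \forall j \near \oo, K `<=` E j.
  move: cK => /compact_near_coveringP; apply => x Kx.
  have : (\bigcup_j E j) x by rewrite ET.
  move=> [i _ /EE Ex]; exists (E i.+1, [set j | (i < j)%N]).
    by split=> //=; exists i.+1.
  by move=> [y j] [/= Ey ij]; exact: (Emon _ _ ij).
by move=> [j _ jP]; exists j; apply: jP => /=.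
Qed.

(* The state [(f, L, eta)] records the current approximant, the compact set on which it
   may no longer be changed, and by how much it may still be changed there. *)
Lemma universal_function (psi : nat -> M -> M) (E : nat -> set M) :
  (forall j, compact (E j)) -> (forall j, E j `<=` interior (E j.+1)) ->
  \bigcup_j E j = setT -> (forall l, continuous (psi l)) ->
  (forall f g (K : set M) (eps : R), holomorphic f -> holomorphic g -> compact K ->
    0 < eps -> exists l h, [/\ holomorphic h, forall x, K x -> nrm (h x - f x) < eps &
      forall x, K x -> nrm (h (psi l x) - g x) < eps]) ->
  exists2 f, holomorphic f & forall g (K : set M) (eps : R), holomorphic g -> compact K ->
    0 < eps -> exists l, forall x, K x -> nrm (f (psi l x) - g x) < eps.
Proof.
move=> cE EE ET cpsi T.
have [D [hD DP]] := holomorphic_separable cE EE.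
(* The triple (i, j, m) asks for [D i] to be approximated on [E j] up to 1 / (m+1); numbers that
   code nothing repeat the triple of zeros. *)
pose tgt t : nat * nat * nat := odflt (0%N, 0%N, 0%N) (unpickle t).
pose del t : R := (tgt t).2.+1%:R^-1.
have del0 t : 0 < del t by rewrite invr_gt0 ltr0n.
pose st := ((M -> C) * set M * R)%type.
pose ok (s : st) := [/\ holomorphic s.1.1, compact s.1.2 & 0 < s.2].
pose rel (a : nat * st) (s' : st) := let s := a.2 in ok s -> ok s' /\
  [/\ s'.2 <= s.2 / 2, s'.2 <= del a.1 / 2, s.1.2 `<=` s'.1.2, E a.1 `<=` s'.1.2 &
      (forall x, s.1.2 x -> nrm (s'.1.1 x - s.1.1 x) <= s.2 / 2) /\
      exists l, forall x, E (tgt a.1).1.2 x -> s'.1.2 (psi l x) /\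
        nrm (s'.1.1 (psi l x) - D (tgt a.1).1.1 x) <= del a.1 / 2].
have /choice[nxt nxtP] : forall a, exists s', rel a s'.
  move=> [t [[f L] eta]]; have [oks|nok] := pselect (ok (f, L, eta)); last first.
    by exists (f, L, eta) => s oks; case: (nok oks).
  have [/= hf cL eta0] := oks.
  set j := (tgt t).1.2; set i := (tgt t).1.1.
  pose K := L `|` E j; have cK : compact K by exact: compactU.
  pose e := Num.min (eta / 2) (del t / 2).
  have e0 : 0 < e by rewrite lt_min !divr_gt0.
  have ee : e <= eta / 2 by rewrite ge_min lexx.
  have ed : e <= del t / 2 by rewrite ge_min lexx orbT.
  have [l [h [hh h1 h2]]] := T f (D i) K e hf (hD i) cK e0.
  exists (h, L `|` E t `|` (psi l @` E j), e) => s _; split.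
    split=> //=; apply: compactU; first exact: compactU.
    by apply: continuous_compact => //; exact: continuous_subspaceT.
  split=> //=; [by move=> x Lx; left; left|by move=> x Ex; left; right|split].
    by move=> x Lx; apply: le_trans (ltW (h1 x (or_introl Lx))) _.
  exists l => x Ex; split; first by right; exists x.
  exact: le_trans (ltW (h2 x (or_intror Ex))) ed.
pose u := fix u t : st := if t is t'.+1 then nxt (t', u t') else (fun=> 0, set0, 1).
have uok t : ok (u t).
  elim: t => [|t IH]; last by have [] := nxtP (t, u t) IH.
  by split; [exact: hol_cst|exact: compact0|exact: ltr01].
have uS t := (nxtP (t, u t) (uok t)).2.
pose F t := (u t).1.1; pose L t := (u t).1.2; pose eta t := (u t).2.
have eta0 t : 0 < eta t by have [] := uok t.
have Lmon t k : L t `<=` L (t + k)%N.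
  elim: k => [|k IH]; first by rewrite addn0.
  rewrite addnS => x /IH Lx.
  by have [_ _ + _ _] := uS (t + k)%N; apply.
(* One stage uses at most half of the tolerance, and the next tolerance is at most the other
   half. *)
have FC k : forall t x, L t x -> nrm (F (t + k)%N x - F t x) <= eta t.
  elim: k => [|k IH] t x Lx; first by rewrite addn0 subrr nrm0 ltW.
  have [h1 _ h2 _ [h3 _]] := uS t.
  rewrite addnS -addSn; apply: le_trans (nrm_tri _ (F t.+1 x) _) _.
  have := IH t.+1 x (h2 x Lx); have := h3 x Lx; move: h1.
  rewrite -/(eta t) -/(F t) -[(nxt _).2]/(eta t.+1) -[(nxt _).1.1]/(F t.+1); lra.
have ELt t x : E t x -> L t.+1 x by have [_ _ _ + _] := uS t; apply.
have Lx0 x : exists t, L t x.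
  have : (\bigcup_j E j) x by rewrite ET.
  by move=> [t _ Ex]; exists t.+1; exact: ELt.
have etaS t : eta t.+1 <= eta t / 2 by have [] := uS t.
have etalim (e : R) t : 0 < e -> exists2 k, (t <= k)%N & eta k < e.
  move=> e0; have eb k : eta k <= (1 / 2) ^+ k.
    elim: k => [|k IH]; first by rewrite expr0.
    by apply: le_trans (etaS k) _; rewrite exprSr; move: IH; set y := (1 / 2) ^+ k; lra.
  have q01 : 0 <= (1 / 2 : R) < 1 by lra.
  have [k kP] := expr_lt_eps 1 q01 e0; exists (t + k)%N; first exact: leq_addr.
  by apply: le_lt_trans (eb _) _; have := kP (t + k)%N (leq_addl _ _); rewrite mul1r.
(* Any cluster value [y] of the bounded sequence [F t x] satisfies the estimates for all [t] at
   once, since they hold along all later stages. *)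
have /choice[f fP] : forall x, exists y : C, forall t, L t x -> nrm (F t x - y) <= eta t.
  move=> x; have [t0 Lt0] := Lx0 x.
  pose Bd := nrm (F t0 x) + eta t0.
  have FB k : nrm (F (t0 + k)%N x) <= Bd.
    have := FC k t0 x Lt0; have := nrmD (F (t0 + k)%N x - F t0 x) (F t0 x).
    by rewrite subrK /Bd; lra.
  have [y _ yP] := cluster_seq FB; exists y => t Lt.
  apply/ler_addgt0Pr => e e0; have [k tk ke] := yP e e0 t.
  have tk' : (t <= t0 + k)%N by apply: leq_trans tk (leq_addl _ _).
  have := FC (t0 + k - t)%N t x Lt; rewrite subnKC// nrmC => h.
  apply: le_trans (nrm_tri _ (F (t0 + k)%N x) _) _.
  by apply: lerD => //; exact: ltW.
exists f.
  apply: hol_limit => K cK e e0.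
  have [j jP] := compact_in_exhaustion EE ET cK.
  have [k jk ke] := etalim e j.+1 e0.
  exists (F k); first by have [] := uok k.
  move=> x Kx; apply: le_trans (ltW ke); apply: fP.
  by rewrite -(subnKC jk); apply: Lmon; apply: ELt; exact: jP.
move=> g K e hg cK e0.
have [j jP] := compact_in_exhaustion EE ET cK.
have [i iP] := DP g hg j (e / 3) (ltac:(lra)).
pose m := Num.truncn (3 / e).
have me : m.+1%:R^-1 < e / 3.
  by rewrite invf_plt ?posrE ?ltr0n ?divr_gt0// invf_div; exact: truncnS_gt.
pose t := pickle (i, j, m).
have tE : tgt t = (i, j, m) by rewrite /tgt pickleK.
have [h1 h2 _ _ [_ [l lP]]] := uS t.
exists l => x Kx; have Ex := jP x Kx.
have := lP x; rewrite /= tE /= => /(_ Ex)[Lx h3].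
have h4 := fP _ t.+1 Lx; have h5 := iP x Ex.
have dE : del t = m.+1%:R^-1 by rewrite /del tE.
have h6 : eta t.+1 <= del t / 2 := h2.
rewrite dE in h3 h6; rewrite -/(F t.+1) in h3.
set y := psi l x in h3 h4 *.
have -> : f y - g x = (F t.+1 y - D i x) - (F t.+1 y - f y) + (D i x - g x) by ring.
apply: le_lt_trans (nrmD _ _) _.
have := nrmB (F t.+1 y - D i x) (F t.+1 y - f y).
have h7 : nrm (F t.+1 y - D i x) <= m.+1%:R^-1 / 2 := h3.
move: h4 h5 h6 h7 me; set z := m.+1%:R^-1; lra.
Qed.

End Separability.

(** * From approximation on compact sets to density *)

Section Density.
Context {R : realType} {N : nat}.
Local Notation C := (Cplx R).
Context {M : complex_manifold R N}.

(** The filter [F] generated by the basic neighbourhoods of [g] converges to [g] uniformly on every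
    compact set, so every neighbourhood of [g] belongs to it. *)
Lemma compact_open_nbhs (g : {family compact, M -> C}) (W : set {family compact, M -> C}) :
  nbhs g W -> exists K (eps : R), [/\ compact K, 0 < eps &
    forall h : M -> C, (forall x, K x -> nrm (h x - g x) < eps) -> W h].
Proof.
pose F : set_system (M -> C) := [set P | exists K (eps : R), [/\ compact K, 0 < eps &
    forall h : M -> C, (forall x, K x -> nrm (h x - g x) < eps) -> P h]].
have FF : Filter F.
  split.
  - by exists set0, 1; split=> //; exact: compact0.
  - move=> P Q [K [e [cK e0 KP]]] [K' [e' [cK' e'0 KQ]]].
    exists (K `|` K'), (Num.min e e'); split.
    + exact: compactU.
    + by rewrite lt_min e0.
    + move=> h hP; split; [apply: KP|apply: KQ] => x Kx.
        by have := hP x (or_introl Kx); rewrite lt_min => /andP[].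
      by have := hP x (or_intror Kx); rewrite lt_min => /andP[].
  - by move=> P Q PQ [K [e [cK e0 KP]]]; exists K, e; split=> // h /KP /PQ.
suff : {family compact, F --> (g : M -> C)} by move=> H /H.
apply/fam_cvgP => K cK P /uniform_nbhs[E [entE EP]].
have [e e0 eE] : exists2 e : R, 0 < e & forall a b : C, nrm (b - a) < e -> E (a, b).
  move: entE; rewrite -entourage_ballE => -[e /= e0 eE].
  have eR : e = rc (re e).
    by apply: eqC => //; rewrite im_rc; move: e0; rewrite ltcE => /andP[/eqP].
  exists (re e); first by move: e0; rewrite ltcE => /andP[].
  move=> a b ab; apply: eE; rewrite /= -ball_normE /ball_ /= nrmE eR ltcR.
  by rewrite nrmC.
exists K, e; split=> // h hP; apply: EP => y Ky; apply: eE.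
exact: hP.
Qed.

Lemma iter_composition (phi : M -> M) (hphi : holomorphic_map phi) (f : holo_space M) m :
  holo_fun (iter m (composition_operator hphi) f) = holo_fun f \o iter m phi.
Proof.
elim: m => [//|m IH]; apply/funext => x.
rewrite iterS -[LHS]/((holo_fun (iter m (composition_operator hphi) f)) (phi x)) IH.
by rewrite /= -iterSr.
Qed.

Lemma hypercyclic_of_universal (phi : M -> M) (hphi : holomorphic_map phi) (n : nat -> nat)
    (f : M -> C) : holomorphic f ->
  (forall g (K : set M) (eps : R), holomorphic g -> compact K -> 0 < eps ->
    exists l, forall x, K x -> nrm (f (iter (n l) phi x) - g x) < eps) ->
  hypercyclic_along hphi n.
Proof.
move=> hf fP.
pose f' : holo_space M := exist _ (f : {family compact, M -> C}) (mem_set hf).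
exists f' => O [g Og] [W oW WO].
have Wg : W (set_val g) by move: Og; rewrite -WO.
have [K [e [cK e0 KW]]] := compact_open_nbhs (open_nbhs_nbhs (conj oW Wg)).
have [l lP] := fP (holo_fun g) K e (holo_funP g) cK e0.
exists (iter (n l) (composition_operator hphi) f'); split; last by exists l.
rewrite -WO; apply: KW => x Kx.
have := lP x Kx; have := iter_composition hphi f' (n l).
by move=> /(congr1 (fun h => h x)); rewrite /holo_fun => ->.
Qed.

End Density.

Theorem theorem4p2 (R : realType) (N : nat) (Omega : complex_manifold R N) :
  connected_stein Omega ->
  (exists z0 : Omega,
     tends_to_infty_at_infty (fun z : Omega => caratheodory z z0)) ->
  class_S Omega.
Proof.
move=> stO [z0 lim]; split=> // phi hphi n _ iphi rphi run.
have [conO [[E [cE EE ET]] _ _ _]] := stO.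
have cphi m : continuous (iter m phi).
  elim: m => [|m IH] x; first exact: cvg_id.
  exact: (continuous_comp (IH x) (hphi.1 _)).
have [f hf fP] := @universal_function R N Omega (fun l => iter (n l) phi) E cE EE ET
  (fun l => cphi (n l)) (fun f g K eps hf hg cK e0 =>
    transitivity conO lim hphi iphi rphi run hf hg cK e0).
exact: hypercyclic_of_universal hf fP.
Qed.
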